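(* Let $\tau=\frac{-b+\sqrt{-d}}{2a}$ where $a,b,c$ are mutually coprime integers with $a>0$, $a\tau^2+b\tau+c=0$ and $-d=b^2-4ac$, and suppose $\tau$ lies in $C_{1/(1-u),\infty}$. Then $$\frac{F^2}{6}\left[(u+3)-\frac{u^2+18u-27}{u-9}s_2(\tau)\right]-u(u-1)\frac{d}{du}F^2=\frac{a}{\pi\sqrt{d}}(u-1),$$ where $u=u(\tau)$, $F={}_2F_1\!\left(\frac13,\frac23;1;\frac{1}{1-u}\right)$, and $\frac{d}{du}F^2$ denotes the derivative of $x\mapsto{}_2F_1(\frac13,\frac23;1;\frac{1}{1-x})^2$ evaluated at $x=u(\tau)$.
   Context: $\mathfrak H$ is the upper half-plane, $q=e^{2\pi i\tau}$, $E_2=1-24\sum_{n\ge1}n\frac{q^n}{1-q^n}$, $E_4=1+240\sum_{n\ge1}n^3\frac{q^n}{1-q^n}$, $E_6=1-504\sum_{n\ge1}n^5\frac{q^n}{1-q^n}$, $E_2^*(\tau)=E_2(\tau)-\frac{3}{\pi\mathrm{Im}(\tau)}$, $s_2(\tau)=\frac{E_4(\tau)}{E_6(\tau)}E_2^*(\tau)$. ${}_2F_1$ is the Gauss hypergeometric function. $u(\tau)=-\frac{1}{27}\left(\frac{\eta(\tau)}{\eta(3\tau)}\right)^{12}$ ($\eta$ the Dedekind eta function) is the Hauptmodul of $\Gamma_0(3)$. With $\mathcal{F}_{3B}=\{z\in\mathfrak{H}:|z+1/3|>1/3,|z-1/3|>1/3,|\mathrm{Re}(z)|<1/2\}$, $C_{1/(1-u),\infty}$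 is the connected component of $\{\tau\in\mathcal F_{3B}:|1-u(\tau)|>1\}$ whose closure contains the cusp $\infty$ (i.e. containing points of arbitrarily large imaginary part). *)

(* Defs.v *)
From Stdlib Require Import Reals ZArith.
From Coquelicot Require Import Coquelicot.
Open Scope C_scope.

(* Limits in C are taken componentwise; as with Coquelicot's [Lim_seq], the
   value is meaningful only for convergent sequences. *)
Definition CLim_seq (s : nat -> C) : C :=
  (real (Lim_seq (fun n => Re (s n))), real (Lim_seq (fun n => Im (s n)))).

Definition CSeries (a : nat -> C) : C := CLim_seq (sum_n a).

Definition Cexp (z : C) : C :=
  (exp (Re z) * cos (Im z), exp (Re z) * sin (Im z))%R.

Definition nome (tau : C) : C := Cexp (2 * RtoC PI * Ci * tau).

(* [CSeries] is indexed from 0, so the n-th term of a sum over n >= 1 is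
   written at [S n]. *)
Definition lambert (k : nat) (q : C) : C :=
  CSeries (fun n => RtoC (INR (S n)) ^ k * (q ^ S n / (1 - q ^ S n))).

Definition E2 (tau : C) : C := 1 - 24 * lambert 1 (nome tau).
Definition E4 (tau : C) : C := 1 + 240 * lambert 3 (nome tau).
Definition E6 (tau : C) : C := 1 - 504 * lambert 5 (nome tau).

Definition E2star (tau : C) : C := E2 tau - RtoC (3 / (PI * Im tau)).

Definition s2 (tau : C) : C := E4 tau / E6 tau * E2star tau.

Fixpoint qpoch (q : C) (N : nat) : C :=
  match N with
  | O => 1
  | S n => qpoch q n * (1 - q ^ S n)
  end.

(* The factor q^(1/24) of eta is exp(2 pi i tau / 24), a function of tau
   rather than of q. *)
Definition eta (tau : C) : C :=
  Cexp (2 * RtoC PI * Ci * tau / 24) * CLim_seq (qpoch (nome tau)).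

Definition u (tau : C) : C := - (1 / 27) * (eta tau / eta (3 * tau)) ^ 12.

Fixpoint rising (x : C) (n : nat) : C :=
  match n with
  | O => 1
  | S m => rising x m * (x + RtoC (INR m))
  end.

(* Gauss's series: this is the function 2F1 on the disc |z| < 1 only. *)
Definition hyp2F1 (a b c z : C) : C :=
  CSeries (fun n =>
    rising a n * rising b n / (rising c n * RtoC (INR (fact n))) * z ^ n).

Definition connected (S : C -> Prop) : Prop :=
  forall U V : C -> Prop, open U -> open V ->
    (forall z, S z -> U z \/ V z) ->
    (exists z, S z /\ U z) -> (exists z, S z /\ V z) ->
    exists z, S z /\ U z /\ V z.

Definition connected_component (A : C -> Prop) (x y : C) : Prop :=
  exists S : C -> Prop,
    connected S /\ (forall z, S z -> A z) /\ S x /\ S y.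

Definition F3B (z : C) : Prop :=
  (0 < Im z /\ 1 / 3 < Cmod (z + RtoC (1 / 3)) /\
   1 / 3 < Cmod (z - RtoC (1 / 3)) /\ Rabs (Re z) < 1 / 2)%R.

Definition region (tau : C) : Prop := F3B tau /\ (1 < Cmod (1 - u tau))%R.

(* The connected component of [region] reaching the cusp at infinity: tau lies
   in it when the component of tau contains points of arbitrarily large
   imaginary part.  Only one component does, as [region] contains the part of
   the strip |Re z| < 1/2 above some height. *)
Definition C_infty (tau : C) : Prop :=
  region tau /\
  forall M : R, exists z, connected_component region tau z /\ (M < Im z)%R.

Definition F (x : C) : C := hyp2F1 (1 / 3) (2 / 3) 1 (1 / (1 - x)).

(* Main.v *)
Require Import Defs.
From Stdlib Require Import Reals ZArith Lra Lia Classical FunctionalExtensionality.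
From Coquelicot Require Import Coquelicot.
Open Scope C_scope.

(* With b = eta(tau)^9 / eta(3 tau)^3, c = 27 eta(3 tau)^9 / eta(tau)^3 and Borwein's
   theta series a, one has a^3 = b + c and u = - b / c, so x = 1 / (1 - u) = c / a^3.
   As power series in q, Ramanujan's trigonometric identity and its derivatives at
   theta = 0 and theta = 2 pi / 3 express the derivatives q d/dq of a, b, c and
   E2, E4, E6 polynomially in a, b and E2; in particular q dx/dq = x (1 - x) a^2.
   Hence a and F(x) satisfy the same equation in x, their Wronskian and then their
   quotient are locally constant, and connectedness up to the cusp gives F(x) = a on
   the whole component.  The identity is then algebraic in a, x, E2, with
   E4 = a^4 (1 + 8 x) and E6 = a^6 (1 - 20 x - 8 x^2).

   Two degenerate cases remain.  Integrating dq/q = dx / (x (1 - x) F^2) gives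
   q = x exp(h(x)) / 27 with h real, so a real x forces Re tau = 0 and x > 0; this
   excludes E4 = 0, that is x = -1/8 and u = 9.  If E6 = 0, where s2 is the junk value
   0, then tau is purely imaginary, and a reflection argument for Ramanujan's
   differential equations shows E2* = 0, so that the formula still holds. *)

(** * Formal power series *)

(** Every modular fact is replaced by a differential equation. The algebraic relations between a, b,
    c and the Eisenstein series come from the addition law w_m w_n = w_(m+n) (1 + w_m + w_n) of w_n
    = q^n / (1 - q^n): the j-th derivative of the trigonometric identity is a relation of weight j +
    2, and those of weights 2 to 6 close the system. The equality F(x) = a and the relation between
    x and q are first integrals, whose constants are read off at the cusp. The symmetry used at a
    zero of E6 comes from uniqueness for Ramanujan's equations.

    Weights also explain the shape of the formula. Up to sign and powers of x, u^2 + 18 u - 27 is E6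
    / a^6 and u - 9 is E4 / a^4, so these factors reduce s2 to a multiple of E2*. The holomorphic
    part E2 then cancels against the one that q da/dq brings into dF^2/du. What survives is the
    nonholomorphic part 3 / (pi Im tau), which the form of tau makes 6 a / (pi sqrt d), now with a
    the integer coefficient. *)

Definition fps := nat -> R.
Declare Scope fps_scope.
Delimit Scope fps_scope with fps.
Bind Scope fps_scope with fps.

Section FormalPowerSeries.
Local Open Scope R_scope.

Definition fc (r : R) : fps := fun n => match n with O => r | S _ => 0 end.
Definition fadd (a b : fps) : fps := fun n => a n + b n.
Definition fopp (a : fps) : fps := fun n => - a n.
Definition fsub (a b : fps) : fps := fun n => a n - b n.
Definition ftail (a : fps) : fps := fun n => a (S n).
(** The Cauchy product by recursion on the degree, peeling off the constant term of the first
    factor: the ring axioms then follow by induction, with no finite sums to reindex. *)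
Fixpoint fmul_coef (n : nat) (a b : fps) : R :=
  match n with
  | O => a O * b O
  | S m => a O * b (S m) + fmul_coef m (ftail a) b
  end.
Definition fmul (a b : fps) : fps := fun n => fmul_coef n a b.
Definition fX (k : nat) : fps := fun n => if Nat.eqb n k then 1 else 0.
Definition fD (a : fps) : fps := fun n => INR n * a n.

Lemma fmul_addl n : forall a b c, fmul (fadd a b) c n = fmul a c n + fmul b c n.
Proof.
  induction n as [|n IH]; intros a b c; simpl.
  - unfold fadd; ring.
  - change (ftail (fadd a b)) with (fadd (ftail a) (ftail b)).
    rewrite IH; unfold fadd; ring.
Qed.

Lemma fmul_scall n : forall r a c, fmul (fun k => r * a k) c n = r * fmul a c n.
Proof.
  induction n as [|n IH]; intros r a c; simpl.
  - ring.
  - change (ftail (fun k => r * a k)) with (fun k => r * ftail a k).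
    rewrite IH; ring.
Qed.

Lemma fmul_Sr n : forall a b,
  fmul a b (S n) = fmul a (ftail b) n + a (S n) * b O.
Proof.
  induction n as [|n IH]; intros a b.
  - simpl; unfold ftail; ring.
  - change (fmul a b (S (S n))) with (a O * b (S (S n)) + fmul (ftail a) b (S n)).
    rewrite IH; simpl; unfold ftail; ring.
Qed.

Lemma fmul_comm_n n : forall a b, fmul a b n = fmul b a n.
Proof.
  induction n as [|n IH]; intros a b.
  - simpl; ring.
  - rewrite fmul_Sr; simpl; rewrite IH; ring.
Qed.

Lemma fmul_ext_le n : forall a a' b b',
  (forall k, (k <= n)%nat -> a k = a' k) ->
  (forall k, (k <= n)%nat -> b k = b' k) -> fmul a b n = fmul a' b' n.
Proof.
  induction n as [|n IH]; intros a a' b b' Ha Hb; simpl.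
  - rewrite Ha, Hb by lia; reflexivity.
  - rewrite Ha, Hb by lia; f_equal; apply IH; intros k Hk.
    + apply Ha; lia.
    + apply Hb; lia.
Qed.

Lemma fmul_assoc_n n : forall a b c, fmul a (fmul b c) n = fmul (fmul a b) c n.
Proof.
  induction n as [|n IH]; intros a b c.
  - simpl; ring.
  - change (fmul (fmul a b) c (S n)) with
      (a O * b O * c (S n) + fmul (ftail (fmul a b)) c n).
    change (ftail (fmul a b)) with
      (fadd (fun k => a O * ftail b k) (fmul (ftail a) b)).
    rewrite fmul_addl, fmul_scall, <- IH; simpl; ring.
Qed.

Lemma fps_ring : ring_theory (fc 0) (fc 1) fadd fmul fsub fopp (@eq fps).
Proof.
  constructor; intros; extensionality n.
  - unfold fadd, fc; destruct n; ring.
  - unfold fadd; ring.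
  - unfold fadd; ring.
  - destruct n; simpl; [ring|].
    replace (fmul (ftail (fc 1)) x n) with (fmul (fun k => 0 * x k) x n).
    + rewrite fmul_scall; ring.
    + apply fmul_ext_le; intros; unfold ftail, fc; [ring|reflexivity].
  - apply fmul_comm_n.
  - apply fmul_assoc_n.
  - unfold fadd at 2; apply fmul_addl.
  - reflexivity.
  - unfold fadd, fopp, fc; destruct n; ring.
Qed.

(** Integer constants under a symbol of their own, so that [ring] recognises them as coefficients
    and computes with them. *)
Definition fz (z : Z) : fps := fc (IZR z).

Lemma fmul_fc r a n : fmul (fc r) a n = r * a n.
Proof.
  destruct n; simpl; [reflexivity|].
  replace (fmul (ftail (fc r)) a n) with (fmul (fun k => 0 * a k) a n).
  - rewrite fmul_scall; ring.
  - apply fmul_ext_le; intros; unfold ftail, fc; [ring|reflexivity].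
Qed.

Lemma fz_morph :
  ring_morph (fc 0) (fc 1) fadd fmul fsub fopp (@eq fps)
    0%Z 1%Z Z.add Z.mul Z.sub Z.opp Z.eqb fz.
Proof.
  constructor; intros; unfold fz; try reflexivity;
    try (extensionality n).
  - rewrite plus_IZR; unfold fadd; destruct n; simpl; ring.
  - rewrite minus_IZR; unfold fsub; destruct n; simpl; ring.
  - rewrite mult_IZR, fmul_fc; destruct n; simpl; ring.
  - rewrite opp_IZR; unfold fopp; destruct n; simpl; ring.
  - apply Z.eqb_eq in H; subst; reflexivity.
Qed.

End FormalPowerSeries.

Ltac fz_cst t :=
  match t with
  | fz ?z => match isZcst z with true => z | _ => constr:(NotConstant) end
  | fc 0%R => constr:(0%Z)
  | fc 1%R => constr:(1%Z)
  | _ => constr:(NotConstant)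
  end.

Add Ring fps_ring : fps_ring (morphism fz_morph, constants [fz_cst]).

Infix "+" := fadd : fps_scope.
Infix "*" := fmul : fps_scope.
Infix "-" := fsub : fps_scope.
Notation "- a" := (fopp a) : fps_scope.
Notation "1" := (fc 1%R) : fps_scope.
Notation "0" := (fc 0%R) : fps_scope.

(** * Double series and Ramanujan's trigonometric identity *)

Section Lambert.
Local Open Scope fps_scope.

(** Divisibility by X^i; congruences modulo X^i stand in for limits of formal series. *)
Definition vanish (i : nat) (a : fps) := forall n, (n < i)%nat -> a n = 0%R.

Fixpoint fsum (N : nat) (g : nat -> fps) : fps :=
  match N with
  | O => 0
  | S n => fsum n g + g (S n)
  end.

Lemma vanish_le i j a : (i <= j)%nat -> vanish j a -> vanish i a.
Proof. intros Hij H n Hn; apply H; lia. Qed.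

Lemma vanish_add i a b : vanish i a -> vanish i b -> vanish i (a + b).
Proof. intros Ha Hb n Hn; unfold fadd; rewrite Ha, Hb by exact Hn; ring. Qed.

Lemma vanish_sub i a b : vanish i a -> vanish i b -> vanish i (a - b).
Proof. intros Ha Hb n Hn; unfold fsub; rewrite Ha, Hb by exact Hn; ring. Qed.

Lemma vanish_mull j a b : vanish j b -> vanish j (a * b).
Proof.
  intros Hb n; revert a; induction n as [|n IH]; intros a Hn.
  - change (a O * b O = 0)%R; rewrite Hb by exact Hn; ring.
  - change (a O * b (S n) + (ftail a * b)%fps n = 0)%R.
    rewrite Hb, IH by lia; ring.
Qed.

Lemma vanish_mulr j a b : vanish j a -> vanish j (a * b).
Proof.
  intros H; replace (a * b) with (b * a) by ring; apply vanish_mull, H.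
Qed.

Lemma vanish_mul i j a b : vanish i a -> vanish j b -> vanish (i + j) (a * b).
Proof.
  revert a; induction i as [|i IH]; intros a Ha Hb; [now apply vanish_mull|].
  intros [|n] Hn.
  - change (a O * b O = 0)%R; rewrite Ha by lia; ring.
  - change (a O * b (S n) + (ftail a * b)%fps n = 0)%R.
    rewrite Ha, (IH (ftail a)); [ring| |exact Hb|lia|lia].
    intros k Hk; apply Ha; lia.
Qed.

Lemma fps_eq (a b : fps) : (forall N, vanish N (a - b)) -> a = b.
Proof.
  intros H; extensionality n.
  specialize (H (S n) n (Nat.lt_succ_diag_r n)); unfold fsub in H; lra.
Qed.

Lemma fz_cancel z (a b : fps) : z <> 0%Z -> fz z * a = fz z * b -> a = b.
Proof.
  intros Hz H; extensionality n.
  assert (E := f_equal (fun s => s n) H); cbv beta in E; unfold fz in E.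
  rewrite !fmul_fc in E; apply Rmult_eq_reg_l in E; [exact E|].
  now apply eq_IZR_contrapositive.
Qed.

(** The coefficients of [b - c] vanish one after the other, from the lowest. Cancellation replaces
    division by 1 - X^k. *)
Lemma fmul_cancel (a b c : fps) : a O <> 0%R -> a * b = a * c -> b = c.
Proof.
  intros Ha H.
  assert (H0 : a * (b - c) = 0)
    by (replace (a * (b - c)) with (a * b - a * c) by ring; rewrite H; ring).
  assert (V : forall n, vanish n (b - c)).
  { induction n as [|n IH]; [intros k Hk; lia|].
    intros k Hk; destruct (Nat.eq_dec k n) as [->|]; [|apply IH; lia].
    assert (E := f_equal (fun s => s n) H0); cbv beta in E.
    destruct n as [|n].
    - simpl in E; apply Rmult_integral in E; tauto.
    - change ((a * (b - c)) (S n)) with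
        (a O * (b - c)%fps (S n) + (ftail a * (b - c))%fps n)%R in E.
      rewrite (vanish_mull (S n) (ftail a) (b - c) IH n) in E by lia.
      rewrite Rplus_0_r in E; apply Rmult_integral in E; simpl in E; tauto. }
  now apply fps_eq.
Qed.

Lemma fsum_ext N g h :
  (forall k, (1 <= k <= N)%nat -> g k = h k) -> fsum N g = fsum N h.
Proof.
  induction N as [|N IH]; intros H; simpl; [reflexivity|].
  rewrite IH, (H (S N)) by (intros; try apply H; lia); reflexivity.
Qed.

Lemma fsum_add N g h : fsum N (fun k => g k + h k) = fsum N g + fsum N h.
Proof. induction N as [|N IH]; simpl; [ring|rewrite IH; ring]. Qed.

Lemma fsum_sub N g h : fsum N (fun k => g k - h k) = fsum N g - fsum N h.
Proof. induction N as [|N IH]; simpl; [ring|rewrite IH; ring]. Qed.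

Lemma fsum_mull N s g : fsum N (fun k => s * g k) = s * fsum N g.
Proof. induction N as [|N IH]; simpl; [ring|rewrite IH; ring]. Qed.

Lemma fsum_vanish i N g :
  (forall k, (1 <= k <= N)%nat -> vanish i (g k)) -> vanish i (fsum N g).
Proof.
  induction N as [|N IH]; intros H; simpl.
  - intros [|n] _; reflexivity.
  - apply vanish_add; [apply IH; intros; apply H; lia|apply H; lia].
Qed.

Lemma fsum_trunc i M N g : (M <= N)%nat ->
  (forall k, (M < k <= N)%nat -> vanish i (g k)) ->
  vanish i (fsum N g - fsum M g).
Proof.
  intros HMN; induction HMN as [|N HMN IH]; intros H.
  - replace (fsum M g - fsum M g) with 0 by ring; intros [|n] _; reflexivity.
  - simpl; replace (fsum N g + g (S N) - fsum M g)
      with (fsum N g - fsum M g + g (S N)) by ring.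
    apply vanish_add; [apply IH; intros; apply H; lia|apply H; lia].
Qed.

Lemma fsum_shift N g : fsum (S N) g = g 1%nat + fsum N (fun k => g (S k)).
Proof.
  induction N as [|N IH]; [simpl; ring|].
  change (fsum (S (S N)) g) with (fsum (S N) g + g (S (S N))).
  rewrite IH; simpl; ring.
Qed.

Lemma fsum_rev N g : fsum N (fun k => g (S N - k)%nat) = fsum N g.
Proof.
  revert g; induction N as [|N IH]; intros g; [reflexivity|].
  rewrite fsum_shift.
  replace (S (S N) - 1)%nat with (S N) by lia.
  rewrite (fsum_ext N _ (fun k => g (S N - k)%nat)) by (intros; f_equal; lia).
  rewrite IH; simpl; ring.
Qed.

(** The square is cut into its diagonal and the parallels a - b = m; those below are folded onto
    those above by symmetry. *)
Lemma fsum_box N (g : nat -> nat -> fps) : (forall a b, g a b = g b a) ->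
  fsum N (fun a => fsum N (fun b => g a b)) =
  fsum N (fun a => g a a)
  + fz 2 * fsum N (fun m => fsum (N - m) (fun b => g (b + m)%nat b)).
Proof.
  intros Hs; induction N as [|N IH]; [simpl; ring|].
  cbn [fsum].
  rewrite (fsum_add N (fun a => fsum N (fun b => g a b)) (fun a => g a (S N))), IH.
  replace (S N - S N)%nat with O by lia; cbn [fsum].
  rewrite (fsum_ext N (fun m => fsum (S N - m) _)
    (fun m => fsum (N - m) (fun b => g (b + m)%nat b) + g (S N) (S N - m)%nat)).
  - rewrite fsum_add, (fsum_rev N (fun k => g (S N) k)).
    rewrite (fsum_ext N (fun a => g a (S N)) (fun k => g (S N) k)) by (intros; apply Hs).
    ring.
  - intros m Hm; replace (S N - m)%nat with (S (N - m)) by lia; cbn [fsum].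
    do 2 f_equal; lia.
Qed.

Lemma fsum_triangle N (g : nat -> nat -> fps) :
  fsum N (fun a => fsum (N - a) (fun b => g a b)) =
  fsum N (fun m => fsum (m - 1) (fun a => g a (m - a)%nat)).
Proof.
  induction N as [|N IH]; [reflexivity|].
  cbn [fsum]; rewrite <- IH.
  replace (S N - S N)%nat with O by lia; replace (S N - 1)%nat with N by lia.
  cbn [fsum].
  rewrite (fsum_ext N (fun a => fsum (S N - a) _)
    (fun a => fsum (N - a) (fun b => g a b) + g a (S N - a)%nat)).
  - rewrite fsum_add; ring.
  - intros m Hm; replace (S N - m)%nat with (S (N - m)) by lia; cbn [fsum].
    do 2 f_equal; lia.
Qed.

(** The infinite sum of c_k w_k over k >= 1: when w_k is divisible by X^k, the coefficient of X^n
    only sees the first n terms. *)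
Definition LS (w : nat -> fps) (c : nat -> R) : fps :=
  fun n => fsum n (fun k => fc (c k) * w k) n.

Definition LS2 (w : nat -> fps) (c : nat -> nat -> R) : fps :=
  fun n => fsum n (fun a => fsum n (fun b => fc (c a b) * (w a * w b))) n.

Definition graded (w : nat -> fps) := forall k, (1 <= k)%nat -> vanish k (w k).

Lemma fsum_eval N g n : (forall k, (n < k)%nat -> vanish k (g k)) ->
  (n <= N)%nat -> fsum N g n = fsum n g n.
Proof.
  intros H Hn.
  assert (V : vanish (S n) (fsum N g - fsum n g)).
  { apply fsum_trunc; [exact Hn|]. intros k Hk; apply (vanish_le _ k); [lia|].
    apply H; lia. }
  specialize (V n (Nat.lt_succ_diag_r n)); unfold fsub in V; lra.
Qed.

Lemma LS_trunc w c N : graded w ->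
  vanish (S N) (LS w c - fsum N (fun k => fc (c k) * w k)).
Proof.
  intros Hw n Hn; unfold fsub, LS.
  rewrite (fsum_eval N); [ring| |lia].
  intros k Hk; apply vanish_mull, Hw; lia.
Qed.

Lemma LS2_trunc w c N : graded w ->
  vanish (S N)
    (LS2 w c - fsum N (fun a => fsum N (fun b => fc (c a b) * (w a * w b)))).
Proof.
  intros Hw n Hn; unfold fsub, LS2.
  assert (E : vanish (S n)
    (fsum N (fun a => fsum N (fun b => fc (c a b) * (w a * w b)))
     - fsum n (fun a => fsum n (fun b => fc (c a b) * (w a * w b))))).
  { replace (fsum N (fun a => fsum N (fun b => fc (c a b) * (w a * w b)))
     - fsum n (fun a => fsum n (fun b => fc (c a b) * (w a * w b))))
    with ((fsum N (fun a => fsum N (fun b => fc (c a b) * (w a * w b)))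
     - fsum n (fun a => fsum N (fun b => fc (c a b) * (w a * w b))))
     + fsum n (fun a => fsum N (fun b => fc (c a b) * (w a * w b)) 
          - fsum n (fun b => fc (c a b) * (w a * w b))))
      by (rewrite fsum_sub; ring).
    apply vanish_add.
    - apply fsum_trunc; [lia|]; intros a Ha; apply fsum_vanish; intros b Hb.
      apply vanish_mull, vanish_mulr, (vanish_le _ a); [lia|apply Hw; lia].
    - apply fsum_vanish; intros a Ha; apply fsum_trunc; [lia|]; intros b Hb.
      apply vanish_mull, vanish_mull, (vanish_le _ b); [lia|apply Hw; lia]. }
  specialize (E n (Nat.lt_succ_diag_r n)); unfold fsub in E; lra.
Qed.

Lemma fps_eq_trunc (a b : fps) (a' b' : nat -> fps) :
  (forall N, vanish (S N) (a - a' N)) -> (forall N, vanish (S N) (b - b' N)) ->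
  (forall N, vanish (S N) (a' N - b' N)) -> a = b.
Proof.
  intros Ha Hb H; apply fps_eq; intros N; apply (vanish_le _ (S N)); [lia|].
  replace (a - b) with (a - a' N + (a' N - b' N) - (b - b' N)) by ring.
  apply vanish_sub; [apply vanish_add|]; auto.
Qed.

Lemma fc_add r s : fc (r + s) = fc r + fc s.
Proof.
  apply functional_extensionality; intros [|n]; unfold fadd; simpl; ring.
Qed.

Lemma fc_mul r s : fc (r * s) = fc r * fc s.
Proof.
  extensionality n; rewrite fmul_fc.
  destruct n; simpl; ring.
Qed.

Lemma fc_sub r s : fc (r - s) = fc r - fc s.
Proof.
  apply functional_extensionality; intros [|n]; unfold fsub; simpl; ring.
Qed.

Lemma LS_ext w c d : (forall k, (1 <= k)%nat -> c k = d k) -> LS w c = LS w d.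
Proof.
  intros H; extensionality n; unfold LS.
  rewrite (fsum_ext n _ (fun k => fc (d k) * w k)); [reflexivity|].
  intros k Hk; rewrite H by lia; reflexivity.
Qed.

Lemma LS_add w c d : LS w (fun k => c k + d k)%R = LS w c + LS w d.
Proof.
  extensionality n; unfold LS, fadd at 1.
  rewrite (fsum_ext n _ (fun k => fc (c k) * w k + fc (d k) * w k)).
  - rewrite fsum_add; reflexivity.
  - intros k Hk; rewrite fc_add; ring.
Qed.

Lemma LS_scal w r c : LS w (fun k => r * c k)%R = fc r * LS w c.
Proof.
  extensionality n.
  rewrite fmul_fc; unfold LS; rewrite <- fmul_fc.
  rewrite <- fsum_mull, (fsum_ext n _ (fun k => fc r * (fc (c k) * w k)));
    [reflexivity|].
  intros k Hk; rewrite fc_mul; ring.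
Qed.

Lemma LS2_ext w c d :
  (forall a b, (1 <= a)%nat -> (1 <= b)%nat -> c a b = d a b) ->
  LS2 w c = LS2 w d.
Proof.
  intros H; extensionality n; unfold LS2.
  rewrite (fsum_ext n _ (fun a => fsum n (fun b => fc (d a b) * (w a * w b))));
    [reflexivity|].
  intros a Ha; apply fsum_ext; intros b Hb; rewrite H by lia; reflexivity.
Qed.

Lemma LS2_add w c d :
  LS2 w (fun a b => c a b + d a b)%R = LS2 w c + LS2 w d.
Proof.
  extensionality n; unfold LS2, fadd at 1.
  rewrite (fsum_ext n _ (fun a => fsum n (fun b => fc (c a b) * (w a * w b))
     + fsum n (fun b => fc (d a b) * (w a * w b)))).
  - rewrite fsum_add; reflexivity.
  - intros a Ha; rewrite <- fsum_add; apply fsum_ext; intros b Hb.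
    rewrite fc_add; ring.
Qed.

Lemma LS2_scal w r c : LS2 w (fun a b => r * c a b)%R = fc r * LS2 w c.
Proof.
  extensionality n.
  rewrite fmul_fc; unfold LS2; rewrite <- fmul_fc, <- fsum_mull.
  rewrite (fsum_ext n _ (fun a => fc r * fsum n (fun b => fc (c a b) * (w a * w b))));
    [reflexivity|].
  intros a Ha; rewrite <- fsum_mull; apply fsum_ext; intros b Hb.
  rewrite fc_mul; ring.
Qed.

Lemma LS2_prod w c d : graded w ->
  LS2 w (fun a b => c a * d b)%R = LS w c * LS w d.
Proof.
  intros Hw.
  apply (fps_eq_trunc _ _
    (fun N => fsum N (fun a => fsum N (fun b => fc (c a * d b) * (w a * w b))))
    (fun N => fsum N (fun k => fc (c k) * w k) * fsum N (fun k => fc (d k) * w k))).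
  - intros N; apply LS2_trunc, Hw.
  - intros N.
    set (x := fsum N (fun k => fc (c k) * w k)).
    set (y := fsum N (fun k => fc (d k) * w k)).
    replace (LS w c * LS w d - x * y)
      with ((LS w c - x) * LS w d + x * (LS w d - y)) by ring.
    apply vanish_add; [apply vanish_mulr|apply vanish_mull]; now apply LS_trunc.
  - intros N.
    rewrite (fsum_ext N (fun a => fsum N (fun b => fc (c a * d b) * (w a * w b)))
      (fun a => fsum N (fun k => fc (d k) * w k) * (fc (c a) * w a))).
    + rewrite fsum_mull.
      match goal with |- vanish _ ?s => replace s with 0 by ring end.
      intros [|n] _; reflexivity.
    + intros a Ha.
      rewrite (fsum_ext N _ (fun b => (fc (c a) * w a) * (fc (d b) * w b))).
      * rewrite fsum_mull; ring.
      * intros b Hb; rewrite fc_mul; ring.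
Qed.

Fixpoint psum (f : nat -> R) (n : nat) : R :=
  match n with
  | O => 0%R
  | S m => (psum f m + f (S m))%R
  end.

Definition ndist (a b : nat) : nat := ((a - b) + (b - a))%nat.

(* Ramanujan's trigonometric identity, with [cos (k * theta)] replaced by an
   arbitrary even function [f].  It only uses the addition law of
   [w k = q^k / (1 - q^k)]. *)
Theorem lambert_square (w : nat -> fps) (f : nat -> R) :
  graded w ->
  (forall a b, (1 <= a)%nat -> (1 <= b)%nat ->
     w a * w b = w (a + b)%nat * (1 + w a + w b)) ->
  LS2 w (fun a b => f (ndist a b) - f (a + b)%nat)%R =
  fc (f O) * LS (fun k => w k * w k) (fun _ => 1%R)
  + fz 2 * LS (fun k => w k * w k) f
  - LS w (fun m => (INR m - 1) * f m + 2 * psum f (m - 1))%R.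
Proof.
  intros Hw Hrel.
  assert (Hw2 : graded (fun k => w k * w k))
    by (intros k Hk; apply vanish_mulr, Hw, Hk).
  set (U := fun N => fsum N w).
  set (c := (fun m => (INR m - 1) * f m + 2 * psum f (m - 1))%R).
  apply (fps_eq_trunc _ _
    (fun N => fsum N (fun a => fsum N (fun b =>
        fc (f (ndist a b) - f (a + b)%nat) * (w a * w b))))
    (fun N => fc (f O) * fsum N (fun k => fc 1 * (w k * w k))
      + fz 2 * fsum N (fun k => fc (f k) * (w k * w k))
      - fsum N (fun k => fc (c k) * w k))).
  { intros N; now apply LS2_trunc. }
  { intros N.
    match goal with |- vanish _ (?p * ?a + ?r * ?b - ?d - (?p * ?a' + ?r * ?b' - ?d')) =>
      replace (p * a + r * b - d - (p * a' + r * b' - d'))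
        with (p * (a - a') + r * (b - b') - (d - d')) by ring end.
    apply vanish_sub; [apply vanish_add; apply vanish_mull|].
    - exact (LS_trunc (fun k => w k * w k) (fun _ => 1%R) N Hw2).
    - exact (LS_trunc (fun k => w k * w k) f N Hw2).
    - exact (LS_trunc w c N Hw). }
  intros N.
  (* Off the diagonal the addition law reads w_(b+m) w_b = w_m (w_b - w_(b+m)) - w_(b+m), and the
     sum over b collapses to the partial sums [U]. *)
  assert (E1 : fsum N (fun a => fsum N (fun b => fc (f (ndist a b)) * (w a * w b)))
    = fc (f O) * fsum N (fun k => fc 1 * (w k * w k))
      + fz 2 * fsum N (fun m => fc (f m) * (w m * (U (N - m)%nat - (U N - U m))
            - (U N - U m)))).
  { rewrite (fsum_box N (fun a b => fc (f (ndist a b)) * (w a * w b))).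
    2:{ intros a b; replace (ndist b a) with (ndist a b) by (unfold ndist; lia); ring. }
    f_equal.
    - rewrite <- fsum_mull; apply fsum_ext; intros k Hk.
      replace (ndist k k) with O by (unfold ndist; lia); ring.
    - f_equal; apply fsum_ext; intros m Hm.
      rewrite (fsum_ext (N - m) _ (fun b => fc (f m) *
        (w m * (w b - w (b + m)%nat) - w (b + m)%nat))).
      2:{ intros b Hb; replace (ndist (b + m) b) with m by (unfold ndist; lia).
          assert (R1 := Hrel b m); replace (w (b + m)%nat * w b) with
            (w b * w m - w (b + m)%nat * w m - w (b + m)%nat); [ring|].
          rewrite R1 by lia; ring. }
      rewrite fsum_mull, fsum_sub, fsum_mull, fsum_sub.
      assert (E : fsum (N - m) (fun b => w (b + m)%nat) = U N - U m).
      { unfold U; clear - Hm; destruct Hm as [_ Hm].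
        induction Hm as [|N Hm IH].
        - replace (m - m)%nat with O by lia; simpl; ring.
        - replace (S N - m)%nat with (S (N - m)) by lia; cbn [fsum].
          rewrite IH; replace (S (N - m) + m)%nat with (S N) by lia; ring. }
      rewrite E; unfold U; ring. }
  (* Terms with a + b > N are divisible by X^(N+1). On the antidiagonal a + b = m the addition law
     factors out w_m and leaves the sum of 1 + w_a + w_(m-a) over m - 1 values of a. *)
  assert (E2 : vanish (S N)
    (fsum N (fun a => fsum N (fun b => fc (f (a + b)%nat) * (w a * w b)))
     - fsum N (fun m => fc (f m) * (w m * (fc (INR m - 1) + fz 2 * U (m - 1)%nat))))).
  { rewrite (fsum_ext N (fun m => fc (f m) * (w m * (fc (INR m - 1) + fz 2 * U (m - 1)%nat)))
      (fun m => fsum (m - 1) (fun a => fc (f (a + (m - a))%nat) * (w a * w (m - a)%nat)))).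
    - rewrite <- (fsum_triangle N (fun a b => fc (f (a + b)%nat) * (w a * w b))).
      rewrite <- fsum_sub; apply fsum_vanish; intros a Ha.
      apply fsum_trunc; [lia|]; intros b Hb.
      apply vanish_mull, (vanish_le _ (a + b)); [lia|].
      apply vanish_mul; apply Hw; lia.
    - intros m Hm.
      rewrite (fsum_ext (m - 1) _ (fun a => (fc (f m) * w m) * (1 + (w a + w (m - a)%nat)))).
      2:{ intros a Ha; rewrite Hrel by lia; replace (a + (m - a))%nat with m by lia; ring. }
      rewrite fsum_mull, fsum_add, fsum_add.
      replace (fsum (m - 1) (fun k => w (m - k)%nat)) with (U (m - 1)%nat).
      2:{ unfold U; rewrite <- fsum_rev; apply fsum_ext; intros k Hk; f_equal; lia. }
      replace (fsum (m - 1) (fun _ => 1)) with (fc (INR m - 1)).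
      { unfold U; ring. }
      destruct m as [|m]; [lia|]; rewrite S_INR; simpl (S m - 1)%nat.
      rewrite Nat.sub_0_r; replace (INR m + 1 - 1)%R with (INR m) by ring.
      clear; induction m as [|m IH]; [reflexivity|].
      cbn [fsum]; rewrite <- IH, S_INR, fc_add; ring. }
  (* Abel summation: w_j is counted with weight f m for every m < j. *)
  assert (E3 : fsum N (fun m => fc (f m) * (U N - U m))
    = fsum N (fun m => fc (psum f (m - 1)) * w m)).
  { unfold U; clear; induction N as [|N IH]; [reflexivity|].
    cbn [fsum]; rewrite <- IH; replace (S N - 1)%nat with N by lia.
    rewrite (fsum_ext N _ (fun m => fc (f m) * (fsum N w - fsum m w) + w (S N) * fc (f m)))
      by (intros; ring).
    rewrite fsum_add, fsum_mull.
    replace (fsum N (fun k => fc (f k))) with (fc (psum f N)); [ring|].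
    clear; induction N as [|N IH]; [reflexivity|]. cbn [fsum psum].
    rewrite fc_add, IH; ring. }
  (* [U N - U (N - m)] starts with w_(N-m+1), so the factor w_m pushes it beyond X^N. *)
  assert (E4 : vanish (S N) (fsum N (fun m => fc (f m) * (w m * (U N - U (N - m)%nat))))).
  { apply fsum_vanish; intros m Hm; apply vanish_mull.
    apply (vanish_le _ (m + S (N - m))); [lia|]; apply vanish_mul; [apply Hw; lia|].
    apply fsum_trunc; [lia|]; intros k Hk; apply (vanish_le _ k); [lia|apply Hw; lia]. }
  rewrite (fsum_ext N (fun k => fc (c k) * w k) (fun k =>
    fc (f k) * (w k * (fc (INR k - 1))) + fz 2 * (fc (psum f (k - 1)) * w k))).
  2:{ intros k Hk; unfold c; rewrite fc_add, !fc_mul.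
      change (fc 2) with (fz 2); ring. }
  rewrite (fsum_ext N (fun a => fsum N (fun b =>
        fc (f (ndist a b) - f (a + b)%nat) * (w a * w b)))
    (fun a => fsum N (fun b => fc (f (ndist a b)) * (w a * w b))
       - fsum N (fun b => fc (f (a + b)%nat) * (w a * w b)))).
  2:{ intros a Ha; rewrite <- fsum_sub; apply fsum_ext; intros b Hb.
      rewrite fc_sub; ring. }
  rewrite fsum_sub, E1, fsum_add, (fsum_mull N (fz 2)), <- E3.
  rewrite (fsum_ext N (fun m => fc (f m) * (w m * (U (N - m)%nat - (U N - U m)) - (U N - U m)))
    (fun m => fc (f m) * (w m * U m)
       - fc (f m) * (w m * (U N - U (N - m)%nat)) - fc (f m) * (U N - U m)))
    by (intros; ring).
  (* With [U (m - 1)] written as [U m - w m], the products w_m U_m cancel between the two halves,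
     and the leftover squares are the term 2 f(m) w_m^2 of the identity. *)
  rewrite (fsum_ext N (fun m => fc (f m) * (w m * (fc (INR m - 1) + fz 2 * U (m - 1)%nat)))
    (fun m => fc (f m) * (w m * fc (INR m - 1))
       + fz 2 * (fc (f m) * (w m * U m) - fc (f m) * (w m * w m)))) in E2.
  2:{ intros m Hm; replace (U m) with (U (m - 1)%nat + w m); [ring|].
      destruct m as [|m]; [lia|]; simpl (S m - 1)%nat; rewrite Nat.sub_0_r.
      reflexivity. }
  rewrite fsum_add, (fsum_mull N (fz 2)), fsum_sub in E2.
  rewrite !fsum_sub.
  match type of E2 with vanish _ ?s => match type of E4 with vanish _ ?t =>
    match goal with |- vanish _ ?g => replace g with (fopp (s + fz 2 * t)) by ring end end end.
  intros n Hn; unfold fopp.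
  rewrite (vanish_add _ _ _ E2 (vanish_mull _ (fz 2) _ E4) n Hn); ring.
Qed.

End Lambert.

(** * Lambert series twisted by cosines and sines of 2 pi k / 3 *)

Section Level3.
Local Open Scope fps_scope.

Lemma fX_mul k a n : (fX k * a) n = if Nat.ltb n k then 0%R else a (n - k)%nat.
Proof.
  revert n; induction k as [|k IH]; intros n.
  - replace (fX 0) with 1 by (apply functional_extensionality; intros [|m]; reflexivity).
    replace (1 * a) with a by ring. rewrite Nat.sub_0_r; reflexivity.
  - destruct n as [|n].
    + change (0%R * a O = 0)%R; ring.
    + change ((0%R * a (S n) + (ftail (fX (S k)) * a)%fps n)%R
        = if Nat.ltb n k then 0%R else a (n - k)%nat).
      change (ftail (fX (S k))) with (fX k); rewrite IH; ring.
Qed.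

Lemma fX_add a b : fX (a + b) = fX a * fX b.
Proof.
  extensionality n; rewrite fX_mul.
  destruct (Nat.ltb_spec n a); unfold fX.
  - destruct (Nat.eqb_spec n (a + b)); [lia|reflexivity].
  - destruct (Nat.eqb_spec n (a + b)), (Nat.eqb_spec (n - a) b);
      try lia; reflexivity.
Qed.

(* X^k / (1 - X^k), for k >= 1 *)
Definition fw (k : nat) : fps := fun n =>
  if Nat.eqb n 0 then 0%R else if Nat.eqb (n mod k) 0 then 1%R else 0%R.

Lemma fw_eq k : (1 <= k)%nat -> fw k * (1 - fX k) = fX k.
Proof.
  intros Hk; replace (fw k * (1 - fX k)) with (fw k - fX k * fw k) by ring.
  extensionality n; unfold fsub; rewrite fX_mul.
  unfold fw, fX.
  destruct (Nat.ltb_spec n k).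
  - rewrite Nat.mod_small by lia.
    destruct (Nat.eqb_spec n 0); destruct (Nat.eqb_spec n k); try lia; ring.
  - destruct (Nat.eqb_spec n 0); [lia|].
    destruct (Nat.eqb_spec (n - k) 0); destruct (Nat.eqb_spec n k); try lia.
    + subst n; rewrite Nat.Div0.mod_same; simpl; ring.
    + replace n with ((n - k) + 1 * k)%nat at 1 by lia.
      rewrite Nat.Div0.mod_add; ring.
Qed.

Lemma one_sub_fX_O k : (1 <= k)%nat -> (1 - fX k) O <> 0%R.
Proof. intros Hk; destruct k; [lia|]; unfold fsub, fX; simpl; lra. Qed.

Lemma fw_graded : graded fw.
Proof.
  intros k Hk n Hn; unfold fw.
  destruct (Nat.eqb_spec n 0); [reflexivity|].
  rewrite Nat.mod_small by lia; destruct (Nat.eqb_spec n 0); [lia|reflexivity].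
Qed.

(** The addition formula of coth: for X = e^(-t), 1/2 + X^k / (1 - X^k) is coth(k t / 2) / 2. *)
Lemma fw_rel a b : (1 <= a)%nat -> (1 <= b)%nat ->
  fw a * fw b = fw (a + b) * (1 + fw a + fw b).
Proof.
  intros Ha Hb.
  apply (fmul_cancel (1 - fX a)); [now apply one_sub_fX_O|].
  apply (fmul_cancel (1 - fX b)); [now apply one_sub_fX_O|].
  apply (fmul_cancel (1 - fX (a + b))); [apply one_sub_fX_O; lia|].
  assert (Ea := fw_eq a Ha); assert (Eb := fw_eq b Hb).
  assert (Ec : fw (a + b) * (1 - fX (a + b)) = fX (a + b)) by (apply fw_eq; lia).
  transitivity ((1 - fX (a + b)) * (fw b * (1 - fX b)) * (fw a * (1 - fX a))); [ring|].
  transitivity (fw (a + b) * (1 - fX (a + b)) *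
    ((1 - fX a) * (1 - fX b) + (fw a * (1 - fX a)) * (1 - fX b)
     + (fw b * (1 - fX b)) * (1 - fX a))); [|ring].
  rewrite Ea, Eb, Ec, fX_add; ring.
Qed.

Lemma fD_mul a b : fD (a * b) = fD a * b + a * fD b.
Proof.
  extensionality n.
  revert a b; induction n as [|n IH]; intros a b.
  - unfold fD, fadd, fmul; simpl; ring.
  - change (fD (a * b) (S n)) with
      (INR (S n) * (a O * b (S n) + (ftail a * b)%fps n))%R.
    change ((fD a * b + a * fD b) (S n)) with
      (INR 0 * a O * b (S n) + (ftail (fD a) * b)%fps n
       + (a O * (INR (S n) * b (S n)) + (ftail a * fD b)%fps n))%R.
    assert (E := IH (ftail a) b).
    change (INR n * (ftail a * b)%fps n
      = (fD (ftail a) * b)%fps n + (ftail a * fD b)%fps n)%R in E.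
    replace (ftail (fD a)) with (fD (ftail a) + ftail a).
    2:{ extensionality k; unfold ftail, fD, fadd.
        rewrite S_INR; ring. }
    replace ((fD (ftail a) + ftail a) * b) with (fD (ftail a) * b + ftail a * b) by ring.
    unfold fadd at 1.
    replace (INR 0) with 0%R by reflexivity.
    rewrite S_INR; lra.
Qed.

Lemma fD_add a b : fD (a + b) = fD a + fD b.
Proof. extensionality n; unfold fD, fadd; ring. Qed.

Lemma fD_sub a b : fD (a - b) = fD a - fD b.
Proof. extensionality n; unfold fD, fsub; ring. Qed.

Lemma fD_fc r : fD (fc r) = 0.
Proof. apply functional_extensionality; intros [|n]; unfold fD; simpl; ring. Qed.

Lemma fD_scal r a : fD (fc r * a) = fc r * fD a.
Proof. rewrite fD_mul, fD_fc; ring. Qed.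

Lemma fD_fX k : fD (fX k) = fc (INR k) * fX k.
Proof.
  extensionality n; rewrite fmul_fc; unfold fD, fX.
  destruct (Nat.eqb_spec n k); [subst; ring|ring].
Qed.

Lemma fD_fw k : (1 <= k)%nat -> fD (fw k) = fc (INR k) * (fw k + fw k * fw k).
Proof.
  intros Hk; apply (fmul_cancel (1 - fX k)); [now apply one_sub_fX_O|].
  assert (E := fw_eq k Hk).
  assert (E' := f_equal fD E); rewrite fD_mul, fD_sub, fD_fc, fD_fX in E'.
  transitivity (fc (INR k) * fX k + fc (INR k) * (fw k * fX k)).
  - rewrite <- E' at 1; ring.
  - transitivity (fc (INR k) * (fw k * (1 - fX k)) * (1 + fw k)); [rewrite E|]; ring.
Qed.

(** The left side is X^k / (1 - X^k)^2, that is 1/k times the derivative of X^k / (1 - X^k). *)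
Lemma fw_sq_coef k n : (1 <= k)%nat ->
  (fw k + fw k * fw k) n = (INR n / INR k * fw k n)%R.
Proof.
  intros Hk; assert (E := f_equal (fun s => s n) (fD_fw k Hk)); cbv beta in E.
  rewrite fmul_fc in E; unfold fD at 1 in E.
  assert (INR k <> 0%R) by (apply not_0_INR; lia).
  apply (Rmult_eq_reg_l (INR k)); [|assumption].
  rewrite <- E; field; assumption.
Qed.

Lemma fsum_coef N g n : fsum N g n = psum (fun k => g k n) N.
Proof.
  induction N as [|N IH]; simpl; [destruct n; reflexivity|].
  unfold fadd; rewrite IH; reflexivity.
Qed.

Lemma LS_coef w c n : LS w c n = psum (fun k => c k * w k n)%R n.
Proof.
  unfold LS; rewrite fsum_coef; generalize n at 2 4; intros N.
  induction N as [|N IH]; simpl; [reflexivity|]; rewrite IH, fmul_fc; reflexivity.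
Qed.

Lemma psum_ext f g n : (forall k, (1 <= k <= n)%nat -> f k = g k) ->
  psum f n = psum g n.
Proof.
  induction n as [|n IH]; intros H; simpl; [reflexivity|].
  rewrite IH, H by (intros; try apply H; lia); reflexivity.
Qed.

Lemma psum_add f g n : psum (fun k => f k + g k)%R n = (psum f n + psum g n)%R.
Proof. induction n as [|n IH]; simpl; [ring|rewrite IH; ring]. Qed.

Lemma psum_swap f n m :
  psum (fun a => psum (fun b => f a b) m) n = psum (fun b => psum (fun a => f a b) n) m.
Proof.
  induction n as [|n IH]; simpl.
  - induction m as [|m IHm]; simpl; [reflexivity|rewrite <- IHm; ring].
  - rewrite IH, <- psum_add; reflexivity.
Qed.

Lemma psum_zero f n : (forall k, (1 <= k <= n)%nat -> f k = 0%R) -> psum f n = 0%R.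
Proof.
  induction n as [|n IH]; intros H; simpl; [reflexivity|].
  rewrite IH, H by (intros; try apply H; lia); ring.
Qed.

Lemma psum_single f n k : (1 <= k <= n)%nat ->
  (forall j, (1 <= j <= n)%nat -> j <> k -> f j = 0%R) -> psum f n = f k.
Proof.
  induction n as [|n IH]; intros Hk H; [lia|]; simpl.
  destruct (Nat.eq_dec k (S n)) as [->|].
  - rewrite psum_zero; [ring|intros; apply H; lia].
  - rewrite IH, (H (S n)) by (try (intros; apply H); lia); ring.
Qed.

Lemma psum_extend f n m : (n <= m)%nat ->
  (forall k, (n < k <= m)%nat -> f k = 0%R) -> psum f m = psum f n.
Proof.
  intros Hnm; induction Hnm as [|m Hnm IH]; intros H; [reflexivity|]; simpl.
  rewrite IH, (H (S m)) by (try (intros; apply H); lia); ring.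
Qed.

(* q^(e k) / (1 - q^(e k)): [e = 1] for tau, [e = 3] for 3 tau *)
Definition fwe (e k : nat) : fps := fw (e * k).

Lemma fwe_graded e : (1 <= e)%nat -> graded (fwe e).
Proof.
  intros He k Hk; apply (vanish_le _ (e * k)); [nia|]; apply fw_graded; nia.
Qed.

Lemma fwe_rel e a b : (1 <= e)%nat -> (1 <= a)%nat -> (1 <= b)%nat ->
  fwe e a * fwe e b = fwe e (a + b) * (1 + fwe e a + fwe e b).
Proof.
  intros He Ha Hb; unfold fwe; rewrite Nat.mul_add_distr_l; apply fw_rel; nia.
Qed.

(* sum of q^k/(1-q^k)^2 = sum of k q^k/(1-q^k): both count k over pairs with k m = n *)
Lemma LS_divisor_symm e : (1 <= e)%nat ->
  LS (fwe e) (fun _ => 1%R) + LS (fun k => fwe e k * fwe e k) (fun _ => 1%R)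
  = LS (fwe e) INR.
Proof.
  intros He; extensionality n; unfold fadd.
  rewrite !LS_coef, <- psum_add.
  set (i := fun k m : nat => if Nat.eqb (e * k * m) n then INR m else 0%R).
  assert (Hi : forall k, (1 <= k <= n)%nat -> forall g : nat -> R,
    psum (fun m => if Nat.eqb (e * k * m) n then g m else 0%R) n
    = (fw (e * k) n * g (n / (e * k))%nat)%R).
  { intros k Hk g; unfold fw.
    destruct (Nat.eqb_spec n 0); [lia|].
    destruct (Nat.eqb_spec (n mod (e * k)) 0) as [Hm|Hm].
    - assert (Hn : (n = e * k * (n / (e * k)))%nat)
        by (apply Nat.Div0.div_exact; exact Hm).
      rewrite (psum_single _ n (n / (e * k))%nat).
      + rewrite <- Hn, Nat.eqb_refl; ring.
      + revert Hn; generalize (n / (e * k))%nat; intros t Ht.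
        assert (1 <= e * k)%nat by nia; generalize dependent (e * k)%nat; nia.
      + intros p Hp Hp'; destruct (Nat.eqb_spec (e * k * p) n) as [E|]; [|reflexivity].
        exfalso; apply Hp'; rewrite Hn in E; apply Nat.mul_cancel_l in E; [exact E|nia].
    - rewrite psum_zero; [ring|].
      intros p Hp; destruct (Nat.eqb_spec (e * k * p) n) as [E|]; [|reflexivity].
      exfalso; apply Hm; rewrite <- E, Nat.mul_comm; apply Nat.Div0.mod_mul. }
  transitivity (psum (fun k => psum (i k) n) n).
  - apply psum_ext; intros k Hk; unfold i; rewrite (Hi k Hk INR).
    transitivity ((fw (e * k) + fw (e * k) * fw (e * k)) n);
      [unfold fadd, fwe; ring|].
    rewrite fw_sq_coef by nia.
    destruct (Req_dec (fw (e * k) n) 0) as [->|Hne]; [ring|].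
    unfold fw in Hne; destruct (Nat.eqb_spec n 0); [lia|].
    destruct (Nat.eqb_spec (n mod (e * k)) 0) as [Hm|]; [|lra].
    assert (Hn : (n = e * k * (n / (e * k)))%nat)
        by (apply Nat.Div0.div_exact; exact Hm).
    rewrite Hn at 1; rewrite mult_INR; field; apply not_0_INR; nia.
  - rewrite psum_swap; apply psum_ext; intros m Hm.
    rewrite (psum_ext _ (fun k => if Nat.eqb (e * m * k) n then INR m else 0%R)).
    + rewrite (Hi m Hm (fun _ => INR m)); unfold fwe; ring.
    + intros k Hk; unfold i; replace (e * k * m)%nat with (e * m * k)%nat by nia.
      reflexivity.
Qed.

Lemma LS_derive e c : (1 <= e)%nat ->
  fD (LS (fwe e) c) = fc (INR e) * (LS (fwe e) (fun k => INR k * c k)%R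
    + LS (fun k => fwe e k * fwe e k) (fun k => INR k * c k)%R).
Proof.
  intros He; extensionality n.
  rewrite fmul_fc; unfold fD, fadd; rewrite !LS_coef, <- psum_add.
  assert (E : forall N, (INR n * psum (fun k => c k * fwe e k n) N
    = INR e * psum (fun k => INR k * c k * fwe e k n
        + INR k * c k * (fwe e k * fwe e k)%fps n) N)%R); [|apply E].
  induction N as [|N IH]; cbn [psum]; [ring|].
  assert (F : (fwe e (S N) n + (fwe e (S N) * fwe e (S N))%fps n
    = INR n / INR (e * S N) * fwe e (S N) n)%R)
    by (unfold fwe; rewrite <- fw_sq_coef by nia; reflexivity).
  rewrite !Rmult_plus_distr_l, IH.
  rewrite mult_INR in F; f_equal.
  assert (INR e <> 0%R) by (apply not_0_INR; lia).
  assert (INR (S N) <> 0%R) by (apply not_0_INR; lia).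
  replace (INR e * (INR (S N) * c (S N) * fwe e (S N) n) +
    INR e * (INR (S N) * c (S N) * (fwe e (S N) * fwe e (S N))%fps n))%R
    with (INR e * INR (S N) * c (S N) *
      (fwe e (S N) n + (fwe e (S N) * fwe e (S N))%fps n))%R by ring.
  rewrite F; field; tauto.
Qed.

(* [c3 k = cos (2 pi k / 3)], and [sin (2 pi k / 3) = sqrt 3 / 2 * chi3 k] with
   [chi3] the nontrivial Dirichlet character modulo 3. *)
Fixpoint c3_chi3 (n : nat) : R * R :=
  match n with
  | O => (1, 0)%R
  | S m => let (c, s) := c3_chi3 m in
           (- (1 / 2) * c - 3 / 4 * s, c - 1 / 2 * s)%R
  end.
Definition c3 (n : nat) : R := fst (c3_chi3 n).
Definition chi3 (n : nat) : R := snd (c3_chi3 n).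

Lemma c3_O : c3 0 = 1%R.
Proof. reflexivity. Qed.

Lemma chi3_O : chi3 0 = 0%R.
Proof. reflexivity. Qed.

Lemma c3_S n : c3 (S n) = (- (1 / 2) * c3 n - 3 / 4 * chi3 n)%R.
Proof. unfold c3, chi3; simpl; destruct (c3_chi3 n); reflexivity. Qed.

Lemma chi3_S n : chi3 (S n) = (c3 n - 1 / 2 * chi3 n)%R.
Proof. unfold c3, chi3; simpl; destruct (c3_chi3 n); reflexivity. Qed.

Global Opaque c3 chi3.

Lemma c3_chi3_add a b :
  (c3 (a + b) = c3 a * c3 b - 3 / 4 * (chi3 a * chi3 b) /\
   chi3 (a + b) = chi3 a * c3 b + c3 a * chi3 b)%R.
Proof.
  induction a as [|a [IH1 IH2]]; [simpl; rewrite c3_O, chi3_O; split; ring|].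
  cbn [Nat.add]; rewrite !c3_S, !chi3_S, IH1, IH2; split; field.
Qed.

Lemma c3_chi3_norm a : (c3 a * c3 a + 3 / 4 * (chi3 a * chi3 a) = 1)%R.
Proof.
  induction a as [|a IH]; [rewrite c3_O, chi3_O; ring|].
  rewrite c3_S, chi3_S.
  transitivity (c3 a * c3 a + 3 / 4 * (chi3 a * chi3 a))%R; [field|exact IH].
Qed.

Lemma c3_chi3_sub m b :
  (c3 m = c3 (m + b) * c3 b + 3 / 4 * (chi3 (m + b) * chi3 b) /\
   chi3 m = chi3 (m + b) * c3 b - c3 (m + b) * chi3 b)%R.
Proof.
  destruct (c3_chi3_add m b) as [-> ->]; assert (N := c3_chi3_norm b); split.
  - transitivity (c3 m * (c3 b * c3 b + 3 / 4 * (chi3 b * chi3 b)))%R; [rewrite N|]; ring.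
  - transitivity (chi3 m * (c3 b * c3 b + 3 / 4 * (chi3 b * chi3 b)))%R; [rewrite N|]; ring.
Qed.

(** The identity and [chi3] are odd, so at |a - b| they pick up the same sign s, which squares away
    in the even functions fed to [lambert_square]. *)
Lemma ndist_spec a b : exists s : R, (s = 1 \/ s = -1)%R /\
  INR (ndist a b) = (s * (INR a - INR b))%R /\
  c3 (ndist a b) = (c3 a * c3 b + 3 / 4 * (chi3 a * chi3 b))%R /\
  chi3 (ndist a b) = (s * (chi3 a * c3 b - c3 a * chi3 b))%R.
Proof.
  destruct (Nat.le_ge_cases a b) as [H|H].
  - exists (-1)%R; split; [now right|].
    replace b with (ndist a b + a)%nat by (unfold ndist; lia).
    replace (ndist a (ndist a b + a)) with (ndist a b) by (unfold ndist; lia).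
    destruct (c3_chi3_sub (ndist a b) a) as [E1 E2]; rewrite plus_INR; repeat split.
    + ring.
    + rewrite E1; ring.
    + rewrite E2; ring.
  - exists 1%R; split; [now left|].
    replace a with (ndist a b + b)%nat by (unfold ndist; lia).
    replace (ndist (ndist a b + b) b) with (ndist a b) by (unfold ndist; lia).
    destruct (c3_chi3_sub (ndist a b) b) as [E1 E2]; rewrite plus_INR; repeat split.
    + ring.
    + rewrite E1; ring.
    + rewrite E2; ring.
Qed.

(* [lambert_square] for [f k = k * g k], the terms [f(m) w_m^2] being absorbed
   in a derivative; the integer [z] clears denominators. *)
Lemma lambert_square_derive (z : Z) e g (c : nat -> R) (d : nat -> nat -> R) :
  (1 <= e)%nat ->
  (forall a b, IZR z * (INR (ndist a b) * g (ndist a b)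
     - INR (a + b) * g (a + b)%nat) = d a b)%R ->
  (forall m, IZR z * ((INR (S m) + 1) * (INR (S m) * g (S m))
     + 2 * psum (fun k => INR k * g k) m) = c (S m))%R ->
  fc (INR e) * LS2 (fwe e) d =
  fz 2 * fz z * fD (LS (fwe e) g) - fc (INR e) * LS (fwe e) c.
Proof.
  intros He Hd Hc.
  rewrite <- (LS2_ext (fwe e) _ d (fun a b _ _ => Hd a b)), LS2_scal.
  rewrite (lambert_square (fwe e) (fun k => INR k * g k)%R (fwe_graded e He))
    by (intros; now apply fwe_rel).
  rewrite (LS_derive e g He).
  rewrite (LS_ext (fwe e) c (fun m => IZR z * (((INR m - 1) * (INR m * g m)
     + 2 * psum (fun k => INR k * g k) (m - 1)) + 2 * (INR m * g m)))%R).
  2:{ intros [|k] Hk; [lia|]; rewrite <- Hc.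
      replace (S k - 1)%nat with k by lia; ring. }
  rewrite (LS_scal (fwe e) (IZR z)).
  rewrite (LS_add (fwe e) (fun m => (INR m - 1) * (INR m * g m)
     + 2 * psum (fun k => INR k * g k) (m - 1))%R), (LS_scal (fwe e) 2).
  replace (fc (INR 0 * g 0%nat)) with (fz 0) by (unfold fz; f_equal; simpl; ring).
  change (fc 2) with (fz 2); change (fc (IZR z)) with (fz z); ring.
Qed.

Ltac fc_to_fz := repeat match goal with
  | H : context [fc (IZR ?z)] |- _ => change (fc (IZR z)) with (fz z) in H
  | |- context [fc (IZR ?z)] => change (fc (IZR z)) with (fz z) end.

Ltac ndist_expand := let a := fresh in let b := fresh in
  intros a b;
  let s := fresh in let Hs := fresh in
  let E1 := fresh in let E2 := fresh in let E3 := fresh in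
  destruct (ndist_spec a b) as (s & Hs & E1 & E2 & E3);
  rewrite ?E1, ?E2, ?E3;
  rewrite ?(proj1 (c3_chi3_add a b)), ?(proj2 (c3_chi3_add a b)), plus_INR;
  destruct Hs as [-> | ->]; field.

(** The closed form of the partial sum is supplied and checked by induction; the goal is then a
    polynomial identity in m, [c3 m] and [chi3 m]. *)
Ltac psum_formula F := let m := fresh "m" in intros m;
  let v := eval cbv beta in (F m) in replace (psum _ m) with v;
  [ rewrite ?S_INR, ?c3_S, ?chi3_S, ?c3_S, ?chi3_S; field
  | symmetry; induction m as [|m IH];
    [simpl; rewrite ?c3_S, ?chi3_S, ?c3_S, ?chi3_S, ?c3_O, ?chi3_O; field|];
    cbn [psum]; rewrite IH, ?S_INR, ?c3_S, ?chi3_S, ?c3_S, ?chi3_S; field ].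

Ltac LS_expand H :=
  rewrite ?LS2_add, ?LS2_scal, ?LS2_prod in H by (apply fwe_graded; lia);
  rewrite ?LS_add, ?LS_scal in H; fc_to_fz.

(** Second derivative at theta = 0: f k = k^2 and (a - b)^2 - (a + b)^2 = -4 a b. The factor 3
    clears the denominator of twice the sum of squares. *)
Lemma LS_square_1 e : (1 <= e)%nat ->
  let T j := LS (fwe e) (fun k => INR k ^ j)%R in
  fc (INR e) * (fz (-12) * (T 1%nat * T 1%nat))
  = fz 6 * fD (T 1%nat) - fc (INR e) * (fz 5 * T 3%nat + T 1%nat).
Proof.
  intros He T.
  assert (H := lambert_square_derive 3 e (fun k => INR k ^ 1)%R
    (fun m => 5 * INR m ^ 3 + 1 * INR m ^ 1)%R
    (fun a b => (-12) * (INR a ^ 1 * INR b ^ 1))%R He).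
  LS_expand H; fold (T 1%nat) in H; fold (T 3%nat) in H; rewrite H.
  - ring.
  - ndist_expand.
  - psum_formula (fun m => (INR m * (INR m + 1) * (2 * INR m + 1)) / 6)%R.
Qed.

(** Fourth derivative at theta = 0, f k = k^4; 15 clears the denominator of twice the sum of fourth
    powers. *)
Lemma LS_square_3 e : (1 <= e)%nat ->
  let T j := LS (fwe e) (fun k => INR k ^ j)%R in
  fc (INR e) * (fz (-240) * (T 3%nat * T 1%nat))
  = fz 30 * fD (T 3%nat)
    - fc (INR e) * (fz 21 * T 5%nat + fz 10 * T 3%nat - T 1%nat).
Proof.
  intros He T.
  assert (H := lambert_square_derive 15 e (fun k => INR k ^ 3)%R
    (fun m => 21 * INR m ^ 5 + 10 * INR m ^ 3 + (-1) * INR m ^ 1)%R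
    (fun a b => (-120) * (INR a ^ 3 * INR b ^ 1) + (-120) * (INR a ^ 1 * INR b ^ 3))%R He).
  LS_expand H; fold (T 1%nat) in H; fold (T 3%nat) in H; fold (T 5%nat) in H.
  transitivity (fc (INR e) *
    (fz (-120) * (T 3%nat * T 1%nat) + fz (-120) * (T 1%nat * T 3%nat))); [ring|].
  rewrite H.
  - ring.
  - ndist_expand.
  - psum_formula (fun m => (6 * INR m ^ 5 + 15 * INR m ^ 4 + 10 * INR m ^ 3 - INR m) / 30)%R.
Qed.

(** For j = 1, 3, 5, [Sk j] and [Vk j] are the Lambert series of weight j + 1 Eisenstein series at
    tau and 3 tau. [Xk] and [Yk] are the twists that appear at theta = 2 pi / 3: [Xk 0] and [Xk 2]
    lead to a and b, while the [Yk j] get eliminated. *)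
Definition Sk (j : nat) := LS (fwe 1) (fun k => INR k ^ j)%R.
Definition Vk (j : nat) := LS (fwe 3) (fun k => INR k ^ j)%R.
Definition Xk (j : nat) := LS (fwe 1) (fun k => INR k ^ j * chi3 k)%R.
Definition Yk (j : nat) := LS (fwe 1) (fun k => INR k ^ j * c3 k)%R.

Ltac fold_LS H :=
  repeat match type of H with
  | context [LS (fwe 1) (fun k => INR k ^ ?j * chi3 k)%R] => fold (Xk j) in H
  | context [LS (fwe 1) (fun k => INR k ^ ?j * c3 k)%R] => fold (Yk j) in H
  end; change (fc (INR 1)) with (fz 1) in H.

(** This and the next three lemmas are the derivatives of orders 1 to 4 at theta = 2 pi / 3, with f
    k = k chi3, k^2 c3, k^3 chi3, k^4 c3: relations of weights 3, 4, 5 and 6. *)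
Lemma Xk_Yk_0 : fz (-12) * (Xk 0 * Yk 1)
  = fz 6 * fD (Xk 0) + fz 2 * Yk 1 - fz 2 * Xk 0 - fz 3 * Xk 2.
Proof.
  assert (H := lambert_square_derive 3 1 (fun k => INR k ^ 0 * chi3 k)%R
    (fun m => (-2) * (INR m ^ 1 * c3 m) + 2 * (INR m ^ 0 * chi3 m)
       + 3 * (INR m ^ 2 * chi3 m))%R
    (fun a b => (-6) * ((INR a ^ 0 * chi3 a) * (INR b ^ 1 * c3 b))
       + (-6) * ((INR a ^ 1 * c3 a) * (INR b ^ 0 * chi3 b)))%R (Nat.le_refl 1)).
  LS_expand H; fold_LS H.
  transitivity (fz 1 * (fz (-6) * (Xk 0 * Yk 1) + fz (-6) * (Yk 1 * Xk 0))); [ring|].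
  rewrite H; [ring|ndist_expand|].
  psum_formula (fun m => - (1/3) * INR (S m) * c3 (S m) + 1/3 * chi3 (S m)
    - 1 / 2 * INR (S m) * chi3 (S m))%R.
Qed.

Lemma Yk_Yk_1 : fz (-24) * (Yk 1 * Yk 1) + fz 18 * (Xk 2 * Xk 0)
  = fz 12 * fD (Yk 1) - fz 8 * Yk 1 - fz 6 * Yk 3 + fz 2 * Xk 0 - fz 3 * Xk 2.
Proof.
  assert (H := lambert_square_derive 6 1 (fun k => INR k ^ 1 * c3 k)%R
    (fun m => 8 * (INR m ^ 1 * c3 m) + 6 * (INR m ^ 3 * c3 m)
       + (-2) * (INR m ^ 0 * chi3 m) + 3 * (INR m ^ 2 * chi3 m))%R
    (fun a b => (-24) * ((INR a ^ 1 * c3 a) * (INR b ^ 1 * c3 b))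
       + 9 * ((INR a ^ 2 * chi3 a) * (INR b ^ 0 * chi3 b))
       + 9 * ((INR a ^ 0 * chi3 a) * (INR b ^ 2 * chi3 b)))%R (Nat.le_refl 1)).
  LS_expand H; fold_LS H.
  transitivity (fz 1 * (fz (-24) * (Yk 1 * Yk 1) + fz 9 * (Xk 2 * Xk 0)
    + fz 9 * (Xk 0 * Xk 2))); [ring|].
  rewrite H; [ring|ndist_expand|].
  psum_formula (fun m => 2 / 3 * INR (S m) * c3 (S m) - 1 / 2 * INR (S m) ^ 2 * c3 (S m)
    - 1 / 6 * chi3 (S m) + 1 / 4 * INR (S m) ^ 2 * chi3 (S m))%R.
Qed.

Lemma Xk_Yk_2 : fz (-36) * (Xk 2 * Yk 1) - fz 12 * (Xk 0 * Yk 3)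
  = fz 6 * fD (Xk 2) - fz 4 * Yk 1 + fz 2 * Yk 3 + fz 2 * Xk 0 - fz 6 * Xk 2
    - fz 3 * Xk 4.
Proof.
  assert (H := lambert_square_derive 3 1 (fun k => INR k ^ 2 * chi3 k)%R
    (fun m => 4 * (INR m ^ 1 * c3 m) + (-2) * (INR m ^ 3 * c3 m)
       + (-2) * (INR m ^ 0 * chi3 m) + 6 * (INR m ^ 2 * chi3 m)
       + 3 * (INR m ^ 4 * chi3 m))%R
    (fun a b => (-18) * ((INR a ^ 2 * chi3 a) * (INR b ^ 1 * c3 b))
       + (-18) * ((INR a ^ 1 * c3 a) * (INR b ^ 2 * chi3 b))
       + (-6) * ((INR a ^ 0 * chi3 a) * (INR b ^ 3 * c3 b))
       + (-6) * ((INR a ^ 3 * c3 a) * (INR b ^ 0 * chi3 b)))%R (Nat.le_refl 1)).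
  LS_expand H; fold_LS H.
  transitivity (fz 1 * (fz (-18) * (Xk 2 * Yk 1) + fz (-18) * (Yk 1 * Xk 2)
    + fz (-6) * (Xk 0 * Yk 3) + fz (-6) * (Yk 3 * Xk 0))); [ring|].
  rewrite H; [ring|ndist_expand|].
  psum_formula (fun m => 2 / 3 * INR (S m) * c3 (S m) - 1 / 3 * INR (S m) ^ 3 * c3 (S m)
    - 1 / 3 * chi3 (S m) + INR (S m) ^ 2 * chi3 (S m)
    - 1 / 2 * INR (S m) ^ 3 * chi3 (S m))%R.
Qed.

Lemma Yk_Yk_3 : fz (-96) * (Yk 3 * Yk 1) + fz 18 * (Xk 4 * Xk 0) + fz 54 * (Xk 2 * Xk 2)
  = fz 12 * fD (Yk 3) + fz 16 * Yk 1 - fz 16 * Yk 3 - fz 6 * Yk 5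
    - fz 6 * Xk 0 + fz 12 * Xk 2 - fz 3 * Xk 4.
Proof.
  assert (H := lambert_square_derive 6 1 (fun k => INR k ^ 3 * c3 k)%R
    (fun m => (-16) * (INR m ^ 1 * c3 m) + 16 * (INR m ^ 3 * c3 m)
       + 6 * (INR m ^ 5 * c3 m)
       + 6 * (INR m ^ 0 * chi3 m) + (-12) * (INR m ^ 2 * chi3 m)
       + 3 * (INR m ^ 4 * chi3 m))%R
    (fun a b => (-48) * ((INR a ^ 3 * c3 a) * (INR b ^ 1 * c3 b))
       + (-48) * ((INR a ^ 1 * c3 a) * (INR b ^ 3 * c3 b))
       + 9 * ((INR a ^ 4 * chi3 a) * (INR b ^ 0 * chi3 b))
       + 9 * ((INR a ^ 0 * chi3 a) * (INR b ^ 4 * chi3 b))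
       + 54 * ((INR a ^ 2 * chi3 a) * (INR b ^ 2 * chi3 b)))%R (Nat.le_refl 1)).
  LS_expand H; fold_LS H.
  transitivity (fz 1 * (fz (-48) * (Yk 3 * Yk 1) + fz (-48) * (Yk 1 * Yk 3)
    + fz 9 * (Xk 4 * Xk 0) + fz 9 * (Xk 0 * Xk 4) + fz 54 * (Xk 2 * Xk 2))); [ring|].
  rewrite H; [ring|ndist_expand|].
  psum_formula (fun m => - (4 / 3) * INR (S m) * c3 (S m) + 4 / 3 * INR (S m) ^ 3 * c3 (S m)
    - 1 / 2 * INR (S m) ^ 4 * c3 (S m)
    + 1 / 2 * chi3 (S m) - INR (S m) ^ 2 * chi3 (S m)
    + 1 / 4 * INR (S m) ^ 4 * chi3 (S m))%R.
Qed.

Lemma c3_multiple k : (c3 (3 * k) = 1 /\ c3 (3 * k + 1) = - (1 / 2)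
  /\ c3 (3 * k + 2) = - (1 / 2) /\ chi3 (3 * k) = 0)%R.
Proof.
  induction k as [|k (IH1 & IH2 & IH3 & IH4)].
  - simpl; rewrite ?c3_S, ?chi3_S, ?c3_S, ?chi3_S, c3_O, chi3_O; repeat split; field.
  - replace (3 * S k)%nat with (S (S (S (3 * k)))) by lia.
    generalize dependent (3 * k)%nat; intros n E1 _ _ E4.
    rewrite <- !plus_n_Sm, <- plus_n_O.
    rewrite ?c3_S, ?chi3_S, ?c3_S, ?chi3_S, ?c3_S, ?chi3_S, ?c3_S, ?chi3_S, ?c3_S, ?chi3_S.
    rewrite E1, E4; repeat split; field.
Qed.

(* [(1 + 2 c3 k) / 3] is the indicator of the multiples of 3. *)
Lemma psum_multiples g n :
  psum (fun k => (1 + 2 * c3 k) * g k)%R (3 * n) = psum (fun j => 3 * g (3 * j)%nat)%R n.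
Proof.
  induction n as [|n IH]; [reflexivity|].
  replace (3 * S n)%nat with (S (S (S (3 * n)))) by lia.
  cbn [psum]; rewrite IH.
  destruct (c3_multiple n) as (_ & E1 & E2 & _); destruct (c3_multiple (S n)) as (E3 & _).
  replace (S (3 * n)) with (3 * n + 1)%nat by lia.
  replace (S (3 * n + 1)) with (3 * n + 2)%nat by lia.
  replace (S (3 * n + 2)) with (3 * S n)%nat by lia.
  rewrite E1, E2, E3; field.
Qed.

(** The factor 1 + 2 [c3 k] keeps the multiples of 3, which turns series in q into series in q^3.
    The map h is arbitrary in order to cover both w_k and w_k^2. *)
Lemma LS_multiples (h : fps -> fps) c : (forall k, (1 <= k)%nat -> vanish k (h (fw k))) ->
  LS (fun k => h (fwe 1 k)) (fun k => (1 + 2 * c3 k) * c k)%R =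
  LS (fun k => h (fwe 3 k)) (fun k => 3 * c (3 * k)%nat)%R.
Proof.
  intros Hh; extensionality n; rewrite !LS_coef.
  rewrite <- (psum_extend _ n (3 * n)).
  - rewrite (psum_ext _ (fun k => (1 + 2 * c3 k) * (c k * h (fw k) n))%R).
    + rewrite psum_multiples; apply psum_ext; intros k _; unfold fwe; ring.
    + intros k _; unfold fwe; rewrite Nat.mul_1_l; ring.
  - lia.
  - intros k Hk; unfold fwe; rewrite Nat.mul_1_l, Hh by lia; ring.
Qed.

(** The case h = identity of [LS_multiples]; it expresses every [Yk j] through Eisenstein series at
    tau and 3 tau. *)
Lemma Yk_eq j : Sk j + fz 2 * Yk j = fz (3 ^ (Z.of_nat (S j))) * Vk j.
Proof.
  unfold Sk, Yk, Vk, fz; rewrite <- !LS_scal, <- LS_add.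
  rewrite (LS_ext (fwe 1) _ (fun k => (1 + 2 * c3 k) * INR k ^ j)%R)
    by (intros; ring).
  etransitivity; [apply (LS_multiples (fun s => s) (fun k => INR k ^ j)%R);
    intros; now apply fw_graded|].
  apply LS_ext; intros k _; rewrite mult_INR, Rpow_mult_distr.
  rewrite <- pow_IZR; replace (INR 3) with 3%R by (simpl; ring).
  change (3 ^ S j)%R with (3 * 3 ^ j)%R; ring.
Qed.

(** The undifferentiated identity at theta = 2 pi / 3, with f k = 2 [c3 k]; the sums of w_k^2 are
    traded for [Sk 1] and [Vk 1] by [LS_divisor_symm] at q and q^3. In other words 2 a^2 = 3 E2(3
    tau) - E2(tau). *)
Lemma Xk_sq : fz 3 * (Xk 0 * Xk 0) = Sk 1 - fz 3 * Vk 1 - Xk 0.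
Proof.
  assert (H := lambert_square (fwe 1) (fun k => 2 * c3 k)%R (fwe_graded 1 (Nat.le_refl 1))
    (fun a b => fwe_rel 1 a b (Nat.le_refl 1))).
  rewrite (LS2_ext (fwe 1) _ (fun a b => 3 * ((INR a ^ 0 * chi3 a) * (INR b ^ 0 * chi3 b)))%R) in H.
  2:{ intros a b _ _; destruct (ndist_spec a b) as (s & _ & _ & -> & _).
      rewrite (proj1 (c3_chi3_add a b)); field. }
  rewrite LS2_scal, LS2_prod in H by (apply fwe_graded; lia).
  rewrite (LS_ext (fwe 1)
    (fun m => (INR m - 1) * (2 * c3 m) + 2 * psum (fun k => 2 * c3 k) (m - 1))%R
    (fun m => (-2) * (INR m ^ 0) + (-4) * (INR m ^ 0 * c3 m)
    + 2 * (INR m ^ 1 * c3 m) + 1 * (INR m ^ 0 * chi3 m))%R) in H.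
  2:{ intros [|m] Hm; [lia|]; cbv beta; replace (S m - 1)%nat with m by lia.
      clear Hm H; revert m.
      psum_formula (fun m => -1 - c3 (S m) + 1 / 2 * chi3 (S m))%R. }
  assert (D1 := LS_divisor_symm 1 (Nat.le_refl 1)).
  assert (D3 := LS_divisor_symm 3 ltac:(lia)).
  rewrite !LS_add, !LS_scal in H.
  assert (F1 : LS (fwe 1) INR = Sk 1) by (apply LS_ext; intros; ring).
  assert (F2 : LS (fwe 3) INR = Vk 1) by (apply LS_ext; intros; ring).
  assert (F3 : LS (fwe 1) (fun _ => 1%R) = Sk 0) by (apply LS_ext; intros; ring).
  assert (F4 : LS (fwe 3) (fun _ => 1%R) = Vk 0) by (apply LS_ext; intros; ring).
  rewrite F1, F3 in D1; rewrite F2, F4 in D3.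
  fold_LS H; fold (Sk 0) in H.
  assert (Y0 := Yk_eq 0); assert (Y1 := Yk_eq 1).
  change (3 ^ Z.of_nat 1)%Z with 3%Z in Y0; change (3 ^ Z.of_nat 2)%Z with 9%Z in Y1.
  replace (fc (2 * c3 0)) with (fz 2) in H by (unfold fz; f_equal; rewrite c3_O; ring).
  fc_to_fz.
  set (Q1 := LS (fun k => fwe 1 k * fwe 1 k) (fun _ => 1%R)) in *.
  set (QC := LS (fun k => fwe 1 k * fwe 1 k) (fun k => c3 k)) in *.
  set (Q3 := LS (fun k => fwe 3 k * fwe 3 k) (fun _ => 1%R)) in *.
  change (LS (fun k => fwe 1 k * fwe 1 k) c3) with QC in *.
  assert (E3' : Q1 + fz 2 * QC = fz 3 * Q3).
  { unfold Q1, QC, Q3, fz; rewrite <- !LS_scal, <- LS_add.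
    etransitivity; [|etransitivity; [apply (LS_multiples (fun s => s * s) (fun _ => 1%R))|]].
    - apply LS_ext; intros; ring.
    - intros k Hk; apply vanish_mulr, fw_graded, Hk.
    - apply LS_ext; intros; ring. }
  rewrite H.
  transitivity (fz 2 * (Q1 + fz 2 * QC) + fz 2 * Sk 0 + fz 4 * Yk 0 - fz 2 * Yk 1 - Xk 0);
    [ring|].
  rewrite E3'.
  transitivity (fz 6 * ((Vk 0 + Q3) - Vk 0) + fz 2 * (Sk 0 + fz 2 * Yk 0)
    - (Sk 1 + fz 2 * Yk 1) + Sk 1 - Xk 0); [ring|].
  rewrite D3, Y0, Y1; ring.
Qed.

End Level3.

(** * Ramanujan's differential equations in levels 1 and 3 *)

Section RamanujanSystem.
Local Open Scope fps_scope.

(** Makes an equation usable as a term: [lincomb] takes a combination of known equations with series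
    as coefficients, [ring] checks it, and every [eq_diff] is then replaced by 0. *)
Definition eq_diff {l r : fps} (_ : l = r) : fps := l - r.

Lemma eq_diff_0 {l r : fps} (H : l = r) : eq_diff H = 0.
Proof. unfold eq_diff; rewrite H; ring. Qed.

Lemma fsub_eq_0 (l r : fps) : l - r = 0 -> l = r.
Proof. intros H; transitivity (l - r + r); [|rewrite H]; ring. Qed.

Ltac lincomb t :=
  apply fsub_eq_0; transitivity t; [unfold eq_diff; ring | rewrite !eq_diff_0; ring].

Lemma fD_fz z a : fD (fz z * a) = fz z * fD a.
Proof. apply fD_scal. Qed.

Lemma fD_fz_cst z : fD (fz z) = 0.
Proof. apply fD_fc. Qed.

Definition fP : fps := 1 - fz 24 * Sk 1.
Definition fQ : fps := 1 + fz 240 * Sk 3.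
Definition fR : fps := 1 - fz 504 * Sk 5.
Definition fP3 : fps := 1 - fz 24 * Vk 1.
Definition fQ3 : fps := 1 + fz 240 * Vk 3.
Definition fR3 : fps := 1 - fz 504 * Vk 5.
(* Borwein's a(q) and b(q)^3 *)
Definition fa : fps := 1 + fz 6 * Xk 0.
Definition fB : fps := 1 - fz 9 * Xk 2.

Ltac fD_expand := rewrite ?fD_add, ?fD_sub, ?fD_fz, ?fD_fc.

Lemma fD_fP : fz 12 * fD fP = fP * fP - fQ.
Proof.
  unfold fP, fQ; fD_expand.
  assert (H := LS_square_1 1 (Nat.le_refl 1)); cbv beta zeta in H; fold (Sk 1) (Sk 3) in H.
  change (fc (INR 1)) with (fz 1) in H.
  lincomb (fz 48 * eq_diff H).
Qed.

Lemma fD_fQ : fz 3 * fD fQ = fP * fQ - fR.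
Proof.
  unfold fP, fQ, fR; fD_expand.
  assert (H := LS_square_3 1 (Nat.le_refl 1)); cbv beta zeta in H; fold (Sk 1) (Sk 3) (Sk 5) in H.
  change (fc (INR 1)) with (fz 1) in H.
  lincomb (fz (-24) * eq_diff H).
Qed.

Lemma fc_INR_3 : fc (INR 3) = fz 3.
Proof. unfold fz; f_equal; simpl; ring. Qed.

(** The 4 in place of 12 reflects that q d/dq of a series in q^3 carries a factor 3. *)
Lemma fD_fP3 : fz 4 * fD fP3 = fP3 * fP3 - fQ3.
Proof.
  unfold fP3, fQ3; fD_expand.
  assert (H := LS_square_1 3 ltac:(lia)).
  cbv beta zeta in H; fold (Vk 1) (Vk 3) in H; rewrite fc_INR_3 in H.
  apply (fz_cancel 3); [discriminate|].
  lincomb (fz 48 * eq_diff H).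
Qed.

Lemma fD_fQ3 : fD fQ3 = fP3 * fQ3 - fR3.
Proof.
  unfold fP3, fQ3, fR3; fD_expand.
  assert (H := LS_square_3 3 ltac:(lia)).
  cbv beta zeta in H; fold (Vk 1) (Vk 3) (Vk 5) in H; rewrite fc_INR_3 in H.
  apply (fz_cancel 3); [discriminate|].
  lincomb (fz (-24) * eq_diff H).
Qed.

Lemma fa_sq : fP = fz 3 * fP3 - fz 2 * (fa * fa).
Proof.
  unfold fP, fP3, fa.
  lincomb (fz 24 * eq_diff Xk_sq).
Qed.

(** The weight 3 relation, after removing [Yk 1] by [Yk_eq] and [Vk 1] by [Xk_sq]. *)
Lemma fD_fa : fz 12 * fD fa = fa * (fz 3 * (fa * fa) + fP) - fz 4 * fB.
Proof.
  unfold fP, fP3, fa, fB; fD_expand.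
  assert (Hy := Yk_eq 1); change (3 ^ Z.of_nat 2)%Z with 9%Z in Hy.
  lincomb (fz (-12) * eq_diff Xk_Yk_0
    - (1 + fz 6 * Xk 0) * (fz 12 * eq_diff Hy + fz 36 * eq_diff Xk_sq)).
Qed.

Lemma Yk_1_eq : fz 48 * Yk 1 = fz 8 - fz 9 * fP3 + fP.
Proof.
  assert (H := Yk_eq 1); change (3 ^ Z.of_nat 2)%Z with 9%Z in H.
  unfold fP, fP3; lincomb (fz 24 * eq_diff H).
Qed.

Lemma Yk_3_eq : fz 480 * Yk 3 = fz 81 * fQ3 - fQ - fz 80.
Proof.
  assert (H := Yk_eq 3); change (3 ^ Z.of_nat 4)%Z with 81%Z in H.
  unfold fQ, fQ3; lincomb (fz 240 * eq_diff H).
Qed.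

Lemma Yk_5_eq : fz 1008 * Yk 5 = fz 728 - fz 729 * fR3 + fR.
Proof.
  assert (H := Yk_eq 5); change (3 ^ Z.of_nat 6)%Z with 729%Z in H.
  unfold fR, fR3; lincomb (fz 504 * eq_diff H).
Qed.

Lemma Xk_0_eq : fz 6 * Xk 0 = fa - 1.
Proof. unfold fa; ring. Qed.

Lemma Xk_2_eq : fz 9 * Xk 2 = 1 - fB.
Proof. unfold fB; ring. Qed.

(** Differentiate [fa_sq] and substitute the three known derivatives; the terms in E2(3 tau)
    cancel. *)
Lemma fQ_sub_fQ3 :
  fQ - fz 9 * fQ3 = fz 8 * (fa * fa * (fa * fa)) - fz 16 * (fa * fB).
Proof.
  assert (H := f_equal fD fa_sq).
  rewrite fD_sub, !fD_fz, fD_mul in H.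
  assert (Ha := fa_sq); assert (H1 := fD_fP); assert (H3 := fD_fP3);
  assert (H2 := fD_fa).
  rewrite Ha in H1, H2.
  assert (H' : fz 12 * fD fP = fz 36 * fD fP3 - fz 4 * (fa * (fz 12 * fD fa)))
    by (rewrite H; ring).
  rewrite Ha in H'; rewrite H1, H2 in H'.
  lincomb (fz (-1) * eq_diff H' - fz 9 * eq_diff H3).
Qed.

(** A second linear relation between E4(tau) and E4(3 tau), from the weight 4 relation; with
    [fQ_sub_fQ3] it determines both in terms of [fa] and [fB]. *)
Lemma fQ_add_fQ3 :
  fQ + fz 54 * fQ3 = fz 15 * (fa * fa * (fa * fa)) + fz 40 * (fa * fB).
Proof.
  assert (H : fz (-5) * ((fz 48 * Yk 1) * (fz 48 * Yk 1))
     + fz 160 * ((fz 9 * Xk 2) * (fz 6 * Xk 0))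
   = fz 120 * fD (fz 48 * Yk 1) - fz 80 * (fz 48 * Yk 1) - fz 6 * (fz 480 * Yk 3)
     + fz 160 * (fz 6 * Xk 0) - fz 160 * (fz 9 * Xk 2)).
  { rewrite fD_fz; lincomb (fz 480 * eq_diff Yk_Yk_1). }
  rewrite Yk_1_eq, Yk_3_eq, Xk_0_eq, Xk_2_eq in H.
  rewrite ?fD_add, ?fD_sub, ?fD_fz, ?fD_fz_cst in H.
  assert (H1 := fD_fP); assert (H3 := fD_fP3).
  set (DP := fD fP) in *; set (DP3 := fD fP3) in *; clearbody DP DP3.
  rewrite fa_sq in H, H1.
  apply (fz_cancel 4); [discriminate|].
  lincomb (fz 1 * eq_diff H + fz 10 * eq_diff H1 - fz 270 * eq_diff H3).
Qed.

Lemma fQ3_eq : fz 9 * fQ3 = fa * fa * (fa * fa) + fz 8 * (fa * fB).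
Proof.
  apply (fz_cancel 7); [discriminate|].
  lincomb (eq_diff fQ_add_fQ3 - eq_diff fQ_sub_fQ3).
Qed.

Lemma fQ_eq : fQ = fz 9 * (fa * fa * (fa * fa)) - fz 8 * (fa * fB).
Proof. lincomb (eq_diff fQ_sub_fQ3 + eq_diff fQ3_eq). Qed.

(* The weight 5 and 6 relations determine D fB up to the common factor fa. *)
Lemma fD_fB : fz 4 * fD fB = fB * (fP - fa * fa).
Proof.
  set (da := fa * (fz 3 * (fa * fa) + fP) - fz 4 * fB).
  assert (Ha : fz 12 * fD fa = da) by exact fD_fa.
  (* So far [fR] and [fR3] are reachable only through the derivatives of [fQ] and [fQ3], hence in
     terms of the unknown [fD fB]. *)
  assert (HQ : fz 1 * fD fQ = fz 3 * (fa * fa * fa) * da - fz 8 * (fa * fD fB)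
     - fz 8 * (fB * fD fa)).
  { rewrite fQ_eq, <- Ha, fD_sub, !fD_fz, !fD_mul; ring. }
  assert (HQ3 : fz 27 * fD fQ3 = fa * fa * fa * da + fz 24 * (fa * fD fB)
     + fz 2 * (fB * da)).
  { transitivity (fz 3 * fD (fz 9 * fQ3)); [rewrite fD_fz; ring|].
    rewrite fQ3_eq, <- Ha, fD_add, !fD_fz, !fD_mul; ring. }
  assert (HR : fR = fP * fQ - fz 3 * fD fQ) by (rewrite fD_fQ; ring).
  assert (HR' : fR = fP * fQ - fz 9 * (fa * fa * fa) * da + fz 24 * (fa * fD fB)
     + fz 2 * (fB * da)).
  { rewrite HR at 1; lincomb (fz (-3) * eq_diff HQ + fz 2 * fB * eq_diff Ha). }
  assert (H3P : fz 3 * fP3 = fz 2 * (fa * fa) + fP).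
  { rewrite fa_sq; ring. }
  assert (HR3 : fz 27 * fR3 = (fz 2 * (fa * fa) + fP) * (fa * fa * (fa * fa) + fz 8 * (fa * fB))
     - (fa * fa * fa * da + fz 24 * (fa * fD fB) + fz 2 * (fB * da))).
  { rewrite <- HQ3, <- H3P, <- fQ3_eq.
    lincomb (fz 27 * eq_diff fD_fQ3). }
  assert (Hy1 : fz 48 * Yk 1 = fz 8 - fz 6 * (fa * fa) - fz 2 * fP).
  { lincomb (eq_diff Yk_1_eq - fz 3 * eq_diff H3P). }
  assert (Hy3 : fz 480 * Yk 3 = fz 80 * (fa * fB) - fz 80).
  { lincomb (eq_diff Yk_3_eq + fz 9 * eq_diff fQ3_eq - eq_diff fQ_eq). }
  assert (Hy5 : fz 1008 * Yk 5 = fz 728 - fz 27 * (fz 27 * fR3) + fR).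
  { rewrite Yk_5_eq; ring. }
  assert (HdX : fz 9 * fD (Xk 2) = - fD fB).
  { unfold fB; fD_expand; ring. }
  assert (HdY : fz 6 * fD (fz 480 * Yk 3) = fz 40 * (fB * da) + fz 480 * (fa * fD fB)).
  { rewrite Hy3, fD_sub, fD_fz, fD_fz_cst, fD_mul.
    lincomb (fz 40 * fB * eq_diff Ha). }
  (* The weight 5 relation, solved for [Xk 4]. *)
  assert (E6 : fz 720 * Xk 4 = fz 160 * (fz 9 * fD (Xk 2)) - fz 20 * (fz 48 * Yk 1)
     + fz 480 * Yk 3 + fz 80 * (fz 6 * Xk 0) - fz 160 * (fz 9 * Xk 2)
     + fz 20 * ((fz 9 * Xk 2) * (fz 48 * Yk 1)) + (fz 6 * Xk 0) * (fz 480 * Yk 3)).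
  { lincomb (fz 240 * eq_diff Xk_Yk_2). }
  (* The weight 6 relation times 1680, so that [Yk 3] and [Yk 5] occur through the multiples 480 and
     1008 computed above. *)
  assert (E7 : fz 7 * (fz 160 * ((fz 9 * Xk 2) * (fz 9 * Xk 2)) - (fz 480 * Yk 3) * (fz 48 * Yk 1)
       + (fz 720 * Xk 4) * (fz 6 * Xk 0))
     = fz 7 * (fz 6 * fD (fz 480 * Yk 3) + fz 80 * (fz 48 * Yk 1) - fz 8 * (fz 480 * Yk 3)
       - fz 240 * (fz 6 * Xk 0) + fz 320 * (fz 9 * Xk 2) - fz 720 * Xk 4)
       - fz 10 * (fz 1008 * Yk 5)).
  { rewrite fD_fz; lincomb (fz 1680 * eq_diff Yk_Yk_3). }
  rewrite Hy5, HR3, HR', HdY, E6, HdX, Hy1, Hy3, Xk_0_eq, Xk_2_eq, fQ_eq in E7.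
  (* After the substitutions the relation is linear in [fD fB] with a common factor [fa], whose
     constant term is 1. *)
  apply (fmul_cancel fa).
  - unfold fa, fadd, Xk, fz; rewrite fmul_fc, LS_coef; simpl; lra.
  - apply (fz_cancel 560); [discriminate|].
    unfold da in E7; lincomb (eq_diff E7).
Qed.

(** Read off from 3 D E4 = E2 E4 - E6, in which the terms in E2 cancel. *)
Lemma fR_eq : fR = fz (-27) * (fa * fa * fa * (fa * fa * fa))
  + fz 36 * (fa * fa * fa * fB) - fz 8 * (fB * fB).
Proof.
  assert (H : fz 3 * fD fQ = fz 9 * (fa * fa * fa) * (fz 12 * fD fa)
     - fz 6 * (fa * (fz 4 * fD fB)) - fz 2 * (fB * (fz 12 * fD fa))).
  { rewrite fQ_eq, fD_sub, !fD_fz, !fD_mul; ring. }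
  rewrite fD_fQ, fD_fB, fD_fa, fQ_eq in H.
  lincomb (fz (-1) * eq_diff H).
Qed.

(** Obtained from the parametrisation by [fa] and [fB], not from another trigonometric sum. *)
Lemma fD_fR : fz 2 * fD fR = fP * fR - fQ * fQ.
Proof.
  transitivity (fz (-27) * (fa * fa * fa * (fa * fa)) * (fz 12 * fD fa)
     + fz 18 * (fa * fa * fB) * (fz 12 * fD fa) + fz 18 * (fa * fa * fa) * (fz 4 * fD fB)
     - fz 8 * fB * (fz 4 * fD fB)).
  - rewrite fR_eq, fD_sub, fD_add, !fD_fz, !fD_mul; ring.
  - rewrite fD_fa, fD_fB, fR_eq, fQ_eq; ring.
Qed.

(* Borwein's c(q)^3 = a(q)^3 - b(q)^3 *)
Definition fC : fps := fa * fa * fa - fB.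

Lemma fD_fC : fz 4 * fD fC = fC * (fz 3 * (fa * fa) + fP).
Proof.
  transitivity ((fa * fa) * (fz 12 * fD fa) - fz 4 * fD fB).
  - unfold fC; rewrite fD_sub, !fD_mul; ring.
  - rewrite fD_fa, fD_fB; unfold fC; ring.
Qed.

End RamanujanSystem.

(** * Complex series and holomorphic functions *)

Definition acvg (c : nat -> C) := ex_series (fun n => Cmod (c n)).

Lemma ex_scal_R (r : R) (a : nat -> R) :
  ex_series a -> ex_series (fun n => r * a n)%R.
Proof. exact (ex_series_scal (K := R_AbsRing) (V := R_NormedModule) r a). Qed.

Lemma ex_ext_R (a b : nat -> R) :
  (forall n, a n = b n) -> ex_series a -> ex_series b.
Proof. exact (ex_series_ext a b). Qed.

Lemma ex_series_nonneg_le (a b : nat -> R) :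
  (forall n, 0 <= a n <= b n)%R -> ex_series b -> ex_series a.
Proof.
  intros H; apply (ex_series_le (K := R_AbsRing) (V := R_CompleteNormedModule)).
  intros n; change (Rabs (a n) <= b n)%R; rewrite Rabs_pos_eq; apply H.
Qed.

Lemma CSeries_eq c :
  CSeries c = (Series (fun n => Re (c n)), Series (fun n => Im (c n))).
Proof.
  unfold CSeries, CLim_seq, Series.
  assert (H : forall n, Re (sum_n c n) = sum_n (fun k => Re (c k)) n
                     /\ Im (sum_n c n) = sum_n (fun k => Im (c k)) n).
  { induction n as [|n [IH1 IH2]]; [rewrite !sum_O; tauto|].
    rewrite !sum_Sn; split; [rewrite <- IH1|rewrite <- IH2]; reflexivity. }
  f_equal; f_equal; apply Lim_seq_ext; intros n; apply H.
Qed.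

Lemma im_le_Cmod z : (Rabs (Im z) <= Cmod z)%R.
Proof.
  eapply Rle_trans; [|apply Rmax_Cmod]; apply Rmax_r.
Qed.

Lemma acvg_re c : acvg c -> ex_series (fun n => Rabs (Re (c n))).
Proof.
  apply ex_series_nonneg_le; intros n; split; [apply Rabs_pos|apply re_le_Cmod].
Qed.

Lemma acvg_im c : acvg c -> ex_series (fun n => Rabs (Im (c n))).
Proof.
  apply ex_series_nonneg_le; intros n; split; [apply Rabs_pos|apply im_le_Cmod].
Qed.

Lemma ex_re c : acvg c -> ex_series (fun n => Re (c n)).
Proof. intros H; apply ex_series_Rabs, acvg_re, H. Qed.

Lemma ex_im c : acvg c -> ex_series (fun n => Im (c n)).
Proof. intros H; apply ex_series_Rabs, acvg_im, H. Qed.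

Lemma acvg_le c (b : nat -> R) :
  (forall n, Cmod (c n) <= b n)%R -> ex_series b -> acvg c.
Proof.
  intros H; apply ex_series_nonneg_le; intros n; split; [apply Cmod_ge_0|apply H].
Qed.

Lemma CSeries_ext c d : (forall n, c n = d n) -> CSeries c = CSeries d.
Proof.
  intros H; rewrite !CSeries_eq; f_equal; apply Series_ext; intros n; rewrite H;
  reflexivity.
Qed.

Lemma CSeries_plus c d : acvg c -> acvg d ->
  CSeries (fun n => c n + d n) = CSeries c + CSeries d.
Proof.
  intros Hc Hd; rewrite !CSeries_eq; unfold Cplus; simpl.
  rewrite <- !Series_plus by (apply ex_re || apply ex_im; assumption); reflexivity.
Qed.

Lemma CSeries_scal z c : acvg c -> CSeries (fun n => z * c n) = z * CSeries c.
Proof.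
  intros Hc; rewrite !CSeries_eq; unfold Cmult; simpl.
  assert (H1 := ex_re c Hc); assert (H2 := ex_im c Hc).
  rewrite <- !Series_scal_l.
  rewrite <- Series_minus, <- Series_plus by
    (apply ex_scal_R; assumption).
  reflexivity.
Qed.

Lemma acvg_plus c d : acvg c -> acvg d -> acvg (fun n => c n + d n).
Proof.
  intros Hc Hd; apply acvg_le with (fun n => Cmod (c n) + Cmod (d n))%R.
  - intros n; apply Cmod_triangle.
  - apply (ex_series_plus (K := R_AbsRing) (V := R_NormedModule)); assumption.
Qed.

Lemma acvg_scal z c : acvg c -> acvg (fun n => z * c n).
Proof.
  intros Hc; apply acvg_le with (fun n => Cmod z * Cmod (c n))%R.
  - intros n; rewrite Cmod_mult; apply Rle_refl.
  - apply ex_scal_R; assumption.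
Qed.

Lemma CSeries_minus c d : acvg c -> acvg d ->
  CSeries (fun n => c n - d n) = CSeries c - CSeries d.
Proof.
  intros Hc Hd.
  rewrite (CSeries_ext _ (fun n => c n + (-1) * d n)) by (intros; ring).
  rewrite CSeries_plus, CSeries_scal; [ring|assumption|assumption|].
  now apply acvg_scal.
Qed.

Lemma acvg_minus c d : acvg c -> acvg d -> acvg (fun n => c n - d n).
Proof.
  intros Hc Hd.
  assert (H : acvg (fun n => c n + (-1) * d n))
    by (apply acvg_plus; [|apply acvg_scal]; assumption).
  apply acvg_le with (fun n => Cmod (c n + (-1) * d n)).
  - intros n; right; f_equal; ring.
  - exact H.
Qed.

Lemma Series_Rabs_le (r b : nat -> R) :
  (forall n, Rabs (r n) <= b n)%R -> ex_series b -> (Rabs (Series r) <= Series b)%R.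
Proof.
  intros H Hb.
  assert (Hr : ex_series (fun n => Rabs (r n))).
  { revert Hb; apply ex_series_nonneg_le; intros n; split; [apply Rabs_pos|apply H]. }
  eapply Rle_trans; [apply Series_Rabs, Hr|].
  apply Series_le; [|exact Hb]; intros n; split; [apply Rabs_pos|apply H].
Qed.

Lemma Cmod_le_abs z : (Cmod z <= Rabs (Re z) + Rabs (Im z))%R.
Proof.
  replace z with (RtoC (Re z) + Ci * RtoC (Im z)) at 1
    by (destruct z; unfold RtoC, Ci, Cplus, Cmult; simpl; f_equal; ring).
  eapply Rle_trans; [apply Cmod_triangle|].
  rewrite Cmod_mult, !Cmod_R, Cmod_Ci; lra.
Qed.

(** The factor 2 pays for bounding real and imaginary parts separately. *)
Lemma CSeries_le c (b : nat -> R) :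
  (forall n, Cmod (c n) <= b n)%R -> ex_series b ->
  (Cmod (CSeries c) <= 2 * Series b)%R.
Proof.
  intros H Hb; rewrite CSeries_eq; eapply Rle_trans; [apply Cmod_le_abs|]; simpl.
  assert (H1 := Series_Rabs_le (fun n => Re (c n)) b
    (fun n => Rle_trans _ _ _ (re_le_Cmod (c n)) (H n)) Hb).
  assert (H2 := Series_Rabs_le (fun n => Im (c n)) b
    (fun n => Rle_trans _ _ _ (im_le_Cmod (c n)) (H n)) Hb).
  lra.
Qed.

Lemma CSeries_incr_1 c : acvg c -> CSeries c = c O + CSeries (fun n => c (S n)).
Proof.
  intros H; rewrite !CSeries_eq.
  rewrite (Series_incr_1 (fun n => Re (c n)) (ex_re c H)).
  rewrite (Series_incr_1 (fun n => Im (c n)) (ex_im c H)); reflexivity.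
Qed.

Lemma acvg_incr_1 c : acvg c -> acvg (fun n => c (S n)).
Proof. intros H; apply (ex_series_incr_1 (K := R_AbsRing) (fun n => Cmod (c n))), H. Qed.

(* Complex differentiability; [C_NormedModule] is not convertible to
   [AbsRing_NormedModule C_AbsRing], for which the product rule is available. *)
Definition CD (f : C -> C) (z l : C) :=
  is_derive (K := C_AbsRing) (V := AbsRing_NormedModule C_AbsRing) f z l.

Lemma CD_is_derive f z l : CD f z l -> is_derive f z l.
Proof. intros [_ H]; split; [apply is_linear_scal_l|exact H]. Qed.

(** The form in which the basic functions are differentiated: power series, inverse and exponential
    all have an explicit second-order remainder. *)
Lemma CD_quadratic (f : C -> C) (z l : C) (d K : R) : (0 < d)%R ->
  (forall h, (Cmod h < d)%R ->
    (Cmod (f (z + h) - f z - l * h)%C <= K * Cmod h * Cmod h)%R) ->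
  CD f z l.
Proof.
  intros Hd H; split; [apply is_linear_scal_l|].
  intros x Hx; apply (is_filter_lim_locally_unique (K := C_AbsRing)
    (V := AbsRing_NormedModule C_AbsRing)) in Hx; subst x.
  intros eps; apply (locally_le_locally_norm (K := C_AbsRing) (V := AbsRing_NormedModule C_AbsRing)).
  assert (HK : (0 < Rabs K + 1)%R) by (assert (0 <= Rabs K)%R by apply Rabs_pos; lra).
  assert (Hm : (0 < Rmin d (eps / (Rabs K + 1)))%R).
  { apply Rmin_pos; [exact Hd|apply Rdiv_lt_0_compat; [apply cond_pos|exact HK]]. }
  exists (mkposreal _ Hm); intros y Hy; unfold ball_norm in Hy; simpl in Hy.
  change (Cmod (y - z) < Rmin d (eps / (Rabs K + 1)))%R in Hy.
  change (Cmod ((f y - f z) - (y - z) * l) <= eps * Cmod (y - z))%R.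
  set (h := y - z) in *.
  replace y with (z + h) by (unfold h; ring).
  replace (f (z + h) - f z - h * l) with (f (z + h) - f z - l * h) by ring.
  eapply Rle_trans; [apply H|].
  { eapply Rlt_le_trans; [exact Hy|apply Rmin_l]. }
  apply Rmult_le_compat_r; [apply Cmod_ge_0|].
  assert (Hy2 : (Cmod h < eps / (Rabs K + 1))%R)
    by (eapply Rlt_le_trans; [exact Hy|apply Rmin_r]).
  apply Rle_trans with ((Rabs K + 1) * Cmod h)%R.
  - apply Rmult_le_compat_r; [apply Cmod_ge_0|].
    assert (K <= Rabs K)%R by apply Rle_abs; lra.
  - apply (Rmult_lt_compat_l (Rabs K + 1)) in Hy2; [|exact HK].
    eapply Rle_trans; [apply Rlt_le; exact Hy2|].
    right; field; lra.
Qed.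

Definition ev (a : fps) (z : C) : C := CSeries (fun n => RtoC (a n) * z ^ n).

(* radius of convergence at least 1 *)
Definition good (a : fps) :=
  forall r, (0 <= r < 1)%R -> ex_series (fun n => Rabs (a n) * r ^ n)%R.

Lemma good_acvg a z : good a -> (Cmod z < 1)%R ->
  acvg (fun n => RtoC (a n) * z ^ n).
Proof.
  intros Ha Hz; apply acvg_le with (fun n => Rabs (a n) * Cmod z ^ n)%R.
  - intros n; rewrite Cmod_mult, Cmod_R, Cmod_pow; apply Rle_refl.
  - apply Ha; split; [apply Cmod_ge_0|exact Hz].
Qed.

(** Smaller radii are dominated by 1/2; keeping away from 0 allows dividing by r. *)
Lemma good_of_half a :
  (forall r, (1 / 2 <= r < 1)%R -> exists b, ex_series b /\
     forall n, (Rabs (a n) * r ^ n <= b n)%R) -> good a.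
Proof.
  intros H r Hr.
  destruct (H (Rmax r (1 / 2))) as (b & Hb & Hle).
  { split; [apply Rmax_r|apply Rmax_lub_lt; lra]. }
  revert Hb; apply ex_series_nonneg_le; intros n; split.
  - apply Rmult_le_pos; [apply Rabs_pos|apply pow_le, Hr].
  - eapply Rle_trans; [|apply Hle]; apply Rmult_le_compat_l; [apply Rabs_pos|].
    apply pow_incr; split; [apply Hr|apply Rmax_l].
Qed.

Lemma good_le a b : (forall n, Rabs (a n) <= Rabs (b n))%R -> good b -> good a.
Proof.
  intros H Hb; apply good_of_half; intros r Hr; eexists; split; [apply (Hb r); lra|].
  intros n; apply Rmult_le_compat_r; [apply pow_le; lra|apply H].
Qed.

Lemma good_add a b : good a -> good b -> good (a + b)%fps.
Proof.
  intros Ha Hb; apply good_of_half; intros r Hr.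
  exists (fun n => Rabs (a n) * r ^ n + Rabs (b n) * r ^ n)%R; split.
  - apply (ex_series_plus (K := R_AbsRing) (V := R_NormedModule)); [apply Ha|apply Hb]; lra.
  - intros n; rewrite <- Rmult_plus_distr_r; apply Rmult_le_compat_r; [apply pow_le; lra|].
    apply Rabs_triang.
Qed.

Lemma good_scal s a : good a -> good (fc s * a)%fps.
Proof.
  intros Ha r Hr.
  apply (ex_ext_R (fun n => Rabs s * (Rabs (a n) * r ^ n))%R).
  - intros n; rewrite fmul_fc, Rabs_mult; symmetry; apply Rmult_assoc.
  - apply ex_scal_R, Ha, Hr.
Qed.

Lemma good_opp a : good a -> good (- a)%fps.
Proof. apply good_le; intros n; unfold fopp; rewrite Rabs_Ropp; apply Rle_refl. Qed.

Lemma good_sub a b : good a -> good b -> good (a - b)%fps.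
Proof.
  intros Ha Hb; replace (a - b)%fps with (a + - b)%fps by ring.
  apply good_add; [|apply good_opp]; assumption.
Qed.

Lemma ex_series_finite (a : nat -> R) N :
  (forall n, (N < n)%nat -> a n = 0%R) -> ex_series a.
Proof.
  intros H; apply (ex_series_incr_n _ (S N)).
  apply (ex_ext_R (fun _ => 0%R)); [intros n; rewrite H by lia; reflexivity|].
  exists 0%R; apply is_series_Reals; intros e He; exists O; intros n _.
  rewrite sum_eq_R0 by reflexivity.
  unfold R_dist; rewrite Rminus_0_r, Rabs_R0; exact He.
Qed.

Lemma good_finite a N : (forall n, (N < n)%nat -> a n = 0%R) -> good a.
Proof.
  intros H r Hr; apply ex_series_finite with N; intros n Hn.
  rewrite H by exact Hn; rewrite Rabs_R0; apply Rmult_0_l.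
Qed.

Lemma good_fc s : good (fc s).
Proof. apply good_finite with O; intros [|n] Hn; [lia|reflexivity]. Qed.

Lemma good_fz z : good (fz z).
Proof. apply good_fc. Qed.

Lemma good_fX k : good (fX k).
Proof.
  apply good_finite with k; intros n Hn; unfold fX.
  destruct (Nat.eqb_spec n k); [lia|reflexivity].
Qed.

Lemma fmul_sum a b n :
  (a * b)%fps n = sum_f_R0 (fun k => a k * b (n - k)%nat)%R n.
Proof.
  revert a b; induction n as [|n IH]; intros a b; [reflexivity|].
  change ((a * b)%fps (S n)) with (a O * b (S n) + (ftail a * b)%fps n)%R.
  rewrite IH, (decomp_sum _ (S n)) by lia; simpl pred; f_equal.
Qed.

Lemma pow_split (r : R) k n : (k <= n)%nat -> (r ^ n = r ^ k * r ^ (n - k))%R.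
Proof. intros H; rewrite <- pow_add; f_equal; lia. Qed.

Lemma good_mul a b : good a -> good b -> good (a * b)%fps.
Proof.
  intros Ha Hb; apply good_of_half; intros r Hr.
  assert (Pp : forall n, (0 <= r ^ n)%R) by (intros; apply pow_le; lra).
  destruct (Ha r ltac:(lra)) as [la Hla]; destruct (Hb r ltac:(lra)) as [lb Hlb].
  assert (M := is_series_mult_pos _ _ la lb Hla Hlb
    (fun n => Rmult_le_pos _ _ (Rabs_pos _) (Pp n))
    (fun n => Rmult_le_pos _ _ (Rabs_pos _) (Pp n))).
  eexists; split; [exists (la * lb)%R; exact M|]; intros n; rewrite fmul_sum.
  eapply Rle_trans; [apply Rmult_le_compat_r; [apply Pp|apply Rsum_abs]|].
  rewrite Rmult_comm, scal_sum; apply sum_Rle; intros k Hk.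
  rewrite Rabs_mult, (pow_split r k n Hk); right; ring.
Qed.

Lemma good_D a : good a -> good (fD a).
Proof.
  intros Ha; apply good_of_half; intros r Hr.
  (* Chosen so that r (1 + x) lies midway between r and 1; Bernoulli's inequality n x <= (1 + x)^n
     then absorbs the factor n. *)
  set (x := ((1 - r) / (2 * r))%R).
  assert (Hx : (0 < x)%R) by (unfold x; apply Rdiv_lt_0_compat; lra).
  assert (Ht : (r * (1 + x) = (1 + r) / 2)%R) by (unfold x; field; lra).
  exists (fun n => / x * (Rabs (a n) * ((1 + r) / 2) ^ n))%R; split.
  - apply ex_scal_R, Ha; lra.
  - intros n; unfold fD; rewrite Rabs_mult, (Rabs_pos_eq (INR n)) by apply pos_INR.
    assert (B : (INR n * r ^ n <= / x * ((1 + r) / 2) ^ n)%R).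
    { rewrite <- Ht, Rpow_mult_distr.
      assert (P := poly n x Hx).
      apply (Rmult_le_reg_l x); [exact Hx|].
      replace (x * (/ x * (r ^ n * (1 + x) ^ n)))%R with (r ^ n * (1 + x) ^ n)%R
        by (field; lra).
      replace (x * (INR n * r ^ n))%R with (r ^ n * (INR n * x))%R by ring.
      apply Rmult_le_compat_l; [apply pow_le; lra|lra]. }
    replace (INR n * Rabs (a n) * r ^ n)%R with (Rabs (a n) * (INR n * r ^ n))%R by ring.
    replace (/ x * (Rabs (a n) * ((1 + r) / 2) ^ n))%R
      with (Rabs (a n) * (/ x * ((1 + r) / 2) ^ n))%R by ring.
    apply Rmult_le_compat_l; [apply Rabs_pos|exact B].
Qed.

Lemma good_geom : good (fun _ => 1%R).
Proof.
  intros r Hr; apply (ex_ext_R (fun n => r ^ n)%R).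
  - intros n; rewrite Rabs_R1; symmetry; apply Rmult_1_l.
  - apply ex_series_geom; rewrite Rabs_pos_eq; lra.
Qed.

(** The series with coefficients n^k is the geometric series hit k times by [fD]. *)
Lemma good_poly a K k : (forall n, Rabs (a n) <= K * INR n ^ k)%R -> good a.
Proof.
  intros H.
  assert (G : good (fun n => INR n ^ k)%R).
  { clear H; induction k as [|k IH]; [exact good_geom|].
    apply good_D in IH; revert IH; apply good_le; intros n; unfold fD; right.
    reflexivity. }
  apply (good_scal K) in G; revert G; apply good_le; intros n.
  eapply Rle_trans; [apply H|]; rewrite fmul_fc; apply Rle_abs.
Qed.

(** The ordinary derivative d/dq, as opposed to q d/dq for [fD]. *)
Definition fdif (a : fps) : fps := fun n => (INR (S n) * a (S n))%R.

Lemma good_tail a : good a -> good (ftail a).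
Proof.
  intros Ha; apply good_of_half; intros r Hr.
  assert (H := Ha r ltac:(lra)).
  apply (ex_series_incr_1 (K := R_AbsRing) (V := R_NormedModule)) in H.
  eexists; split; [apply (ex_scal_R (/ r)), H|].
  intros n; unfold ftail; simpl pow; right; field; lra.
Qed.

Lemma good_dif a : good a -> good (fdif a).
Proof. intros Ha; exact (good_tail _ (good_D a Ha)). Qed.

Lemma ev_add a b z : good a -> good b -> (Cmod z < 1)%R ->
  ev (a + b)%fps z = ev a z + ev b z.
Proof.
  intros Ha Hb Hz; unfold ev; rewrite <- CSeries_plus by now apply good_acvg.
  apply CSeries_ext; intros n; unfold fadd; rewrite RtoC_plus; ring.
Qed.

Lemma ev_sub a b z : good a -> good b -> (Cmod z < 1)%R ->
  ev (a - b)%fps z = ev a z - ev b z.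
Proof.
  intros Ha Hb Hz; unfold ev; rewrite <- CSeries_minus by now apply good_acvg.
  apply CSeries_ext; intros n; unfold fsub; rewrite RtoC_minus; ring.
Qed.

Lemma ev_scal r a z : good a -> (Cmod z < 1)%R ->
  ev (fc r * a)%fps z = RtoC r * ev a z.
Proof.
  intros Ha Hz; unfold ev; rewrite <- CSeries_scal by now apply good_acvg.
  apply CSeries_ext; intros n; rewrite fmul_fc, RtoC_mult; ring.
Qed.

Lemma ev_O a : good a -> ev a 0 = RtoC (a O).
Proof.
  intros Ha; unfold ev.
  rewrite CSeries_incr_1 by (apply good_acvg; [exact Ha|rewrite Cmod_0; lra]).
  rewrite (CSeries_ext _ (fun n => 0 * (RtoC (a (S n)) * 0 ^ n))).
  - rewrite CSeries_scal; [simpl; ring|].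
    apply (good_acvg (ftail a)); [now apply good_tail|rewrite Cmod_0; lra].
  - intros n; simpl; ring.
Qed.

Lemma ev_tail a z : good a -> (Cmod z < 1)%R ->
  ev a z = RtoC (a O) + z * ev (ftail a) z.
Proof.
  intros Ha Hz; unfold ev; rewrite CSeries_incr_1 by now apply good_acvg.
  rewrite <- CSeries_scal by (apply good_acvg; [now apply good_tail|exact Hz]).
  f_equal; [simpl; ring|].
  apply CSeries_ext; intros n; unfold ftail; simpl; ring.
Qed.

Lemma Series_zero (c : nat -> R) : (forall n, c n = 0%R) -> Series c = 0%R.
Proof.
  intros H; rewrite (Series_ext _ (fun n => 0 * c n)%R).
  - rewrite Series_scal_l; ring.
  - intros n; rewrite H; ring.
Qed.

Lemma ev_fc r z : ev (fc r) z = RtoC r.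
Proof.
  unfold ev; rewrite CSeries_eq.
  rewrite (Series_ext _ (fc r)), (Series_ext (fun n => Im _) (fun n => 0%R)).
  - rewrite Series_incr_1 by (apply ex_series_finite with O; intros [|n] Hn; [lia|reflexivity]).
    rewrite !Series_zero by reflexivity; simpl; rewrite Rplus_0_r; reflexivity.
  - intros [|n]; simpl; ring.
  - intros [|n]; simpl; ring.
Qed.

Lemma ev_mul a b z : good a -> good b -> (Cmod z < 1)%R ->
  ev (a * b)%fps z = ev a z * ev b z.
Proof.
  intros Ha Hb Hz.
  set (p := fun n => RtoC (a n) * z ^ n); set (q := fun n => RtoC (b n) * z ^ n).
  assert (Hp : acvg p) by now apply good_acvg.
  assert (Hq : acvg q) by now apply good_acvg.
  (* The complex Cauchy product is split into four real ones, one for each choice of real or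
     imaginary parts. *)
  assert (E : forall n, RtoC ((a * b)%fps n) * z ^ n =
     ((sum_f_R0 (fun k => Re (p k) * Re (q (n - k)%nat)) n
      - sum_f_R0 (fun k => Im (p k) * Im (q (n - k)%nat)) n)%R,
      (sum_f_R0 (fun k => Re (p k) * Im (q (n - k)%nat)) n
      + sum_f_R0 (fun k => Im (p k) * Re (q (n - k)%nat)) n)%R)).
  { intros n; rewrite fmul_sum.
    assert (G : forall m, (m <= n)%nat ->
      RtoC (sum_f_R0 (fun k => a k * b (n - k)%nat)%R m) * z ^ n =
     ((sum_f_R0 (fun k => Re (p k) * Re (q (n - k)%nat)) m
      - sum_f_R0 (fun k => Im (p k) * Im (q (n - k)%nat)) m)%R,
      (sum_f_R0 (fun k => Re (p k) * Im (q (n - k)%nat)) m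
      + sum_f_R0 (fun k => Im (p k) * Re (q (n - k)%nat)) m)%R)).
    { assert (S1 : forall k, (k <= n)%nat ->
        RtoC (a k * b (n - k)%nat)%R * z ^ n = p k * q (n - k)%nat).
      { intros k Hk; unfold p, q; replace (z ^ n) with (z ^ k * z ^ (n - k)).
        - rewrite RtoC_mult; ring.
        - rewrite <- Cpow_add_r; f_equal; lia. }
      induction m as [|m IH]; intros Hm.
      - simpl sum_f_R0; rewrite (S1 O) by lia; reflexivity.
      - simpl sum_f_R0; rewrite RtoC_plus, Cmult_plus_distr_r, IH by lia.
        rewrite S1 by lia; unfold Cplus, Cmult, Re, Im; simpl; f_equal; ring. }
    apply G; lia. }
  unfold ev; rewrite (CSeries_ext _ _ E).
  fold p q; rewrite !CSeries_eq; simpl.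
  assert (S1 : forall f g : nat -> R, ex_series (fun n => Rabs (f n)) ->
     ex_series (fun n => Rabs (g n)) ->
     is_series (fun n => sum_f_R0 (fun k => f k * g (n - k)%nat)%R n)
       (Series f * Series g)%R).
  { intros f g Hf Hg; apply is_series_mult; try assumption;
      apply Series_correct; now apply ex_series_Rabs. }
  assert (P1 := acvg_re p Hp); assert (P2 := acvg_im p Hp).
  assert (Q1 := acvg_re q Hq); assert (Q2 := acvg_im q Hq).
  assert (A := S1 _ _ P1 Q1); assert (B := S1 _ _ P2 Q2).
  assert (C' := S1 _ _ P1 Q2); assert (D := S1 _ _ P2 Q1).
  unfold Cmult; simpl; f_equal.
  - apply is_series_unique; exact (is_series_minus _ _ _ _ A B).
  - apply is_series_unique; exact (is_series_plus _ _ _ _ C' D).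
Qed.

Lemma ev_dif_mul a z : good a -> (Cmod z < 1)%R -> z * ev (fdif a) z = ev (fD a) z.
Proof.
  intros Ha Hz; rewrite (ev_tail (fD a)) by (try apply good_D; assumption).
  change (ftail (fD a)) with (fdif a); unfold fD at 1; simpl; rewrite Rmult_0_l; ring.
Qed.

Lemma CD_ev a z : good a -> (Cmod z < 1)%R -> CD (ev a) z (ev (fdif a) z).
Proof.
  intros Ha Hz.
  set (rho := ((1 + Cmod z) / 2)%R).
  assert (Hz0 := Cmod_ge_0 z).
  assert (Hr : (0 < rho < 1)%R) by (unfold rho; lra).
  set (b := fun n => (Rabs (a (S n)) * (INR (S n) ^ 2 * rho ^ (S n)))%R).
  assert (Hb : ex_series b).
  { assert (G := good_D _ (good_D a Ha) rho ltac:(lra)).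
    apply (ex_series_incr_1 (K := R_AbsRing) (V := R_NormedModule)) in G.
    revert G; apply ex_ext_R; intros n; unfold b, fD.
    assert (Hn := pos_INR (S n)).
    rewrite !Rabs_mult, (Rabs_pos_eq (INR (S n))) by exact Hn; ring. }
  apply (CD_quadratic _ _ _ (rho - Cmod z) (/ (rho * rho) * (2 * Series b)));
    [unfold rho; lra|].
  intros h Hh.
  assert (Hzh : (Cmod (z + h) <= rho)%R)
    by (eapply Rle_trans; [apply Cmod_triangle|lra]).
  assert (Hzr : (Cmod z <= rho)%R) by (unfold rho; lra).
  assert (Hzh1 : (Cmod (z + h) < 1)%R) by lra.
  (* If e_n is the second-order remainder of z^(n+1), then e_(n+1) = (z + h) e_n + (n + 1) h^2 z^n.
     The factor rho^2 on the left keeps exponents of rho nonnegative throughout the induction. *)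
  assert (T : forall n, (rho * rho * Cmod ((z + h) ^ (S n) - z ^ (S n) - INR (S n) * h * z ^ n)%C
     <= INR (S n) ^ 2 * (Cmod h * Cmod h) * rho ^ (S n))%R).
  { assert (Hh0 := Cmod_ge_0 h).
    induction n as [|n IH].
    - replace ((z + h) ^ 1 - z ^ 1 - RtoC (INR 1) * h * z ^ 0) with (RtoC 0)
        by (change (INR 1) with 1%R; cbn [Cpow]; ring).
      rewrite Cmod_0, Rmult_0_r; repeat apply Rmult_le_pos; try lra;
        try apply pow_le; try apply pos_INR; lra.
    - replace ((z + h) ^ (S (S n)) - z ^ (S (S n)) - RtoC (INR (S (S n))) * h * z ^ (S n))
        with ((z + h) * ((z + h) ^ (S n) - z ^ (S n) - RtoC (INR (S n)) * h * z ^ n)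
           + RtoC (INR (S n)) * (h * h) * z ^ n).
      2:{ rewrite (S_INR (S n)), RtoC_plus; simpl Cpow; ring. }
      assert (Hn := pos_INR (S n)).
      set (e := Cmod ((z + h) ^ (S n) - z ^ (S n) - RtoC (INR (S n)) * h * z ^ n)) in *.
      assert (He : (0 <= e)%R) by apply Cmod_ge_0.
      apply Rle_trans with (rho * rho * (rho * e + INR (S n) * (Cmod h * Cmod h) * rho ^ n))%R.
      + apply Rmult_le_compat_l; [nra|].
        eapply Rle_trans; [apply Cmod_triangle|].
        rewrite !Cmod_mult, Cmod_R, Cmod_pow, (Rabs_pos_eq (INR (S n))) by exact Hn.
        fold e; apply Rplus_le_compat.
        * apply Rmult_le_compat_r; assumption.
        * apply Rmult_le_compat_l; [repeat apply Rmult_le_pos; assumption|].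
          apply pow_incr; lra.
      + rewrite (S_INR (S n)).
        assert (0 <= rho ^ n)%R by (apply pow_le; lra).
        cbn [pow] in IH |- *.
        set (N := INR (S n)) in *; set (H2 := (Cmod h * Cmod h)%R) in *.
        assert (0 <= H2)%R by (unfold H2; nra).
        set (R' := (rho ^ n)%R) in *.
        apply Rle_trans with (rho * (N * (N * 1) * H2 * (rho * R')) + rho * rho * (N * H2 * R'))%R.
        * replace (rho * rho * (rho * e + N * H2 * R'))%R
            with (rho * (rho * rho * e) + rho * rho * (N * H2 * R'))%R by ring.
          apply Rplus_le_compat_r, Rmult_le_compat_l; [lra|exact IH].
        * replace ((N + 1) * ((N + 1) * 1) * H2 * (rho * (rho * R')))%R
            with (rho * (N * (N * 1) * H2 * (rho * R')) + rho * rho * (N * H2 * R')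
              + (rho * rho * ((N + 1) * (H2 * R'))))%R by ring.
          assert (0 <= rho * rho * ((N + 1) * (H2 * R')))%R.
          { apply Rmult_le_pos; [nra|]; apply Rmult_le_pos; [lra|].
            apply Rmult_le_pos; assumption. }
          lra. }
  assert (A1 := good_acvg a z Ha Hz); assert (A2 := good_acvg a (z + h) Ha Hzh1).
  assert (A3 := good_acvg (fdif a) z (good_dif a Ha) Hz).
  replace (ev a (z + h) - ev a z - ev (fdif a) z * h)
    with (CSeries (fun n => RtoC (a (S n)) *
      ((z + h) ^ (S n) - z ^ (S n) - RtoC (INR (S n)) * h * z ^ n))).
  - eapply Rle_trans; [apply (CSeries_le _
      (fun n => / (rho * rho) * (Cmod h * Cmod h) * b n)%R)|].
    + intros n; rewrite Cmod_mult, Cmod_R; unfold b.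
      assert (0 <= Rabs (a (S n)))%R by apply Rabs_pos.
      replace (/ (rho * rho) * (Cmod h * Cmod h) *
        (Rabs (a (S n)) * (INR (S n) ^ 2 * rho ^ S n)))%R
        with (Rabs (a (S n)) * (/ (rho * rho) *
          (INR (S n) ^ 2 * (Cmod h * Cmod h) * rho ^ S n)))%R by ring.
      apply Rmult_le_compat_l; [assumption|].
      apply (Rmult_le_reg_l (rho * rho)); [nra|].
      rewrite <- (Rmult_assoc (rho * rho) (/ (rho * rho))), Rinv_r, Rmult_1_l by nra.
      apply T.
    + apply ex_scal_R, Hb.
    + rewrite Series_scal_l; right; ring.
  - rewrite (CSeries_ext _ (fun n => (RtoC (a (S n)) * (z + h) ^ (S n)
        - RtoC (a (S n)) * z ^ (S n)) - h * (RtoC (fdif a n) * z ^ n))).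
    2:{ intros n; unfold fdif; rewrite RtoC_mult; ring. }
    assert (B1 := acvg_incr_1 _ A1); assert (B2 := acvg_incr_1 _ A2).
    rewrite CSeries_minus, CSeries_minus, CSeries_scal;
      try assumption; try (apply acvg_minus; assumption); try (apply acvg_scal; assumption).
    unfold ev at 1 2; rewrite (CSeries_incr_1 _ A1), (CSeries_incr_1 _ A2).
    unfold ev; simpl Cpow; ring.
Qed.

(** * Rules of complex differentiation *)

Lemma CD_eps f z l : CD f z l -> forall eps, (0 < eps)%R ->
  exists d, (0 < d)%R /\ forall y, (Cmod (y - z) < d)%R ->
    (Cmod ((f y - f z) - (y - z) * l)%C <= eps * Cmod (y - z))%R.
Proof.
  intros [_ H] eps He.
  specialize (H z (fun P HP => HP) (mkposreal _ He)).
  apply (locally_norm_le_locally (K := C_AbsRing)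
    (V := AbsRing_NormedModule C_AbsRing)) in H.
  destruct H as [d Hd]; exists (pos d); split; [apply cond_pos|].
  intros y Hy; exact (Hd y Hy).
Qed.

Lemma CD_ext f g z l : (forall y, f y = g y) -> CD f z l -> CD g z l.
Proof. intros H; apply is_derive_ext; exact H. Qed.

Lemma CD_const c z : CD (fun _ => c) z 0.
Proof. exact (is_derive_const (K := C_AbsRing) (V := AbsRing_NormedModule C_AbsRing) c z). Qed.

Lemma CD_id z : CD (fun y => y) z 1.
Proof. exact (is_derive_id (K := C_AbsRing) z). Qed.

Lemma CD_minus f g z a b : CD f z a -> CD g z b -> CD (fun y => f y - g y) z (a - b).
Proof. exact (is_derive_minus (K := C_AbsRing) (V := AbsRing_NormedModule C_AbsRing) f g z a b). Qed.

Lemma CD_mult f g z a b : CD f z a -> CD g z b ->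
  CD (fun y => f y * g y) z (a * g z + f z * b).
Proof.
  intros Hf Hg.
  exact (is_derive_mult (K := C_AbsRing) f g z a b Hf Hg Cmult_comm).
Qed.

Lemma CD_scal c f z a : CD f z a -> CD (fun y => c * f y) z (c * a).
Proof.
  intros H; replace (c * a) with (0 * f z + c * a) by ring.
  apply (CD_mult (fun _ => c)); [apply CD_const|exact H].
Qed.

Lemma CD_comp f g z a b : CD f (g z) a -> CD g z b -> CD (fun y => f (g y)) z (b * a).
Proof.
  exact (is_derive_comp (K := C_AbsRing) (V := AbsRing_NormedModule C_AbsRing) f g z a b).
Qed.

Lemma CD_eq f z a b : a = b -> CD f z a -> CD f z b.
Proof. now intros ->. Qed.

Lemma CD_inv (z : C) : z <> 0 -> CD (fun y => / y) z (- / (z * z)).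
Proof.
  intros Hz; assert (Hm : (0 < Cmod z)%R) by exact (proj1 (Cmod_gt_0 z) Hz).
  apply (CD_quadratic _ _ _ (Cmod z / 2) (2 / (Cmod z * Cmod z * Cmod z))); [lra|].
  intros h Hh.
  assert (Hzh : (Cmod z / 2 <= Cmod (z + h))%R).
  { assert (T := Cmod_triangle (z + h) (- h)).
    replace (z + h + - h) with z in T by ring; rewrite Cmod_opp in T; lra. }
  assert (Hn : z + h <> 0) by (intros E; rewrite E, Cmod_0 in Hzh; lra).
  replace (/ (z + h) - / z - - / (z * z) * h) with (h * h * / (z * z * (z + h)))
    by (field; auto).
  rewrite Cmod_mult, Cmod_inv by (repeat apply Cmult_neq_0; assumption).
  rewrite !Cmod_mult.
  replace (2 / (Cmod z * Cmod z * Cmod z) * Cmod h * Cmod h)%R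
    with (Cmod h * Cmod h * (/ (Cmod z * Cmod z * (Cmod z / 2))))%R by (field; lra).
  assert (0 <= Cmod h)%R by apply Cmod_ge_0.
  apply Rmult_le_compat_l; [nra|].
  apply Rinv_le_contravar.
  - repeat apply Rmult_lt_0_compat; lra.
  - apply Rmult_le_compat_l; [nra|exact Hzh].
Qed.

(** * The complex exponential *)

Lemma Cexp_plus x y : Cexp (x + y) = Cexp x * Cexp y.
Proof.
  destruct x as [a b], y as [c d]; unfold Cexp, Cplus, Cmult; cbn [Re Im fst snd].
  rewrite exp_plus, cos_plus, sin_plus; f_equal; ring.
Qed.

Lemma Cexp_0 : Cexp 0 = 1.
Proof.
  unfold Cexp, RtoC; cbn [Re Im fst snd].
  rewrite exp_0, cos_0, sin_0; f_equal; apply Rmult_1_l.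
Qed.

Lemma Cexp_neq_0 x : Cexp x <> 0.
Proof.
  intros E; assert (H := Cexp_plus x (- x)).
  replace (x + - x) with (RtoC 0) in H by ring.
  rewrite E, Cexp_0 in H; apply C1_nz; rewrite H; ring.
Qed.

Lemma Cexp_opp x : Cexp (- x) = / Cexp x.
Proof.
  assert (H := Cexp_plus x (- x)).
  replace (x + - x) with (RtoC 0) in H by ring; rewrite Cexp_0 in H.
  assert (Hx := Cexp_neq_0 x).
  transitivity (/ Cexp x * (Cexp x * Cexp (- x))); [field; exact Hx|].
  rewrite <- H; ring.
Qed.

Lemma Cexp_pow x n : Cexp x ^ n = Cexp (RtoC (INR n) * x).
Proof.
  induction n as [|n IH].
  - simpl; replace (RtoC 0 * x) with (RtoC 0) by ring; symmetry; apply Cexp_0.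
  - rewrite S_INR, RtoC_plus.
    replace ((RtoC (INR n) + 1) * x) with (x + RtoC (INR n) * x) by ring.
    rewrite Cexp_plus, <- IH; reflexivity.
Qed.

Lemma Cmod_Cexp x : Cmod (Cexp x) = exp (Re x).
Proof.
  unfold Cmod, Cexp; cbn [fst snd].
  replace ((exp (Re x) * cos (Im x)) ^ 2 + (exp (Re x) * sin (Im x)) ^ 2)%R
    with (exp (Re x) * exp (Re x))%R.
  - apply sqrt_square, Rlt_le, exp_pos.
  - assert (H := sin2_cos2 (Im x)); unfold Rsqr in H.
    transitivity (exp (Re x) * exp (Re x) *
      (sin (Im x) * sin (Im x) + cos (Im x) * cos (Im x)))%R; [rewrite H|]; ring.
Qed.

Lemma Rabs_sin_le y : (Rabs (sin y) <= Rabs y)%R.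
Proof.
  destruct (MVT_gen sin 0 y cos) as (c & _ & H).
  - intros x _; apply is_derive_Reals, derivable_pt_lim_sin.
  - intros x _; apply continuity_sin.
  - rewrite sin_0, !Rminus_0_r in H; rewrite H, Rabs_mult.
    assert (Hc := COS_bound c).
    assert (0 <= Rabs y)%R by apply Rabs_pos.
    assert (Rabs (cos c) <= 1)%R by (apply Rabs_le; lra).
    apply Rle_trans with (1 * Rabs y)%R; [apply Rmult_le_compat_r; assumption|lra].
Qed.

Lemma one_sub_cos_le y : (0 <= 1 - cos y <= y * y / 2)%R.
Proof.
  assert (H := cos_2a_sin (y / 2)); replace (2 * (y / 2))%R with y in H by field.
  assert (Hs := Rabs_sin_le (y / 2)).
  apply Rsqr_le_abs_1 in Hs; unfold Rsqr in Hs; split; nra.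
Qed.

Lemma sin_sub_le y : (Rabs y <= 1)%R -> (Rabs (sin y - y) <= y * y)%R.
Proof.
  intros Hy.
  destruct (MVT_gen (fun t => sin t - t)%R 0 y (fun t => cos t - 1)%R) as (c & Hc & H).
  - intros x _; apply (is_derive_minus (V := R_NormedModule) sin (fun t => t) x).
    + apply is_derive_Reals, derivable_pt_lim_sin.
    + apply (is_derive_id (K := R_AbsRing)).
  - intros x _; apply continuity_minus; [apply continuity_sin|].
    apply derivable_continuous, derivable_id.
  - rewrite sin_0 in H; replace (sin y - y)%R with (sin y - y - (0 - 0))%R by ring.
    rewrite H, Rabs_mult, Rminus_0_r.
    assert (B := one_sub_cos_le c).
    assert (Hcy : (Rabs c <= Rabs y)%R).
    { revert Hc; unfold Rmin, Rmax; destruct (Rle_dec 0 y); intros Hc;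
      unfold Rabs; destruct (Rcase_abs c), (Rcase_abs y); lra. }
    rewrite <- (Rabs_Ropp (cos c - 1)), (Rabs_pos_eq (- (cos c - 1))) by lra.
    assert (E1 := Rsqr_abs c); assert (E2 := Rsqr_abs y); unfold Rsqr in E1, E2.
    assert (0 <= Rabs c)%R by apply Rabs_pos.
    rewrite E2; apply Rmult_le_compat_r; [apply Rabs_pos|].
    rewrite E1 in B; nra.
Qed.

Lemma exp_sub_le x : (Rabs x <= 1 / 2)%R ->
  (0 <= exp x - 1 - x <= 2 * (x * x))%R /\ (exp x <= 2)%R.
Proof.
  intros Hx; apply Rabs_le_between in Hx.
  assert (H1 := exp_ineq1_le x); assert (H2 := exp_ineq1_le (- x)).
  rewrite exp_Ropp in H2; assert (P := exp_pos x).
  assert (H3 : (exp x * (1 - x) <= 1)%R).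
  { apply Rle_trans with (exp x * / exp x)%R; [|right; field; lra].
    apply Rmult_le_compat_l; lra. }
  assert (H4 : (exp x <= 2)%R) by nra.
  split; [split; [lra|]|exact H4].
  nra.
Qed.

Lemma CD_exp z : CD Cexp z (Cexp z).
Proof.
  apply (CD_quadratic _ _ _ (1 / 2) (Cmod (Cexp z) * 9)); [lra|].
  intros h Hh; rewrite Cexp_plus.
  replace (Cexp z * Cexp h - Cexp z - Cexp z * h) with (Cexp z * (Cexp h - 1 - h)) by ring.
  rewrite Cmod_mult, !Rmult_assoc; apply Rmult_le_compat_l; [apply Cmod_ge_0|].
  eapply Rle_trans; [apply Cmod_le_abs|].
  destruct h as [x y].
  assert (Hx := re_le_Cmod (x, y)); assert (Hy := im_le_Cmod (x, y)).
  simpl in Hx, Hy; set (m := Cmod (x, y)) in *.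
  unfold Cexp; simpl.
  destruct (exp_sub_le x ltac:(lra)) as [Ex1 Ex2].
  assert (Ey1 := one_sub_cos_le y); assert (Ey2 := sin_sub_le y ltac:(lra)).
  assert (Px := exp_pos x).
  assert (A : forall t, (Rabs t <= m -> t * t <= m * m)%R).
  { intros t Ht; assert (E := Rsqr_abs t); unfold Rsqr in E; rewrite E.
    assert (0 <= Rabs t)%R by apply Rabs_pos; nra. }
  assert (Ax := A x Hx); assert (Ay := A y Hy).
  assert (Hm : (0 <= m)%R) by apply Cmod_ge_0.
  assert (B1 : (Rabs (exp x * cos y + - (1) + - x) <= 3 * (m * m))%R).
  { replace (exp x * cos y + - (1) + - x)%R
      with ((exp x - 1 - x) + - (exp x * (1 - cos y)))%R by ring.
    eapply Rle_trans; [apply Rabs_triang|].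
    rewrite Rabs_Ropp, (Rabs_pos_eq (exp x - 1 - x)), (Rabs_pos_eq (exp x * (1 - cos y))) by nra.
    nra. }
  assert (B2 : (Rabs (exp x * sin y + - 0 + - y) <= 6 * (m * m))%R).
  { replace (exp x * sin y + - 0 + - y)%R
      with (exp x * (sin y - y) + y * ((exp x - 1 - x) + x))%R by ring.
    eapply Rle_trans; [apply Rabs_triang|].
    rewrite !Rabs_mult, (Rabs_pos_eq (exp x)) by lra.
    assert (C1 : (exp x * Rabs (sin y - y) <= 2 * (m * m))%R).
    { apply Rmult_le_compat; try lra; apply Rabs_pos. }
    assert (C2 : (Rabs y * Rabs (exp x - 1 - x + x) <= m * (2 * m))%R).
    { apply Rmult_le_compat; try apply Rabs_pos; [exact Hy|].
      eapply Rle_trans; [apply Rabs_triang|].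
      rewrite (Rabs_pos_eq (exp x - 1 - x)) by lra.
      assert (2 * (x * x) <= m)%R; [|lra].
      nra. }
    nra. }
  nra.
Qed.

(* [proj] is the real or the imaginary part. *)
Lemma CD_line (proj : C -> R) f a b t l :
  (forall w, Rabs (proj w) <= Cmod w)%R ->
  (forall v w, proj (v - w) = (proj v - proj w)%R) ->
  (forall r w, proj (RtoC r * w) = (r * proj w)%R) ->
  CD f (a + RtoC t * b) l ->
  is_derive (fun t : R => proj (f (a + RtoC t * b))) t (proj (l * b)).
Proof.
  intros Hp Hl Hs H; apply is_derive_Reals; intros eps He.
  set (M := (Cmod b + 1)%R).
  assert (HM : (0 < M)%R) by (assert (0 <= Cmod b)%R by apply Cmod_ge_0; unfold M; lra).
  destruct (CD_eps _ _ _ H (eps / (2 * M))%R) as (d & Hd & Hf).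
  { apply Rdiv_lt_0_compat; lra. }
  assert (Hd' : (0 < d / M)%R) by (apply Rdiv_lt_0_compat; assumption).
  exists (mkposreal _ Hd'); intros h Hh Hhd; simpl in Hhd.
  specialize (Hf (a + RtoC (t + h) * b)).
  set (w := f (a + RtoC (t + h) * b)) in *.
  set (w0 := f (a + RtoC t * b)) in *.
  replace (a + RtoC (t + h) * b - (a + RtoC t * b))
    with (RtoC h * b) in Hf by (rewrite RtoC_plus; ring).
  replace (RtoC h * b * l) with (RtoC h * (l * b)) in Hf by ring.
  rewrite (Cmod_mult (RtoC h)), Cmod_R in Hf.
  assert (Hh0 : (0 < Rabs h)%R) by now apply Rabs_pos_lt.
  assert (Hb : (Rabs h * Cmod b <= Rabs h * M)%R)
    by (apply Rmult_le_compat_l; unfold M; lra).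
  assert (Hlt : (Rabs h * M < d)%R).
  { apply (Rmult_lt_compat_r M) in Hhd; [|exact HM].
    replace (d / M * M)%R with d in Hhd by (field; lra); exact Hhd. }
  specialize (Hf ltac:(lra)).
  replace ((proj w - proj w0) / h - proj (l * b)%C)%R
    with (proj (w - w0 - RtoC h * (l * b))%C / h)%R
    by (rewrite !Hl, Hs; field; exact Hh).
  unfold Rdiv; rewrite Rabs_mult, Rabs_inv.
  apply (Rmult_lt_reg_r (Rabs h)); [exact Hh0|].
  rewrite Rmult_assoc, Rinv_l, Rmult_1_r by lra.
  apply Rle_lt_trans with (eps / 2 * Rabs h)%R; [|nra].
  eapply Rle_trans; [apply Hp|]; eapply Rle_trans; [exact Hf|].
  apply Rle_trans with (eps / (2 * M) * (Rabs h * M))%R.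
  - apply Rmult_le_compat_l; [|exact Hb].
    apply Rlt_le, Rdiv_lt_0_compat; lra.
  - right; field; lra.
Qed.

Lemma Re_scal r w : Re (RtoC r * w) = (r * Re w)%R.
Proof. destruct w; unfold RtoC, Cmult, Re; cbn [fst snd]; ring. Qed.

Lemma Im_scal r w : Im (RtoC r * w) = (r * Im w)%R.
Proof. destruct w; unfold RtoC, Cmult, Im; cbn [fst snd]; ring. Qed.

Lemma CD_zero_segment f (a b : C) :
  (forall t, (0 <= t <= 1)%R -> CD f (a + RtoC t * (b - a)) 0) -> f b = f a.
Proof.
  intros H.
  assert (G : forall proj : C -> R, (forall w, Rabs (proj w) <= Cmod w)%R ->
     (forall v w, proj (v - w) = (proj v - proj w)%R) ->
     (forall r w, proj (RtoC r * w) = (r * proj w)%R) -> proj (f a) = proj (f b)).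
  { intros proj Hp Hl Hs.
    set (g := fun t : R => proj (f (a + RtoC t * (b - a)))).
    assert (E : g 0%R = g 1%R).
    { apply eq_is_derive; [|lra]; intros t Ht.
      assert (D := CD_line proj f a (b - a) t 0 Hp Hl Hs (H t Ht)).
      rewrite Hs, Rmult_0_l in D; exact D. }
    unfold g in E; replace (a + RtoC 0 * (b - a)) with a in E by ring.
    replace (a + RtoC 1 * (b - a)) with b in E by ring; exact E. }
  assert (E1 := G Re re_le_Cmod ltac:(reflexivity) Re_scal).
  assert (E2 := G Im im_le_Cmod ltac:(reflexivity) Im_scal).
  destruct (f a), (f b); simpl in *; subst; reflexivity.
Qed.

Lemma CD_zero_disc f z : (Cmod z < 1)%R ->
  (forall y, (Cmod y < 1)%R -> CD f y 0) -> f z = f 0.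
Proof.
  intros Hz H; apply CD_zero_segment; intros t Ht; apply H.
  replace (0 + RtoC t * (z - 0)) with (RtoC t * z) by ring.
  rewrite Cmod_mult, Cmod_R, Rabs_pos_eq by apply Ht.
  assert (0 <= Cmod z)%R by apply Cmod_ge_0; nra.
Qed.

(** Cancels a factor q, so that the differential equation also says something at q = 0. *)
Lemma fdif_exp_eq (y G : fps) : fD y = (y * fD G)%fps -> fdif y = (y * fdif G)%fps.
Proof.
  intros H; extensionality n.
  assert (E := f_equal (fun s => s (S n)) H); cbv beta in E.
  change (fD y (S n)) with (fdif y n) in E; rewrite E.
  assert (X : fD G = (fX 1 * fdif G)%fps).
  { apply functional_extensionality; intros [|k]; rewrite fX_mul; simpl.
    - unfold fD; simpl; ring.
    - rewrite Nat.sub_0_r; reflexivity. }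
  rewrite X; replace (y * (fX 1 * fdif G))%fps with (fX 1 * (y * fdif G))%fps by ring.
  rewrite fX_mul; simpl; rewrite Nat.sub_0_r; reflexivity.
Qed.

(** y exp(-G) has zero derivative on the disc. This is how a formal logarithmic derivative becomes
    an infinite product. *)
Lemma ev_exp (y G : fps) z : good y -> good G -> G O = 0%R ->
  fD y = (y * fD G)%fps -> (Cmod z < 1)%R ->
  ev y z = RtoC (y O) * Cexp (ev G z).
Proof.
  intros Hy HG G0 HD Hz.
  assert (E : ev y z * Cexp (- ev G z) = ev y 0 * Cexp (- ev G 0)).
  { apply (CD_zero_disc (fun z => ev y z * Cexp (- ev G z))); [exact Hz|].
    intros w Hw.
    eapply CD_eq; [|apply CD_mult; [now apply CD_ev|]].
    2:{ apply (CD_comp Cexp (fun w => - ev G w)); [apply CD_exp|].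
        apply (CD_ext (fun w => (-1) * ev G w)); [intros; ring|].
        apply CD_scal, CD_ev; assumption. }
    rewrite (fdif_exp_eq y G HD), ev_mul by (try apply good_dif; assumption).
    ring. }
  rewrite !ev_O, G0 in E by assumption.
  replace (- RtoC 0) with (RtoC 0) in E by ring; rewrite Cexp_0, Cexp_opp in E.
  assert (N := Cexp_neq_0 (ev G z)).
  transitivity (ev y z * / Cexp (ev G z) * Cexp (ev G z)); [field; exact N|].
  rewrite E; ring.
Qed.

(** * Eisenstein series and eta products as power series *)

Lemma CLim_seq_unique (s : nat -> C) (l : C) :
  (forall eps, (0 < eps)%R -> exists N0, forall N, (N0 <= N)%nat ->
     (Cmod (s N - l)%C < eps)%R) -> CLim_seq s = l.
Proof.
  intros H.
  assert (G : forall proj : C -> R, (forall w, Rabs (proj w) <= Cmod w)%R ->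
     (forall v w, proj (v - w)%C = (proj v - proj w)%R) ->
     real (Lim_seq (fun n => proj (s n))) = proj l).
  { intros proj Hp Hl.
    rewrite (is_lim_seq_unique _ (Finite (proj l))); [reflexivity|].
    apply is_lim_seq_spec; intros eps.
    destruct (H eps (cond_pos eps)) as [N0 HN]; exists N0; intros n Hn.
    rewrite <- Hl; eapply Rle_lt_trans; [apply Hp|apply HN, Hn]. }
  unfold CLim_seq.
  rewrite (G Re re_le_Cmod), (G Im im_le_Cmod) by reflexivity.
  symmetry; apply surjective_pairing.
Qed.

Lemma CD_continuous f z l : CD f z l -> forall eps, (0 < eps)%R ->
  exists d, (0 < d)%R /\ forall y, (Cmod (y - z)%C < d)%R -> (Cmod (f y - f z)%C < eps)%R.
Proof.
  intros H eps He.
  assert (K := ex_derive_continuous (K := C_AbsRing) (V := AbsRing_NormedModule C_AbsRing)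
    f z (ex_intro _ l H)).
  destruct (K (fun w => (Cmod (w - f z)%C < eps)%R)) as [d Hd].
  { exists (mkposreal eps He); intros w Hw; exact Hw. }
  exists d; split; [apply cond_pos|exact Hd].
Qed.

(** Dominated convergence: the error lives in degrees beyond N, and comparison with a radius t
    between |z| and 1 makes it O((|z| / t)^N). *)
Lemma ev_trunc (a b : fps) (s : nat -> fps) z : good a -> good b ->
  (forall N, good (s N)) -> (Cmod z < 1)%R ->
  (forall N n, (Rabs (s N n - a n) <= Rabs (b n))%R) ->
  (forall N n, (n <= N)%nat -> s N n = a n) ->
  forall eps, (0 < eps)%R -> exists N0, forall N, (N0 <= N)%nat ->
    (Cmod (ev (s N) z - ev a z)%C < eps)%R.
Proof.
  intros Ha Hb Hs Hz Hle Heq eps He.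
  set (r := Cmod z) in *; assert (Hr0 : (0 <= r)%R) by apply Cmod_ge_0.
  set (t := ((1 + r) / 2)%R); assert (Ht : (0 < t < 1)%R) by (unfold t; lra).
  assert (Hrt : (0 <= r / t < 1)%R).
  { split; [apply Rdiv_le_0_compat; lra|].
    apply (Rmult_lt_reg_r t); [lra|]; replace (r / t * t)%R with r by (field; lra).
    unfold t; lra. }
  assert (HB := Hb t ltac:(lra)).
  set (B := Series (fun n => Rabs (b n) * t ^ n)%R) in *.
  assert (HB0 : (0 <= B)%R).
  { unfold B; rewrite <- (Series_zero (fun _ => 0%R)) by reflexivity.
    apply Series_le; [|exact HB]; intros n; split; [lra|].
    apply Rmult_le_pos; [apply Rabs_pos|apply pow_le; lra]. }
  destruct (pow_lt_1_zero (r / t) ltac:(rewrite Rabs_pos_eq; lra) (eps / (2 * B + 1)))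
    as [N0 HN0].
  { apply Rdiv_lt_0_compat; lra. }
  exists N0; intros N HN.
  rewrite <- ev_sub by (try apply Hs; assumption).
  eapply Rle_lt_trans; [apply (CSeries_le _
    (fun n => (r / t) ^ N * (Rabs (b n) * t ^ n))%R)|].
  - intros n; rewrite Cmod_mult, Cmod_R, Cmod_pow; unfold fsub; fold r.
    destruct (Nat.le_gt_cases n N) as [Hn|Hn].
    + rewrite (Heq N n Hn); unfold Rminus; rewrite Rplus_opp_r, Rabs_R0, Rmult_0_l.
      apply Rmult_le_pos; [apply pow_le, Hrt|].
      apply Rmult_le_pos; [apply Rabs_pos|apply pow_le; lra].
    + replace r with (r / t * t)%R at 1 by (field; lra).
      rewrite Rpow_mult_distr.
      assert (P1 : ((r / t) ^ n <= (r / t) ^ N)%R).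
      { replace n with (N + (n - N))%nat by lia; rewrite pow_add.
        rewrite <- (Rmult_1_r ((r / t) ^ N)) at 2.
        apply Rmult_le_compat_l; [apply pow_le, Hrt|].
        rewrite <- (pow1 (n - N)); apply pow_incr; lra. }
      assert (P2 : (0 <= t ^ n)%R) by (apply pow_le; lra).
      assert (P3 : (0 <= (r / t) ^ n)%R) by (apply pow_le, Hrt).
      apply Rle_trans with (Rabs (b n) * ((r / t) ^ n * t ^ n))%R.
      * apply Rmult_le_compat_r; [nra|apply Hle].
      * replace ((r / t) ^ N * (Rabs (b n) * t ^ n))%R
          with (Rabs (b n) * ((r / t) ^ N * t ^ n))%R by ring.
        apply Rmult_le_compat_l; [apply Rabs_pos|].
        apply Rmult_le_compat_r; assumption.
  - apply ex_scal_R, HB.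
  - rewrite Series_scal_l; fold B.
    specialize (HN0 N HN); rewrite Rabs_pos_eq in HN0 by (apply pow_le, Hrt).
    assert (P : (0 <= (r / t) ^ N)%R) by (apply pow_le, Hrt).
    apply (Rmult_lt_compat_r (2 * B + 1)) in HN0; [|lra].
    replace (eps / (2 * B + 1) * (2 * B + 1))%R with eps in HN0 by (field; lra).
    nra.
Qed.

Lemma fw_coef_bound k n : (0 <= fw k n <= 1)%R.
Proof.
  unfold fw; destruct (Nat.eqb n 0); [lra|]; destruct (Nat.eqb (n mod k) 0); lra.
Qed.

Lemma psum_nonneg f n : (forall k, (1 <= k <= n)%nat -> (0 <= f k)%R) -> (0 <= psum f n)%R.
Proof.
  induction n as [|n IH]; intros H; simpl; [lra|].
  assert (0 <= psum f n)%R by (apply IH; intros; apply H; lia).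
  assert (0 <= f (S n))%R by (apply H; lia); lra.
Qed.

Lemma psum_abs_le f M n : (forall k, (1 <= k <= n)%nat -> (Rabs (f k) <= M)%R) ->
  (Rabs (psum f n) <= INR n * M)%R.
Proof.
  induction n as [|n IH]; intros H; [simpl; rewrite Rabs_R0; lra|].
  cbn [psum]; rewrite S_INR; eapply Rle_trans; [apply Rabs_triang|].
  assert (Rabs (psum f n) <= INR n * M)%R by (apply IH; intros; apply H; lia).
  assert (Rabs (f (S n)) <= M)%R by (apply H; lia); lra.
Qed.

Lemma good_LS e c K j : (forall k, (Rabs (c k) <= K * INR k ^ j)%R) ->
  good (LS (fwe e) c).
Proof.
  intros H; apply (good_poly _ (Rabs K) (S j)); intros n; rewrite LS_coef.
  eapply Rle_trans; [apply (psum_abs_le _ (Rabs K * INR n ^ j))|].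
  - intros k Hk; rewrite Rabs_mult; assert (B := fw_coef_bound (e * k) n).
    unfold fwe; rewrite (Rabs_pos_eq (fw _ _)) by lra.
    assert (0 <= Rabs (c k))%R by apply Rabs_pos.
    apply Rle_trans with (Rabs (c k)); [nra|].
    eapply Rle_trans; [apply H|].
    apply Rmult_le_compat; [|apply pow_le, pos_INR|apply Rle_abs|].
    + destruct Hk as [Hk _].
      assert (0 < INR k ^ j)%R by (apply pow_lt, lt_0_INR; lia).
      specialize (H k).
      destruct (Rle_dec 0 K) as [P|P]; [exact P|].
      exfalso; assert (K * INR k ^ j < 0)%R by nra; lra.
    + apply pow_incr; split; [apply pos_INR|apply le_INR; lia].
  - simpl; right; ring.
Qed.

Lemma good_Sk j : good (Sk j).
Proof.
  apply (good_LS 1 _ 1 j); intros k; rewrite Rabs_pos_eq by (apply pow_le, pos_INR); lra.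
Qed.

Lemma good_Vk j : good (Vk j).
Proof.
  apply (good_LS 3 _ 1 j); intros k; rewrite Rabs_pos_eq by (apply pow_le, pos_INR); lra.
Qed.

Lemma good_Xk j : good (Xk j).
Proof.
  apply (good_LS 1 _ 2 j); intros k.
  rewrite Rabs_mult, Rabs_pos_eq by (apply pow_le, pos_INR).
  rewrite Rmult_comm; apply Rmult_le_compat_r; [apply pow_le, pos_INR|].
  assert (H := c3_chi3_norm k); apply Rabs_le; nra.
Qed.

Lemma Cpow_lt_1 q n : (Cmod q < 1)%R -> (1 <= n)%nat -> (Cmod (q ^ n) < 1)%R.
Proof.
  intros Hq Hn; rewrite Cmod_pow.
  destruct n as [|n]; [lia|]; simpl.
  assert (0 <= Cmod q)%R by apply Cmod_ge_0.
  assert (Cmod q ^ n <= 1)%R by (rewrite <- (pow1 n); apply pow_incr; lra).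
  assert (0 <= Cmod q ^ n)%R by (apply pow_le; lra); nra.
Qed.

Lemma one_sub_neq_0 w : (Cmod w < 1)%R -> 1 - w <> 0.
Proof.
  intros H E; assert (w = 1) by (transitivity (1 - (1 - w)); [ring|rewrite E; ring]).
  subst w; rewrite Cmod_1 in H; lra.
Qed.

Lemma ev_fX k q : (Cmod q < 1)%R -> ev (fX k) q = q ^ k.
Proof.
  intros Hq.
  assert (E0 : fX 0 = fc 1) by (apply functional_extensionality; intros [|m]; reflexivity).
  induction k as [|k IH]; [rewrite E0; apply ev_fc|].
  rewrite ev_tail by (try apply good_fX; exact Hq).
  change (ftail (fX (S k))) with (fX k); rewrite IH.
  unfold fX; simpl; ring.
Qed.

Lemma good_fw k : (1 <= k)%nat -> good (fw k).
Proof.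
  intros Hk; apply (good_le _ (fun _ => 1%R)); [|apply good_geom].
  intros n; assert (B := fw_coef_bound k n); rewrite Rabs_R1, Rabs_pos_eq; lra.
Qed.

Lemma ev_fw k q : (1 <= k)%nat -> (Cmod q < 1)%R -> ev (fw k) q = q ^ k / (1 - q ^ k).
Proof.
  intros Hk Hq.
  assert (E := f_equal (fun s => ev s q) (fw_eq k Hk)); cbv beta in E.
  rewrite ev_mul, ev_sub, ev_fX, ev_fc in E
    by (try apply good_fw; try apply good_sub; try apply good_fX; try apply good_fc; assumption).
  assert (N := one_sub_neq_0 _ (Cpow_lt_1 q k Hq Hk)).
  rewrite <- E at 1; field; exact N.
Qed.

Lemma good_fsum N g : (forall k, (1 <= k)%nat -> good (g k)) -> good (fsum N g).
Proof.
  intros H; induction N as [|N IH]; simpl; [apply good_fc|].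
  apply good_add; [exact IH|apply H; lia].
Qed.

Lemma good_term e c k : (1 <= e)%nat -> (1 <= k)%nat -> good (fc (c k) * fwe e k)%fps.
Proof. intros He Hk; apply good_scal, good_fw; nia. Qed.

(** For nonnegative c the partial sums increase coefficientwise to the full series: these are the
    domination and the agreement that [ev_trunc] asks for. *)
Lemma LS_partial_bound e c N n : (1 <= e)%nat -> (forall k, 0 <= c k)%R ->
  (Rabs (fsum N (fun k => fc (c k) * fwe e k)%fps n - LS (fwe e) c n) <= Rabs (LS (fwe e) c n))%R
  /\ ((n <= N)%nat -> fsum N (fun k => fc (c k) * fwe e k)%fps n = LS (fwe e) c n).
Proof.
  intros He Hc.
  assert (Hv : forall k, (n < k)%nat -> vanish k (fc (c k) * fwe e k)%fps).
  { intros k Hk; apply vanish_mull, fwe_graded; lia. }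
  assert (Hp : forall m, fsum m (fun k => fc (c k) * fwe e k)%fps n
     = psum (fun k => c k * fwe e k n)%R m).
  { intros m; rewrite fsum_coef; apply psum_ext; intros; apply fmul_fc. }
  assert (Ht : forall k, (0 <= c k * fwe e k n)%R).
  { intros k; apply Rmult_le_pos; [apply Hc|apply fw_coef_bound]. }
  destruct (Nat.le_gt_cases n N) as [Hn|Hn].
  - assert (E : fsum N (fun k => fc (c k) * fwe e k)%fps n = LS (fwe e) c n)
      by (apply fsum_eval; assumption).
    split; [|intros _; exact E].
    rewrite E; unfold Rminus; rewrite Rplus_opp_r, Rabs_R0; apply Rabs_pos.
  - split; [|lia].
    rewrite Hp, LS_coef.
    set (f := fun k => (c k * fwe e k n)%R) in *.
    assert (Hm : forall m, (N <= m)%nat -> (psum f N <= psum f m)%R).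
    { intros m Hm; induction Hm as [|m Hm IH]; [lra|]; simpl.
      assert (0 <= f (S m))%R by apply Ht; lra. }
    assert (P := Hm n ltac:(lia)).
    assert (0 <= psum f N)%R by (apply psum_nonneg; intros; apply Ht).
    rewrite <- Rabs_Ropp, !Rabs_pos_eq; lra.
Qed.

Lemma lambert_eq k q : (Cmod q < 1)%R -> lambert k q = ev (Sk k) q.
Proof.
  intros Hq; unfold lambert, CSeries; apply CLim_seq_unique; intros eps He.
  set (c := fun n => (INR n ^ k)%R).
  assert (Hc : forall n, (0 <= c n)%R) by (intros; apply pow_le, pos_INR).
  (* [sum_n] up to N has N + 1 terms, the first of which is the term k = 1. *)
  set (s := fun N => fsum (S N) (fun n => fc (c n) * fwe 1 n)%fps).
  assert (Hs : forall N, sum_n (fun n => RtoC (INR (S n)) ^ k * (q ^ S n / (1 - q ^ S n))) N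
    = ev (s N) q).
  { assert (T : forall n, ev (fc (c (S n)) * fwe 1 (S n))%fps q
      = RtoC (INR (S n)) ^ k * (q ^ S n / (1 - q ^ S n))).
    { intros n; rewrite ev_scal by (try apply good_fw; try assumption; lia).
      unfold fwe; rewrite Nat.mul_1_l, ev_fw by (try assumption; lia).
      unfold c; rewrite RtoC_pow; reflexivity. }
    induction N as [|N IH].
    - rewrite sum_O; unfold s; cbn [fsum].
      replace (0 + fc (c 1%nat) * fwe 1 1)%fps with (fc (c 1%nat) * fwe 1 1)%fps by ring.
      symmetry; apply T.
    - rewrite sum_Sn, IH; unfold s; cbn [fsum].
      rewrite (ev_add (fsum N _ + _)%fps).
      + rewrite T; reflexivity.
      + apply (good_fsum (S N)); intros; apply good_term; lia.
      + apply good_term; lia.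
      + exact Hq. }
  destruct (ev_trunc (Sk k) (Sk k) s q (good_Sk k) (good_Sk k)) with (eps := eps)
    as [N0 HN0]; try assumption.
  - intros N; apply (good_fsum (S N)); intros; apply good_term; lia.
  - intros N n; apply (LS_partial_bound 1 c (S N) n (Nat.le_refl 1) Hc).
  - intros N n Hn; apply (LS_partial_bound 1 c (S N) n (Nat.le_refl 1) Hc); lia.
  - exists N0; intros N HN; rewrite Hs; apply HN0, HN.
Qed.

(** The inverse of [fD] on series without constant term; the division by 0 at n = 0 then has
    numerator 0. *)
Definition fint (a : fps) : fps := fun n => (a n / INR n)%R.

Lemma fD_fint a : a O = 0%R -> fD (fint a) = a.
Proof.
  intros H; apply functional_extensionality; intros [|n]; unfold fD, fint.
  - rewrite H; simpl; ring.
  - field; apply not_0_INR; lia.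
Qed.

Lemma fint_O a : a O = 0%R -> fint a O = 0%R.
Proof. intros H; unfold fint; rewrite H; unfold Rdiv; apply Rmult_0_l. Qed.

Lemma Rabs_div_INR_le x n : (1 <= n)%nat -> (Rabs (x / INR n) <= Rabs x)%R.
Proof.
  intros Hn; assert (1 <= INR n)%R by (change 1%R with (INR 1); apply le_INR, Hn).
  unfold Rdiv; rewrite Rabs_mult, Rabs_inv, (Rabs_pos_eq (INR n)) by lra.
  rewrite <- (Rmult_1_r (Rabs x)) at 2; apply Rmult_le_compat_l; [apply Rabs_pos|].
  rewrite <- Rinv_1; apply Rinv_le_contravar; lra.
Qed.

Lemma good_fint a : a O = 0%R -> good a -> good (fint a).
Proof.
  intros H0; apply good_le; intros [|n].
  - rewrite fint_O by exact H0; rewrite Rabs_R0; apply Rabs_pos.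
  - apply Rabs_div_INR_le; lia.
Qed.

Fixpoint fqpoch (e N : nat) : fps :=
  match N with
  | O => fc 1
  | S n => (fqpoch e n * (fc 1 - fX (e * S n)))%fps
  end.

Lemma good_fqpoch e N : good (fqpoch e N).
Proof.
  induction N as [|N IH]; simpl; [apply good_fc|].
  apply good_mul; [exact IH|apply good_sub; [apply good_fc|apply good_fX]].
Qed.

Lemma ev_fqpoch e N q : (Cmod q < 1)%R -> ev (fqpoch e N) q = qpoch (q ^ e) N.
Proof.
  intros Hq; induction N as [|N IH]; [apply ev_fc|].
  cbn [fqpoch qpoch].
  rewrite ev_mul, ev_sub, ev_fX, ev_fc, IH
    by (try apply good_fqpoch; try apply good_sub; try apply good_fX; try apply good_fc; assumption).
  rewrite <- Cpow_mult_r; reflexivity.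
Qed.

(** Logarithmic derivative: the factor 1 - X^m contributes - m X^m / (1 - X^m). *)
Lemma fD_fqpoch e N : (1 <= e)%nat -> fD (fqpoch e N) =
  (fqpoch e N * - (fc (INR e) * fsum N (fun k => fc (INR k ^ 1)%R * fwe e k)))%fps.
Proof.
  intros He; induction N as [|N IH]; cbn [fqpoch fsum]; [rewrite fD_fc; ring|].
  rewrite fD_mul, IH, fD_sub, fD_fc, fD_fX.
  rewrite <- (fw_eq (e * S N)) at 2 by nia.
  unfold fwe; rewrite mult_INR, fc_mul, pow_1; ring.
Qed.

Lemma fqpoch_O e N : (1 <= e)%nat -> fqpoch e N O = 1%R.
Proof.
  intros He; induction N as [|N IH]; [reflexivity|]; cbn [fqpoch].
  change (fqpoch e N O * (1 - fX (e * S N) O) = 1)%R.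
  rewrite IH; unfold fX; destruct (Nat.eqb_spec 0 (e * S N)); [nia|ring].
Qed.

(* minus the logarithm of the product of the 1 - q^(e n) *)
Definition flog (e : nat) : fps :=
  fint (fc (INR e) * LS (fwe e) (fun k => INR k ^ 1)%R)%fps.

Lemma LS_O e c : LS (fwe e) c O = 0%R.
Proof. reflexivity. Qed.

Lemma flog_arg_O e : (fc (INR e) * LS (fwe e) (fun k => INR k ^ 1)%R)%fps O = 0%R.
Proof. rewrite fmul_fc, LS_O; ring. Qed.

Lemma good_LS_1 e : good (LS (fwe e) (fun k => INR k ^ 1)%R).
Proof.
  apply (good_LS e _ 1 1); intros k; rewrite Rabs_pos_eq by (apply pow_le, pos_INR); lra.
Qed.

Lemma good_flog e : good (flog e).
Proof. apply good_fint; [apply flog_arg_O|]; apply good_scal, good_LS_1. Qed.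

(** By [ev_exp] each finite product is the exponential of its formal logarithm, so convergence of
    the product reduces to [ev_trunc] for the logarithms. *)
Lemma qpoch_limit e q : (1 <= e)%nat -> (Cmod q < 1)%R ->
  CLim_seq (qpoch (q ^ e)) = Cexp (- ev (flog e) q).
Proof.
  intros He Hq; apply CLim_seq_unique; intros eps Heps.
  set (c := fun k => (INR k ^ 1)%R).
  assert (Hc : forall n, (0 <= c n)%R) by (intros; apply pow_le, pos_INR).
  set (p := fun N => (fc (INR e) * fsum N (fun k => fc (c k) * fwe e k))%fps).
  assert (Hp0 : forall N, p N O = 0%R).
  { intros N; unfold p; rewrite fmul_fc; destruct (LS_partial_bound e c N O He Hc) as [_ E].
    rewrite E by lia; apply flog_arg_O || (rewrite LS_O; ring). }
  assert (Hpg : forall N, good (p N)).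
  { intros N; apply good_scal, good_fsum; intros; apply good_term; assumption. }
  assert (Hq1 : forall N, qpoch (q ^ e) N = Cexp (- ev (fint (p N)) q)).
  { intros N; rewrite <- ev_fqpoch by exact Hq.
    rewrite (ev_exp _ (- fint (p N))%fps).
    - rewrite fqpoch_O by exact He; rewrite Cmult_1_l; f_equal.
      replace (- fint (p N))%fps with (fc (-1) * fint (p N))%fps
        by (extensionality n; rewrite fmul_fc; unfold fopp; ring).
      rewrite ev_scal by (try apply good_fint; auto); ring.
    - apply good_fqpoch.
    - apply good_opp, good_fint; auto.
    - unfold fopp; rewrite fint_O by auto; ring.
    - rewrite fD_fqpoch by exact He.
      replace (fD (- fint (p N))%fps) with (- fD (fint (p N)))%fps
        by (extensionality n; unfold fopp, fD; ring).
      rewrite fD_fint by auto; reflexivity.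
    - exact Hq. }
  destruct (CD_continuous Cexp (- ev (flog e) q) _ (CD_exp _) eps Heps) as (d & Hd & Hcont).
  destruct (ev_trunc (flog e) (fc (INR e) * LS (fwe e) c)%fps (fun N => fint (p N)) q)
    with (eps := d) as [N0 HN0]; try assumption.
  - apply good_flog.
  - apply good_scal, good_LS_1.
  - intros N; apply good_fint; auto.
  - intros N [|n].
    + rewrite fint_O by auto; unfold flog; rewrite fint_O by apply flog_arg_O.
      unfold Rminus; rewrite Rplus_opp_r, Rabs_R0; apply Rabs_pos.
    + unfold flog, fint.
      replace (p N (S n) / INR (S n) - (fc (INR e) * LS (fwe e) (fun k => INR k ^ 1)%R)%fps (S n) / INR (S n))%R
        with ((p N (S n) - (fc (INR e) * LS (fwe e) c)%fps (S n)) / INR (S n))%R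
        by (unfold c; field; apply not_0_INR; lia).
      eapply Rle_trans; [apply Rabs_div_INR_le; lia|].
      unfold p; rewrite !fmul_fc, <- Rmult_minus_distr_l, !Rabs_mult.
      apply Rmult_le_compat_l; [apply Rabs_pos|].
      apply (LS_partial_bound e c N (S n) He Hc).
  - intros N n Hn; unfold flog, fint, p; rewrite !fmul_fc.
    destruct (LS_partial_bound e c N n He Hc) as [_ E]; rewrite E by exact Hn; reflexivity.
  - exists N0; intros N HN; rewrite Hq1; apply Hcont.
    replace (- ev (fint (p N)) q - - ev (flog e) q)
      with (- (ev (fint (p N)) q - ev (flog e) q)) by ring.
    rewrite Cmod_opp; apply HN0, HN.
Qed.

(** * The nome, the Eisenstein series and u as functions of tau *)

Definition tpi : C := 2 * RtoC PI * Ci.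

Lemma nome_eq tau : nome tau = Cexp (tpi * tau).
Proof. reflexivity. Qed.

Lemma Cmod_nome tau : Cmod (nome tau) = exp (- (2 * PI * Im tau)).
Proof.
  unfold nome; rewrite Cmod_Cexp; f_equal.
  destruct tau as [x y]; unfold Cmult, Ci, RtoC, Re, Im; cbn [fst snd]; ring.
Qed.

Lemma nome_lt_1 tau : (0 < Im tau)%R -> (Cmod (nome tau) < 1)%R.
Proof.
  intros H; rewrite Cmod_nome, <- exp_0; apply exp_increasing.
  assert (P := PI_RGT_0); nra.
Qed.

Lemma CD_nome tau : CD nome tau (tpi * nome tau).
Proof.
  apply (CD_ext (fun t => Cexp (tpi * t))); [reflexivity|].
  eapply CD_eq; [|apply (CD_comp Cexp (fun t => tpi * t));
    [apply CD_exp|apply CD_scal, CD_id]].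
  rewrite nome_eq; ring.
Qed.

Lemma CD_ev_nome s tau : good s -> (0 < Im tau)%R ->
  CD (fun t => ev s (nome t)) tau (tpi * ev (fD s) (nome tau)).
Proof.
  intros Hs Ht; assert (Hq := nome_lt_1 tau Ht).
  eapply CD_eq; [|apply (CD_comp (ev s) nome); [apply CD_ev; assumption|apply CD_nome]].
  rewrite <- ev_dif_mul by assumption; ring.
Qed.

Lemma good_fP : good fP.
Proof. apply good_sub; [apply good_fc|apply good_scal, good_Sk]. Qed.

Lemma good_fQ : good fQ.
Proof. apply good_add; [apply good_fc|apply good_scal, good_Sk]. Qed.

Lemma good_fR : good fR.
Proof. apply good_sub; [apply good_fc|apply good_scal, good_Sk]. Qed.

Lemma good_fa : good fa.
Proof. apply good_add; [apply good_fc|apply good_scal, good_Xk]. Qed.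

Lemma good_fB : good fB.
Proof. apply good_sub; [apply good_fc|apply good_scal, good_Xk]. Qed.

Lemma good_fC : good fC.
Proof. exact (good_sub _ _ (good_mul _ _ (good_mul _ _ good_fa good_fa) good_fa) good_fB). Qed.

Ltac good_tac := repeat match goal with
  | |- good (fadd _ _) => apply good_add
  | |- good (fsub _ _) => apply good_sub
  | |- good (fopp _) => apply good_opp
  | |- good (fmul _ _) => apply good_mul
  | |- good (fD _) => apply good_D
  | |- good (fc _) => apply good_fc
  | |- good (fz _) => apply good_fz
  | |- good (fX _) => apply good_fX
  | |- good fP => exact good_fP
  | |- good fQ => exact good_fQ
  | |- good fR => exact good_fR
  | |- good fa => exact good_fa
  | |- good fB => exact good_fB
  | |- good fC => exact good_fC
  | |- good (flog _) => apply good_flog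
  | |- good (Sk _) => apply good_Sk
  | |- good (Vk _) => apply good_Vk
  | |- good (Xk _) => apply good_Xk
  | |- _ => assumption
  end.

Lemma ev_fz z w : ev (fz z) w = RtoC (IZR z).
Proof. apply ev_fc. Qed.

Ltac evaluate H E q :=
  assert (H := f_equal (fun s => ev s q) E); cbv beta in H;
  repeat rewrite ?ev_sub, ?ev_add, ?ev_mul, ?ev_fz in H by good_tac.

Lemma E2_eq tau : (0 < Im tau)%R -> E2 tau = ev fP (nome tau).
Proof.
  intros H; assert (Hq := nome_lt_1 tau H).
  unfold E2, fP; rewrite lambert_eq, ev_sub, ev_mul, ev_fc, ev_fz by good_tac; reflexivity.
Qed.

Lemma E4_eq tau : (0 < Im tau)%R -> E4 tau = ev fQ (nome tau).
Proof.
  intros H; assert (Hq := nome_lt_1 tau H).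
  unfold E4, fQ; rewrite lambert_eq, ev_add, ev_mul, ev_fc, ev_fz by good_tac; reflexivity.
Qed.

Lemma E6_eq tau : (0 < Im tau)%R -> E6 tau = ev fR (nome tau).
Proof.
  intros H; assert (Hq := nome_lt_1 tau H).
  unfold E6, fR; rewrite lambert_eq, ev_sub, ev_mul, ev_fc, ev_fz by good_tac; reflexivity.
Qed.

Lemma fD_flog_1 : fD (flog 1) = Sk 1.
Proof.
  unfold flog; rewrite fD_fint by apply flog_arg_O.
  change (fc (INR 1)) with (fz 1); fold (Sk 1); ring.
Qed.

Lemma fD_flog_3 : fD (flog 3) = (fz 3 * Vk 1)%fps.
Proof.
  unfold flog; rewrite fD_fint by apply flog_arg_O.
  rewrite fc_INR_3; reflexivity.
Qed.

Lemma flog_O e : flog e O = 0%R.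
Proof. apply fint_O, flog_arg_O. Qed.

Lemma fa_O : fa O = 1%R.
Proof. unfold fa, fadd, Xk, fz; rewrite fmul_fc, LS_O; simpl; ring. Qed.

Lemma fB_O : fB O = 1%R.
Proof. unfold fB, fsub, Xk, fz; rewrite fmul_fc, LS_O; simpl; ring. Qed.

Lemma fC_O : fC O = 0%R.
Proof.
  change (fa O * fa O * fa O - fB O = 0)%R; rewrite fa_O, fB_O; ring.
Qed.

(** 18 comes from a^3 and 9 from - b. This 27 fixes the constant both in the eta quotient and in the
    relation between x and q. *)
Lemma fC_1 : fC 1%nat = 27%R.
Proof.
  assert (Ea : fa 1%nat = 6%R).
  { unfold fa, fadd, Xk, fz; rewrite fmul_fc, LS_coef; simpl.
    rewrite chi3_S, c3_O, chi3_O; unfold fwe, fw; simpl; lra. }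
  assert (Eb : fB 1%nat = (-9)%R).
  { unfold fB, fsub, Xk, fz; rewrite fmul_fc, LS_coef; simpl.
    rewrite chi3_S, c3_O, chi3_O; unfold fwe, fw; simpl; lra. }
  change ((fa O * fa O) * fa 1%nat + (fa O * fa 1%nat + fa 1%nat * fa O) * fa O
    - fB 1%nat = 27)%R.
  rewrite fa_O, Ea, Eb; ring.
Qed.

Lemma fP_sub_fa_sq : (fz 2 * (fP - fa * fa) = fz 3 * fP - fz 3 * fP3)%fps.
Proof.
  assert (H := fa_sq); transitivity (fz 2 * fP - fz 2 * (fa * fa))%fps; [ring|].
  replace (fz 2 * (fa * fa))%fps with (fz 3 * fP3 - fP)%fps; [ring|].
  rewrite H; ring.
Qed.

(* b(q)^3 = prod (1 - q^n)^9 / (1 - q^(3n))^3 *)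
Lemma ev_fB q : (Cmod q < 1)%R ->
  ev fB q = Cexp (3 * ev (flog 3) q - 9 * ev (flog 1) q).
Proof.
  intros Hq.
  rewrite (ev_exp fB (fz 3 * flog 3 - fz 9 * flog 1)%fps).
  - rewrite fB_O, ev_sub, !ev_mul, !ev_fz by good_tac.
    rewrite Cmult_1_l; reflexivity.
  - good_tac.
  - good_tac.
  - unfold fsub, fz; rewrite !fmul_fc, !flog_O; ring.
  - apply (fz_cancel 8); [discriminate|].
    transitivity (fz 2 * (fz 4 * fD fB))%fps; [ring|].
    rewrite fD_fB, fD_sub, !fD_fz, fD_flog_1, fD_flog_3.
    transitivity (fB * (fz 2 * (fP - fa * fa)))%fps; [ring|].
    rewrite fP_sub_fa_sq; unfold fP, fP3; ring.
  - exact Hq.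
Qed.

(* c(q)^3 = 27 q prod (1 - q^(3n))^9 / (1 - q^n)^3 *)
Lemma ev_fC q : (Cmod q < 1)%R ->
  ev fC q = 27 * q * Cexp (3 * ev (flog 1) q - 9 * ev (flog 3) q).
Proof.
  intros Hq.
  rewrite ev_tail by good_tac; rewrite fC_O.
  (* [fC] vanishes at q = 0, so [ev_exp] is applied to [fC] divided by q. *)
  assert (EX : fC = (fX 1 * ftail fC)%fps).
  { apply functional_extensionality; intros [|n]; rewrite fX_mul; simpl.
    - apply fC_O.
    - rewrite Nat.sub_0_r; reflexivity. }
  rewrite (ev_exp (ftail fC) (fz 3 * flog 1 - fz 9 * flog 3)%fps).
  - change (ftail fC O) with (fC 1%nat); rewrite fC_1.
    rewrite ev_sub, !ev_mul, !ev_fz by good_tac; ring.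
  - apply good_tail; good_tac.
  - good_tac.
  - unfold fsub, fz; rewrite !fmul_fc, !flog_O; ring.
  - assert (H := fD_fC); rewrite EX, fD_mul, fD_fX in H.
    replace (fc (INR 1)) with (fz 1) in H by reflexivity.
    set (t := ftail fC) in *.
    assert (HX : forall v w, (fX 1 * v = fX 1 * w)%fps -> v = w).
    { intros v w E; extensionality n.
      assert (E' := f_equal (fun s => s (S n)) E); cbv beta in E'.
      rewrite !fX_mul in E'; simpl in E'; rewrite Nat.sub_0_r in E'; exact E'. }
    apply HX; apply (fz_cancel 8); [discriminate|].
    rewrite fD_sub, !fD_fz, fD_flog_1, fD_flog_3.
    transitivity (fz 2 * (fz 4 * (fz 1 * fX 1 * t + fX 1 * fD t)) - fz 8 * fX 1 * t)%fps; [ring|].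
    rewrite H.
    transitivity (fX 1 * t * (fz 3 * (fz 2 * (fa * fa)) + fz 2 * fP - fz 8))%fps; [ring|].
    replace (fz 2 * (fa * fa))%fps with (fz 3 * fP3 - fP)%fps
      by (rewrite fa_sq; ring).
    unfold fP, fP3; ring.
  - exact Hq.
Qed.

Lemma ev_fC_neq_0 tau : (0 < Im tau)%R -> ev fC (nome tau) <> 0.
Proof.
  intros H; rewrite ev_fC by now apply nome_lt_1.
  repeat apply Cmult_neq_0; try apply Cexp_neq_0.
  intros E; apply RtoC_inj in E; lra.
Qed.

Lemma eta_eq tau : (0 < Im tau)%R ->
  eta tau = Cexp (tpi * tau / 24 - ev (flog 1) (nome tau)).
Proof.
  intros H; unfold eta.
  replace (nome tau) with (nome tau ^ 1) at 1 by (simpl; ring).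
  rewrite qpoch_limit by (try apply nome_lt_1; try assumption; lia).
  unfold Cminus; rewrite Cexp_plus; reflexivity.
Qed.

Lemma eta_3_eq tau : (0 < Im tau)%R ->
  eta (3 * tau) = Cexp (tpi * (3 * tau) / 24 - ev (flog 3) (nome tau)).
Proof.
  intros H; unfold eta.
  replace (nome (3 * tau)) with (nome tau ^ 3).
  - rewrite qpoch_limit by (try apply nome_lt_1; try assumption; lia).
    unfold Cminus; rewrite Cexp_plus; reflexivity.
  - rewrite !nome_eq, Cexp_pow; f_equal; simpl INR.
    replace (RtoC (1 + 1 + 1)) with (RtoC 3) by (f_equal; ring); ring.
Qed.

Lemma u_eq tau : (0 < Im tau)%R ->
  u tau = - (ev fB (nome tau) / ev fC (nome tau)).
Proof.
  intros H; unfold u.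
  assert (Hq := nome_lt_1 tau H).
  rewrite eta_eq, eta_3_eq, ev_fB, ev_fC by assumption.
  set (f1 := ev (flog 1) (nome tau)); set (f3 := ev (flog 3) (nome tau)).
  unfold Cdiv at 2; rewrite <- Cexp_opp, <- Cexp_plus, Cexp_pow.
  rewrite nome_eq.
  set (p := 3 * f3 - 9 * f1); set (r := 3 * f1 - 9 * f3).
  (* The products contribute 12 (f3 - f1) = p - r, and the prefactors q^(12/24 - 36/24) = 1 / q. *)
  transitivity (- (1 / 27) * (Cexp p * Cexp (- r) * Cexp (- (tpi * tau)))).
  - rewrite <- !Cexp_plus; f_equal; f_equal; unfold p, r.
    replace (RtoC (INR 12)) with (RtoC 12) by (f_equal; simpl; ring).
    field.
  - rewrite !Cexp_opp; field; split; apply Cexp_neq_0.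
Qed.

(** * The modular function x = 1 / (1 - u) *)

Definition Xf (tau : C) : C :=
  ev fC (nome tau) / (ev fa (nome tau) * ev fa (nome tau) * ev fa (nome tau)).

Lemma ev_fC_eq q : (Cmod q < 1)%R -> ev fC q = ev fa q * ev fa q * ev fa q - ev fB q.
Proof. intros Hq; unfold fC; rewrite ev_sub, !ev_mul by good_tac; reflexivity. Qed.

(** An open set containing [region] on which x is holomorphic and stays in the disc of convergence
    of F; all continuation arguments take place in it. *)
Definition Omega (tau : C) : Prop :=
  (0 < Im tau)%R /\ ev fa (nome tau) <> 0 /\ (Cmod (Xf tau) < 1)%R.

Lemma one_sub_u tau : (0 < Im tau)%R ->
  1 - u tau = ev fa (nome tau) * ev fa (nome tau) * ev fa (nome tau) / ev fC (nome tau).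
Proof.
  intros H; rewrite u_eq by exact H.
  assert (N := ev_fC_neq_0 tau H).
  assert (E := ev_fC_eq _ (nome_lt_1 tau H)).
  rewrite E in N |- *; field; exact N.
Qed.

Lemma region_Omega tau : region tau -> Omega tau /\ 1 / (1 - u tau) = Xf tau.
Proof.
  intros [(Hi & _) Hu].
  assert (N := ev_fC_neq_0 tau Hi); rewrite (one_sub_u tau Hi) in *; unfold Omega, Xf.
  set (a := ev fa (nome tau)) in *; set (c := ev fC (nome tau)) in *.
  assert (Ha : a <> 0).
  { intros E; rewrite E in Hu.
    replace (0 * 0 * 0 / c) with (RtoC 0) in Hu by (field; exact N).
    rewrite Cmod_0 in Hu; lra. }
  assert (E : 1 / (a * a * a / c) = c / (a * a * a)) by (field; auto).
  split; [|exact E]; split; [exact Hi|split; [exact Ha|]].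
  assert (Nd : a * a * a / c <> 0).
  { intros E'; rewrite E', Cmod_0 in Hu; lra. }
  rewrite <- E, Cmod_div by exact Nd; rewrite Cmod_1.
  apply (Rmult_lt_reg_r (Cmod (a * a * a / c))); [lra|].
  unfold Rdiv; rewrite Rmult_assoc, Rinv_l, Rmult_1_r, Rmult_1_l by lra; exact Hu.
Qed.

Lemma ev_fD_fa q : (Cmod q < 1)%R -> 12 * ev (fD fa) q =
  ev fa q * (3 * (ev fa q * ev fa q) + ev fP q) - 4 * ev fB q.
Proof.
  intros Hq; evaluate H fD_fa q; exact H.
Qed.

Lemma ev_fD_fC q : (Cmod q < 1)%R -> 4 * ev (fD fC) q =
  ev fC q * (3 * (ev fa q * ev fa q) + ev fP q).
Proof.
  intros Hq; evaluate H fD_fC q; exact H.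
Qed.

(** Numerator and denominator of x both have weight 3, so E2 cancels from the logarithmic
    derivative. *)
Lemma CD_Xf tau : (0 < Im tau)%R -> ev fa (nome tau) <> 0 ->
  CD Xf tau (tpi * (Xf tau * (1 - Xf tau) * (ev fa (nome tau) * ev fa (nome tau)))).
Proof.
  intros Hi Ha; assert (Hq := nome_lt_1 tau Hi).
  set (A3 := fun t => ev fa (nome t) * ev fa (nome t) * ev fa (nome t)).
  assert (HA := CD_ev_nome fa tau good_fa Hi).
  assert (HA3 := CD_mult _ _ _ _ _ (CD_mult _ _ _ _ _ HA HA) HA).
  assert (N : A3 tau <> 0) by (unfold A3; repeat apply Cmult_neq_0; exact Ha).
  eapply CD_eq; [|apply (CD_mult (fun t => ev fC (nome t)) (fun t => / A3 t));
    [apply CD_ev_nome; [good_tac|exact Hi]|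
     apply (CD_comp Cinv A3); [apply CD_inv, N|exact HA3]]].
  unfold A3, Xf in *.
  assert (E1 := ev_fD_fa _ Hq); assert (E2 := ev_fD_fC _ Hq); assert (E3 := ev_fC_eq _ Hq).
  set (a := ev fa (nome tau)) in *; set (c := ev fC (nome tau)) in *.
  set (b := ev fB (nome tau)) in *; set (p := ev fP (nome tau)) in *.
  set (da := ev (fD fa) (nome tau)) in *; set (dc := ev (fD fC) (nome tau)) in *.
  assert (E1' : da = (a * (3 * (a * a) + p) - 4 * b) / 12) by (rewrite <- E1; field).
  assert (E2' : dc = c * (3 * (a * a) + p) / 4) by (rewrite <- E2; field).
  rewrite E1', E2', E3; field; exact Ha.
Qed.

(** * The hypergeometric series *)

Fixpoint hyp (n : nat) : R :=
  match n with
  | O => 1%R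
  | S m => (hyp m * ((INR m + 1 / 3) * (INR m + 2 / 3) / ((INR m + 1) * (INR m + 1))))%R
  end.

Definition fH : fps := hyp.

Lemma hyp_pos n : (0 < hyp n)%R.
Proof.
  induction n as [|n IH]; simpl; [lra|].
  assert (0 <= INR n)%R by apply pos_INR.
  apply Rmult_lt_0_compat; [exact IH|].
  apply Rdiv_lt_0_compat; apply Rmult_lt_0_compat; lra.
Qed.

Lemma hyp_decr n : (hyp (S n) <= hyp n)%R.
Proof.
  simpl; assert (H := hyp_pos n); assert (0 <= INR n)%R by apply pos_INR.
  rewrite <- (Rmult_1_r (hyp n)) at 2; apply Rmult_le_compat_l; [lra|].
  apply (Rmult_le_reg_r ((INR n + 1) * (INR n + 1))); [nra|].
  unfold Rdiv; rewrite Rmult_assoc, Rinv_l by nra; nra.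
Qed.

Lemma hyp_le_1 n : (hyp n <= 1)%R.
Proof.
  induction n as [|n IH]; [simpl; lra|].
  eapply Rle_trans; [apply hyp_decr|exact IH].
Qed.

Lemma good_fH : good fH.
Proof.
  apply (good_le _ (fun _ => 1%R)); [|apply good_geom].
  intros n; assert (H1 := hyp_pos n); assert (H2 := hyp_le_1 n).
  unfold fH; rewrite Rabs_R1, Rabs_pos_eq; lra.
Qed.

Lemma hyp2F1_eq z : hyp2F1 (1 / 3) (2 / 3) 1 z = ev fH z.
Proof.
  unfold hyp2F1, ev; apply CSeries_ext; intros n; f_equal.
  assert (Hf : forall m, rising 1 m = RtoC (INR (fact m))).
  { induction m as [|m IH]; [reflexivity|].
    cbn [rising]; rewrite IH, fact_simpl, mult_INR, RtoC_mult, S_INR, RtoC_plus; ring. }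
  assert (Hn : forall m, RtoC (INR (fact m)) <> 0).
  { intros m E; apply RtoC_inj in E; revert E; apply INR_fact_neq_0. }
  assert (Hm : forall m, RtoC (INR m) + 1 <> 0).
  { intros m E; rewrite <- RtoC_plus in E; apply RtoC_inj in E.
    assert (0 <= INR m)%R by apply pos_INR; lra. }
  unfold fH; induction n as [|n IH].
  - simpl; field; intros E; apply RtoC_inj in E; lra.
  - cbn [hyp rising]; rewrite RtoC_mult, <- IH, !Hf, fact_simpl, mult_INR, RtoC_mult, S_INR.
    assert (Hp := pos_INR n).
    rewrite RtoC_div by nra; rewrite !RtoC_mult, !RtoC_plus, !RtoC_div by lra.
    field; repeat split; auto; intros E; apply RtoC_inj in E; lra.
Qed.

(** The hypergeometric equation in Euler form, with 2/9 = 1/3 * 2/3; on coefficients it is the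
    recurrence defining [hyp]. *)
Lemma fH_ode : fD ((1 - fX 1) * fD fH)%fps = (fc (2 / 9) * (fX 1 * fH))%fps.
Proof.
  replace ((1 - fX 1) * fD fH)%fps with (fD fH - fX 1 * fD fH)%fps by ring.
  extensionality n.
  rewrite fmul_fc; unfold fD at 1, fsub; rewrite !fX_mul.
  destruct n as [|n]; [simpl; ring|].
  change (Nat.ltb (S n) 1) with false; cbv iota; replace (S n - 1)%nat with n by lia.
  unfold fD, fH; cbn [hyp]; rewrite S_INR.
  assert (0 <= INR n)%R by apply pos_INR; field; lra.
Qed.

(* (1 - x) F = 1 - e(x) where e has nonnegative coefficients of sum at most 1,
   so that (1 - x) F has an inverse with coefficients in [0, 1]. *)
Definition fe : fps := (1 - (1 - fX 1) * fH)%fps.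

Lemma fe_coef n : fe (S n) = (hyp n - hyp (S n))%R.
Proof.
  unfold fe; replace (1 - (1 - fX 1) * fH)%fps with (1 - fH + fX 1 * fH)%fps by ring.
  unfold fadd, fsub; rewrite fX_mul; change (Nat.ltb (S n) 1) with false; cbv iota.
  replace (S n - 1)%nat with n by lia; simpl; unfold fH; simpl; ring.
Qed.

Lemma fe_O : fe O = 0%R.
Proof.
  unfold fe; replace (1 - (1 - fX 1) * fH)%fps with (1 - fH + fX 1 * fH)%fps by ring.
  unfold fadd, fsub; rewrite fX_mul; simpl; ring.
Qed.

(** Partial sums of the geometric series of [fe]; as [fe] has no constant term they stabilise
    coefficientwise, with limit 1 / (1 - fe). *)
Fixpoint geo (N : nat) : fps :=
  match N with O => 1%fps | S n => (1 + fe * geo n)%fps end.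

Definition fI : fps := fun n => geo n n.

Lemma vanish_fe : vanish 1 fe.
Proof. intros n Hn; replace n with O by lia; apply fe_O. Qed.

Lemma geo_stable N : vanish (S N) (geo (S N) - geo N)%fps.
Proof.
  induction N as [|N IH].
  - simpl; replace (1 + fe * 1 - 1)%fps with fe by ring; apply vanish_fe.
  - change (vanish (S (S N)) (1 + fe * geo (S N) - (1 + fe * geo N))%fps).
    replace (1 + fe * geo (S N) - (1 + fe * geo N))%fps
      with (fe * (geo (S N) - geo N))%fps by ring.
    apply (vanish_mul 1 (S N)); [apply vanish_fe|exact IH].
Qed.

Lemma geo_eval N n : (n <= N)%nat -> geo N n = fI n.
Proof.
  intros H; induction H as [|N H IH]; [reflexivity|].
  rewrite <- IH; assert (E := geo_stable N n ltac:(lia)); unfold fsub in E; lra.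
Qed.

Lemma fI_eq : ((1 - fX 1) * fH * fI)%fps = 1%fps.
Proof.
  assert (E : fI = (1 + fe * fI)%fps).
  { extensionality n.
    rewrite <- (geo_eval (S n) n) by lia; cbn [geo].
    unfold fadd; f_equal.
    apply fmul_ext_le; intros k Hk; [reflexivity|apply geo_eval; exact Hk]. }
  transitivity (fI - fe * fI)%fps; [unfold fe; ring|].
  rewrite E at 1; ring.
Qed.

(** The coefficients hyp n - hyp (n + 1) of [fe] are nonnegative and telescope to a sum at most 1,
    so convolution with [fe] preserves values in [0, 1]. *)
Lemma fe_mul_bound g n : (forall k, (0 <= g k <= 1)%R) -> (0 <= (fe * g)%fps n <= 1)%R.
Proof.
  intros Hg; rewrite fmul_sum.
  assert (E : forall m, (m <= n)%nat ->
    (0 <= sum_f_R0 (fun k => fe k * g (n - k)%nat) m <= 1 - hyp m)%R).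
  { induction m as [|m IH]; intros Hm.
    - simpl; rewrite fe_O; lra.
    - simpl sum_f_R0; rewrite fe_coef.
      assert (D := hyp_decr m); assert (G := Hg (n - S m)%nat).
      specialize (IH ltac:(lia)); nra. }
  specialize (E n (Nat.le_refl n)); assert (P := hyp_pos n); lra.
Qed.

Lemma fI_bound n : (0 <= fI n <= 1)%R.
Proof.
  unfold fI; generalize n at 1 3 as N; intros N; revert n.
  induction N as [|N IH]; intros n.
  - destruct n; simpl; lra.
  - cbn [geo]; unfold fadd; assert (B := fe_mul_bound (geo N) n IH).
    destruct n as [|n]; [|simpl fc; lra].
    change ((fe * geo N)%fps O) with (fe O * geo N O)%R; rewrite fe_O; simpl; lra.
Qed.

Lemma good_fI : good fI.
Proof.
  apply (good_le _ (fun _ => 1%R)); [|apply good_geom].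
  intros n; assert (H := fI_bound n); rewrite Rabs_R1, Rabs_pos_eq; lra.
Qed.

(* h with q = (x / 27) exp (h x): dlog q = dx / (x (1 - x) F^2) *)
Definition fh : fps := fint ((1 - fX 1) * (fI * fI) - 1)%fps.

Lemma fh_arg_O : ((1 - fX 1) * (fI * fI) - 1)%fps O = 0%R.
Proof.
  assert (E : fI O = 1%R) by reflexivity.
  unfold fsub at 1; change ((1 - fX 1)%fps O * (fI O * fI O) - 1 = 0)%R.
  unfold fsub, fX; rewrite E; simpl; ring.
Qed.

Lemma good_one_sub_fX : good (1 - fX 1)%fps.
Proof. apply good_sub; [apply good_fc|apply good_fX]. Qed.

Lemma good_fh : good fh.
Proof.
  apply good_fint; [exact fh_arg_O|].
  apply good_sub; [|apply good_fc].
  apply good_mul; [exact good_one_sub_fX|apply good_mul; exact good_fI].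
Qed.

Lemma fD_fh : (fD fh + 1)%fps = ((1 - fX 1) * (fI * fI))%fps.
Proof. unfold fh; rewrite fD_fint by exact fh_arg_O; ring. Qed.

Lemma ev_one_sub_fX z : (Cmod z < 1)%R -> ev (1 - fX 1)%fps z = 1 - z.
Proof.
  intros Hz; rewrite ev_sub, ev_fc, ev_fX by (try apply good_fc; try apply good_fX; exact Hz).
  simpl; ring.
Qed.

Lemma ev_fI z : (Cmod z < 1)%R -> (1 - z) * ev fH z * ev fI z = 1.
Proof.
  intros Hz; assert (E := f_equal (fun s => ev s z) fI_eq); cbv beta in E.
  rewrite !ev_mul, ev_one_sub_fX, ev_fc in E
    by (try apply good_mul; first [exact Hz|exact good_one_sub_fX|exact good_fH|exact good_fI]).
  exact E.
Qed.

(** The inverse series converges on the whole disc. Division by F is thus legitimate everywhere in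
    [Omega]. *)
Lemma ev_fH_neq_0 z : (Cmod z < 1)%R -> ev fH z <> 0.
Proof.
  intros Hz E; assert (H := ev_fI z Hz); rewrite E in H.
  apply C1_nz; rewrite <- H; ring.
Qed.

Lemma ev_fD_fh z : (Cmod z < 1)%R ->
  (ev (fD fh) z + 1) * ((1 - z) * (ev fH z * ev fH z)) = 1.
Proof.
  intros Hz; assert (E := f_equal (fun s => ev s z) fD_fh); cbv beta in E.
  assert (G := good_D _ good_fh); assert (GI := good_mul _ _ good_fI good_fI).
  rewrite ev_add, !ev_mul, ev_one_sub_fX, ev_fc in E
    by first [exact Hz|exact G|exact GI|exact good_fI|exact good_one_sub_fX|apply good_fc].
  change (ev (fD fh) z + 1 = (1 - z) * (ev fI z * ev fI z)) in E; rewrite E.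
  transitivity (((1 - z) * ev fH z * ev fI z) * ((1 - z) * ev fH z * ev fI z)); [ring|].
  rewrite ev_fI by exact Hz; ring.
Qed.

(** * Analytic continuation along the component *)

Lemma CD_near f z l : CD f z l -> (Cmod (f z) < 1)%R ->
  exists d, (0 < d)%R /\ forall y, (Cmod (y - z)%C < d)%R -> (Cmod (f y) < 1)%R.
Proof.
  intros H Hz.
  destruct (CD_continuous f z l H (1 - Cmod (f z))) as (d & Hd & Hf); [lra|].
  exists d; split; [exact Hd|]; intros y Hy; specialize (Hf y Hy).
  replace (f y) with ((f y - f z) + f z) by ring.
  eapply Rle_lt_trans; [apply Cmod_triangle|lra].
Qed.

Lemma Omega_open tau : Omega tau ->
  exists d, (0 < d)%R /\ forall y, (Cmod (y - tau)%C < d)%R -> Omega y.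
Proof.
  intros (Hi & Ha & Hx).
  destruct (CD_near Xf tau _ (CD_Xf tau Hi Ha) Hx) as (d1 & Hd1 & H1).
  destruct (CD_continuous (fun t => ev fa (nome t)) tau _ (CD_ev_nome fa tau good_fa Hi)
    (Cmod (ev fa (nome tau)))) as (d2 & Hd2 & H2).
  { apply (proj1 (Cmod_gt_0 _)), Ha. }
  exists (Rmin (Im tau) (Rmin d1 d2)); split.
  - repeat apply Rmin_pos; assumption.
  - intros y Hy.
    assert (Hy0 : (Cmod (y - tau) < Im tau)%R)
      by (eapply Rlt_le_trans; [exact Hy|apply Rmin_l]).
    assert (Hy12 : (Cmod (y - tau) < Rmin d1 d2)%R)
      by (eapply Rlt_le_trans; [exact Hy|apply Rmin_r]).
    split; [|split].
    + assert (B := im_le_Cmod (y - tau)).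
      change (Im (y - tau)) with (Im y + - Im tau)%R in B.
      apply Rle_lt_trans with (2 := Hy0) in B; apply Rabs_def2 in B; lra.
    + intros E; specialize (H2 y (Rlt_le_trans _ _ _ Hy12 (Rmin_r _ _))).
      rewrite E in H2.
      replace (0 - ev fa (nome tau)) with (- ev fa (nome tau)) in H2 by ring.
      rewrite Cmod_opp in H2; lra.
    + apply H1; eapply Rlt_le_trans; [exact Hy12|apply Rmin_l].
Qed.

(** Formulated for predicates so that facts can be stacked: a / F has zero derivative only where the
    Wronskian vanishes, and [nome_ratio] only where F(x) = a. *)
Definition loc_const (P : C -> Prop) : Prop :=
  forall z, Omega z -> exists d, (0 < d)%R /\
    forall y, (Cmod (y - z)%C < d)%R -> Omega y /\ (P y <-> P z).

(** P persists on a small disc, so f has zero derivative on the whole disc and is constant there. *)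
Lemma loc_const_and P f c : loc_const P ->
  (forall z, Omega z -> P z -> CD f z 0) -> loc_const (fun z => P z /\ f z = c).
Proof.
  intros HP Hf z Hz; destruct (HP z Hz) as (d & Hd & H).
  exists d; split; [exact Hd|]; intros y Hy; destruct (H y Hy) as [Oy Ey].
  split; [exact Oy|].
  assert (E : P z -> f y = f z).
  { intros Pz; apply CD_zero_segment; intros t Ht.
    destruct (H (z + RtoC t * (y - z))) as [Ot Et].
    - replace (z + RtoC t * (y - z) - z) with (RtoC t * (y - z)) by ring.
      rewrite Cmod_mult, Cmod_R, Rabs_pos_eq by apply Ht.
      assert (0 <= Cmod (y - z))%R by apply Cmod_ge_0; nra.
    - apply Hf; [exact Ot|apply Et, Pz]. }
  rewrite Ey; split; intros [Pz Q]; split; try exact Pz.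
  - rewrite <- E; assumption.
  - rewrite E; assumption.
Qed.

Lemma open_of_balls (U : C -> Prop) :
  (forall z, U z -> exists d, (0 < d)%R /\ forall y, (Cmod (y - z)%C < d)%R -> U y) ->
  open U.
Proof.
  intros H z Hz; destruct (H z Hz) as (d & Hd & Hb); apply locally_C.
  exists (mkposreal d Hd); intros y Hy; apply Hb, Hy.
Qed.

Lemma connected_loc_const S P : connected S -> (forall z, S z -> Omega z) ->
  loc_const P -> forall z w, S z -> S w -> P z -> P w.
Proof.
  intros HS HO HP z w Sz Sw Pz.
  destruct (classic (P w)) as [Pw|Nw]; [exact Pw|exfalso].
  destruct (HS (fun y => Omega y /\ P y) (fun y => Omega y /\ ~ P y)) as (y & _ & [_ Q] & [_ NQ]).
  - apply open_of_balls; intros y [Oy Py]; destruct (HP y Oy) as (d & Hd & H).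
    exists d; split; [exact Hd|]; intros y' Hy'; destruct (H y' Hy'); tauto.
  - apply open_of_balls; intros y [Oy Py]; destruct (HP y Oy) as (d & Hd & H).
    exists d; split; [exact Hd|]; intros y' Hy'; destruct (H y' Hy'); tauto.
  - intros y Sy; assert (Oy := HO y Sy); destruct (classic (P y)); tauto.
  - exists z; auto.
  - exists w; auto.
  - exact (NQ Q).
Qed.

Definition at_cusp (f : C -> C) (l : C) : Prop :=
  forall eps, (0 < eps)%R -> exists M, forall z, (M < Im z)%R -> (Cmod (f z - l)%C < eps)%R.

Lemma at_cusp_CD f g z l : CD f z l -> at_cusp g z -> at_cusp (fun t => f (g t)) (f z).
Proof.
  intros Hf Hg eps He; destruct (CD_continuous f z l Hf eps He) as (d & Hd & H).
  destruct (Hg d Hd) as [M HM]; exists M; intros t Ht; apply H, HM, Ht.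
Qed.

Lemma at_cusp_minus f g a b : at_cusp f a -> at_cusp g b -> at_cusp (fun t => f t - g t) (a - b).
Proof.
  intros Hf Hg eps He.
  destruct (Hf (eps / 2)%R ltac:(lra)) as [M1 H1].
  destruct (Hg (eps / 2)%R ltac:(lra)) as [M2 H2].
  exists (Rmax M1 M2); intros t Ht.
  assert (M1 <= Rmax M1 M2)%R by apply Rmax_l; assert (M2 <= Rmax M1 M2)%R by apply Rmax_r.
  specialize (H1 t ltac:(lra)); specialize (H2 t ltac:(lra)).
  replace (f t - g t - (a - b)) with ((f t - a) + - (g t - b)) by ring.
  eapply Rle_lt_trans; [apply Cmod_triangle|]; rewrite Cmod_opp; lra.
Qed.

Lemma at_cusp_mult f g a b : at_cusp f a -> at_cusp g b -> at_cusp (fun t => f t * g t) (a * b).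
Proof.
  intros Hf Hg eps He.
  set (K := (Cmod a + Cmod b + 1)%R).
  assert (Ka := Cmod_ge_0 a); assert (Kb := Cmod_ge_0 b).
  assert (He' : (0 < Rmin 1 (eps / K))%R).
  { apply Rmin_pos; [lra|apply Rdiv_lt_0_compat; unfold K; lra]. }
  destruct (Hf _ He') as [M1 H1]; destruct (Hg _ He') as [M2 H2].
  exists (Rmax M1 M2); intros t Ht.
  assert (M1 <= Rmax M1 M2)%R by apply Rmax_l; assert (M2 <= Rmax M1 M2)%R by apply Rmax_r.
  specialize (H1 t ltac:(lra)); specialize (H2 t ltac:(lra)).
  set (e := Rmin 1 (eps / K)) in *.
  assert (E1 : (e <= 1)%R) by apply Rmin_l.
  assert (E2 : (e * K <= eps)%R).
  { apply Rle_trans with (eps / K * K)%R.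
    - apply Rmult_le_compat_r; [unfold K; lra|apply Rmin_r].
    - right; field; unfold K; lra. }
  replace (f t * g t - a * b) with ((f t - a) * (g t - b) + (a * (g t - b) + (f t - a) * b)) by ring.
  eapply Rle_lt_trans; [apply Cmod_triangle|].
  eapply Rle_lt_trans; [apply Rplus_le_compat_l, Cmod_triangle|].
  rewrite !Cmod_mult.
  assert (P1 := Cmod_ge_0 (f t - a)); assert (P2 := Cmod_ge_0 (g t - b)).
  unfold K in E2; nra.
Qed.

Lemma at_cusp_nome : at_cusp nome 0.
Proof.
  intros eps He; exists (- ln eps / (2 * PI))%R; intros z Hz.
  replace (nome z - 0) with (nome z) by ring; rewrite Cmod_nome.
  rewrite <- (exp_ln eps He) at 1; apply exp_increasing.
  assert (P := PI_RGT_0).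
  apply (Rmult_lt_compat_l (2 * PI)) in Hz; [|lra].
  replace (2 * PI * (- ln eps / (2 * PI)))%R with (- ln eps)%R in Hz by (field; lra).
  lra.
Qed.

Lemma at_cusp_ev s f : good s -> at_cusp f 0 -> at_cusp (fun t => ev s (f t)) (RtoC (s O)).
Proof.
  intros Hs Hf; rewrite <- ev_O by exact Hs.
  apply (at_cusp_CD (ev s) f 0 (ev (fdif s) 0)); [|exact Hf].
  apply CD_ev; [exact Hs|rewrite Cmod_0; lra].
Qed.

Lemma at_cusp_inv f (l : C) : l <> 0 -> at_cusp f l -> at_cusp (fun t => / f t) (/ l).
Proof. intros Hl Hf; apply (at_cusp_CD Cinv f l _ (CD_inv l Hl) Hf). Qed.

Lemma at_cusp_eq f a b : a = b -> at_cusp f a -> at_cusp f b.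
Proof. now intros ->. Qed.

Lemma at_cusp_Xf : at_cusp Xf 0.
Proof.
  assert (Ta := at_cusp_ev fa nome good_fa at_cusp_nome).
  assert (Tc := at_cusp_ev fC nome good_fC at_cusp_nome).
  rewrite fa_O in Ta; rewrite fC_O in Tc.
  assert (N : RtoC 1 * 1 * 1 <> 0) by (repeat apply Cmult_neq_0; exact C1_nz).
  eapply at_cusp_eq; [|exact (at_cusp_mult _ _ _ _ Tc
    (at_cusp_inv _ _ N (at_cusp_mult _ _ _ _ (at_cusp_mult _ _ _ _ Ta Ta) Ta)))].
  ring.
Qed.

(** The property travels from tau towards the cusp along the connected sets in the definition of
    [C_infty], which may vary with the height M. *)
Lemma C_infty_loc_const P tau : C_infty tau -> loc_const P -> P tau ->
  forall M, exists z, Omega z /\ P z /\ (M < Im z)%R.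
Proof.
  intros [_ H] HP Pt M; destruct (H M) as (z & (S & HS & HR & St & Sz) & Hz).
  assert (HO : forall w, S w -> Omega w) by (intros w Sw; apply region_Omega, HR, Sw).
  exists z; repeat split; try (apply HO, Sz); try exact Hz.
  exact (connected_loc_const S P HS HO HP tau z St Sz Pt).
Qed.

(** The value f tau is also taken at points of arbitrarily large height, where f is close to l. *)
Lemma C_infty_limit P f l tau : C_infty tau -> loc_const P -> P tau ->
  (forall z, Omega z -> P z -> CD f z 0) -> at_cusp f l -> f tau = l.
Proof.
  intros Ht HP Pt Hf Hl.
  assert (HL := C_infty_loc_const _ tau Ht (loc_const_and P f (f tau) HP Hf) (conj Pt eq_refl)).
  destruct (classic (f tau = l)) as [E|N]; [exact E|exfalso].
  assert (Hm : (0 < Cmod (f tau - l))%R).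
  { apply (proj1 (Cmod_gt_0 _)); intros E; apply N.
    transitivity (f tau - l + l); [ring|rewrite E; ring]. }
  destruct (Hl _ Hm) as [M HM]; destruct (HL M) as (z & _ & [_ Ez] & Hz).
  specialize (HM z Hz); rewrite Ez in HM; lra.
Qed.

(** * The second order equation common to a and F *)

Lemma fD_fD_fa : (fz 144 * fD (fD fa) =
  (fa * (fz 3 * (fa * fa) + fP) - fz 4 * fB) * (fz 9 * (fa * fa) + fP)
  + fa * (fP * fP - (fz 9 * (fa * fa * (fa * fa)) - fz 8 * (fa * fB)))
  - fz 12 * (fB * (fP - fa * fa)))%fps.
Proof.
  assert (H : (fz 144 * fD (fD fa) = fz 12 * fD (fz 12 * fD fa))%fps)
    by (rewrite fD_fz; ring).
  rewrite H, fD_fa, fD_sub, fD_fz, fD_mul, fD_add, fD_fz, fD_mul, <- fQ_eq, <- fD_fP, <- fD_fB,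
    <- fD_fa; ring.
Qed.

Lemma ev_fD_fD_fa q : (Cmod q < 1)%R ->
  let a := ev fa q in let p := ev fP q in let b := ev fB q in
  144 * ev (fD (fD fa)) q = (a * (3 * (a * a) + p) - 4 * b) * (9 * (a * a) + p)
    + a * (p * p - (9 * (a * a * (a * a)) - 8 * (a * b))) - 12 * (b * (p - a * a)).
Proof.
  intros Hq a p b; evaluate H fD_fD_fa q; exact H.
Qed.

Lemma ev_fB_Xf tau : Omega tau ->
  ev fB (nome tau) = ev fa (nome tau) ^ 3 * (1 - Xf tau).
Proof.
  intros (Hi & Ha & _); unfold Xf; rewrite ev_fC_eq by (now apply nome_lt_1).
  field; exact Ha.
Qed.

Lemma ev_fQ_Xf tau : Omega tau ->
  ev fQ (nome tau) = ev fa (nome tau) ^ 4 * (1 + 8 * Xf tau).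
Proof.
  intros HO; assert (Hq := nome_lt_1 tau (proj1 HO)).
  evaluate H fQ_eq (nome tau); rewrite H, ev_fB_Xf by exact HO; ring.
Qed.

Lemma ev_fR_Xf tau : Omega tau -> ev fR (nome tau) =
  ev fa (nome tau) ^ 6 * (1 - 20 * Xf tau - 8 * (Xf tau * Xf tau)).
Proof.
  intros HO; assert (Hq := nome_lt_1 tau (proj1 HO)).
  evaluate H fR_eq (nome tau); rewrite H, ev_fB_Xf by exact HO; ring.
Qed.

Lemma CD_ev_Xf s tau : good s -> Omega tau ->
  CD (fun t => ev s (Xf t)) tau
    (tpi * ((1 - Xf tau) * (ev fa (nome tau) * ev fa (nome tau)) * ev (fD s) (Xf tau))).
Proof.
  intros Hs (Hi & Ha & Hx).
  eapply CD_eq; [|apply (CD_comp (ev s) Xf); [apply CD_ev; assumption|apply CD_Xf; assumption]].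
  rewrite <- ev_dif_mul by assumption; ring.
Qed.

(** x (1 - x) dF/dx, the quantity differentiated in the self-adjoint form of the equation; a
    Wronskian built on it is constant without a weight factor. *)
Definition fH1 : fps := ((1 - fX 1) * fD fH)%fps.

Lemma good_fH1 : good fH1.
Proof. apply good_mul; [exact good_one_sub_fX|exact (good_D _ good_fH)]. Qed.

Lemma ev_fD_fH z : (Cmod z < 1)%R -> ev fH1 z = (1 - z) * ev (fD fH) z.
Proof.
  intros Hz; unfold fH1; rewrite ev_mul, ev_one_sub_fX
    by first [exact Hz|exact good_one_sub_fX|exact (good_D _ good_fH)]; reflexivity.
Qed.

Lemma ev_fD_fH1 z : (Cmod z < 1)%R -> 9 * ev (fD fH1) z = 2 * (z * ev fH z).
Proof.
  intros Hz; unfold fH1; rewrite fH_ode.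
  assert (G := good_mul _ _ (good_fX 1) good_fH).
  rewrite ev_scal, ev_mul, ev_fX by first [exact Hz|exact G|exact good_fH|apply good_fX].
  rewrite RtoC_div by lra; cbn [Cpow]; field.
Qed.

(* a(q) and F(x) solve the same second order equation in x. *)
Definition wronskian (t : C) : C :=
  ev fa (nome t) * ev fH1 (Xf t)
  - ev (fD fa) (nome t) * / (ev fa (nome t) * ev fa (nome t)) * ev fH (Xf t).

(** Since q d/dq = x (1 - x) a^2 d/dx, the quotient of q da/dq by a^2 is x (1 - x) da/dx, the
    counterpart of [fH1]. The second derivative of a comes from differentiating [fD_fa]. *)
Lemma CD_wronskian tau : Omega tau -> CD wronskian tau 0.
Proof.
  intros HO; assert (HO' := HO); destruct HO' as (Hi & Ha & Hx).
  assert (Hq := nome_lt_1 tau Hi).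
  assert (DA := CD_ev_nome fa tau good_fa Hi).
  assert (DN := CD_ev_nome (fD fa) tau (good_D _ good_fa) Hi).
  assert (DG := CD_ev_Xf fH tau good_fH HO).
  assert (DG1 := CD_ev_Xf fH1 tau good_fH1 HO).
  assert (N2 : ev fa (nome tau) * ev fa (nome tau) <> 0) by (apply Cmult_neq_0; exact Ha).
  assert (DI := CD_comp Cinv (fun t => ev fa (nome t) * ev fa (nome t)) tau _ _
    (CD_inv _ N2) (CD_mult _ _ _ _ _ DA DA)).
  eapply CD_eq; [|exact (CD_minus _ _ _ _ _ (CD_mult _ _ _ _ _ DA DG1)
    (CD_mult _ _ _ _ _ (CD_mult _ _ _ _ _ DN DI) DG))].
  assert (E1 := ev_fD_fa _ Hq); assert (E2 := ev_fD_fD_fa _ Hq); cbv zeta in E2.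
  assert (E3 := ev_fC_eq _ Hq); assert (E4 := ev_fD_fH _ Hx); assert (E5 := ev_fD_fH1 _ Hx).
  cbv beta; assert (EX : Xf tau = ev fC (nome tau) /
    (ev fa (nome tau) * ev fa (nome tau) * ev fa (nome tau))) by reflexivity.
  set (a := ev fa (nome tau)) in *; set (c := ev fC (nome tau)) in *.
  set (b := ev fB (nome tau)) in *; set (p := ev fP (nome tau)) in *.
  set (da := ev (fD fa) (nome tau)) in *; set (dda := ev (fD (fD fa)) (nome tau)) in *.
  set (x := Xf tau) in *.
  set (g := ev fH x) in *; set (g1 := ev fH1 x) in *; set (dg := ev (fD fH) x) in *.
  set (dg1 := ev (fD fH1) x) in *.
  assert (E1' : da = (a * (3 * (a * a) + p) - 4 * b) / 12) by (rewrite <- E1; field).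
  assert (E2' : dda = ((a * (3 * (a * a) + p) - 4 * b) * (9 * (a * a) + p)
    + a * (p * p - (9 * (a * a * (a * a)) - 8 * (a * b))) - 12 * (b * (p - a * a))) / 144)
    by (rewrite <- E2; field).
  assert (E5' : dg1 = 2 / 9 * (x * g)).
  { transitivity (9 * dg1 / 9); [field|rewrite E5; field]. }
  replace ((1 - x) * (a * a) * dg) with (a * a * ((1 - x) * dg)) by ring.
  rewrite <- E4, E5', E2', E1', EX, E3; field; exact Ha.
Qed.

(** Each term contains an Euler derivative, whose series has no constant term. *)
Lemma at_cusp_wronskian : at_cusp wronskian 0.
Proof.
  assert (Ta := at_cusp_ev fa nome good_fa at_cusp_nome); rewrite fa_O in Ta.
  assert (Td := at_cusp_ev (fD fa) nome (good_D _ good_fa) at_cusp_nome).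
  replace (fD fa O) with 0%R in Td by (unfold fD; simpl; ring).
  assert (Tg := at_cusp_ev fH Xf good_fH at_cusp_Xf).
  assert (Tg1 := at_cusp_ev fH1 Xf good_fH1 at_cusp_Xf).
  replace (fH1 O) with 0%R in Tg1 by
    (change (0 = (1 - fX 1)%fps O * (INR 0 * fH O))%R; simpl; ring).
  eapply at_cusp_eq; [|exact (at_cusp_minus _ _ _ _ (at_cusp_mult _ _ _ _ Ta Tg1)
    (at_cusp_mult _ _ _ _ (at_cusp_mult _ _ _ _ Td
      (at_cusp_inv _ (1 * 1) (Cmult_neq_0 _ _ C1_nz C1_nz) (at_cusp_mult _ _ _ _ Ta Ta))) Tg))].
  ring.
Qed.

Lemma loc_const_True : loc_const (fun _ => True).
Proof.
  intros z Hz; destruct (Omega_open z Hz) as (d & Hd & H); exists d; split; [exact Hd|].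
  intros y Hy; split; [exact (H y Hy)|tauto].
Qed.

Definition wronskian_zero (t : C) := True /\ wronskian t = 0.

Lemma loc_const_wronskian_zero : loc_const wronskian_zero.
Proof. apply loc_const_and; [exact loc_const_True|]; intros z Hz _; now apply CD_wronskian. Qed.

Lemma wronskian_eq_0 tau : C_infty tau -> wronskian tau = 0.
Proof.
  intros H; apply (C_infty_limit _ wronskian 0 tau H loc_const_True I);
    [|exact at_cusp_wronskian].
  intros z Hz _; now apply CD_wronskian.
Qed.

Definition theta_ratio (t : C) : C := ev fa (nome t) * / ev fH (Xf t).

Lemma CD_theta_ratio tau : Omega tau -> wronskian_zero tau -> CD theta_ratio tau 0.
Proof.
  intros HO [_ HW]; assert (HO' := HO); destruct HO' as (Hi & Ha & Hx).
  assert (Hg := ev_fH_neq_0 _ Hx).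
  assert (DA := CD_ev_nome fa tau good_fa Hi).
  assert (DG := CD_ev_Xf fH tau good_fH HO).
  assert (DI := CD_comp Cinv (fun t => ev fH (Xf t)) tau _ _ (CD_inv _ Hg) DG).
  eapply CD_eq; [|exact (CD_mult _ _ _ _ _ DA DI)].
  cbv beta; assert (E4 := ev_fD_fH _ Hx); unfold wronskian in HW.
  set (a := ev fa (nome tau)) in *; set (da := ev (fD fa) (nome tau)) in *.
  set (x := Xf tau) in *.
  set (g := ev fH x) in *; set (g1 := ev fH1 x) in *; set (dg := ev (fD fH) x) in *.
  (* The derivative of a / F is a multiple of the Wronskian. *)
  transitivity (- (tpi * (a * a / (g * g)) * (a * g1 - da * / (a * a) * g))).
  - rewrite E4; field; auto.
  - rewrite HW; ring.
Qed.

Lemma theta_ratio_eq_1 tau : C_infty tau -> theta_ratio tau = 1.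
Proof.
  intros H; apply (C_infty_limit wronskian_zero theta_ratio 1 tau H loc_const_wronskian_zero).
  - split; [exact I|now apply wronskian_eq_0].
  - exact CD_theta_ratio.
  - assert (Ta := at_cusp_ev fa nome good_fa at_cusp_nome); rewrite fa_O in Ta.
    assert (Tg := at_cusp_ev fH Xf good_fH at_cusp_Xf).
    change (fH O) with 1%R in Tg.
    eapply at_cusp_eq; [|exact (at_cusp_mult _ _ _ _ Ta (at_cusp_inv _ 1 C1_nz Tg))].
    field.
Qed.

Definition F_is_theta (t : C) := wronskian_zero t /\ theta_ratio t = 1.

Lemma loc_const_F_is_theta : loc_const F_is_theta.
Proof. apply loc_const_and; [exact loc_const_wronskian_zero|exact CD_theta_ratio]. Qed.

Lemma C_infty_F_is_theta tau : C_infty tau -> F_is_theta tau.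
Proof.
  intros H; split; [split; [exact I|now apply wronskian_eq_0]|now apply theta_ratio_eq_1].
Qed.

Lemma C_infty_Omega tau : C_infty tau -> Omega tau.
Proof. intros [H _]; now apply region_Omega. Qed.

Lemma F_is_theta_eq tau : Omega tau -> F_is_theta tau -> ev fH (Xf tau) = ev fa (nome tau).
Proof.
  intros (_ & _ & Hx) [_ H]; unfold theta_ratio in H.
  assert (Hg := ev_fH_neq_0 _ Hx).
  transitivity (ev fa (nome tau) * / ev fH (Xf tau) * ev fH (Xf tau)); [rewrite H; ring|].
  field; exact Hg.
Qed.

(** * The nome as a function of x *)

Definition nome_ratio (t : C) : C := Xf t * Cexp (ev fh (Xf t)) * Cexp (- (tpi * t)).

(** The logarithmic derivative of x exp(h(x)) is dx / (x (1 - x) F^2), which F(x) = a turns into 2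
    pi i dtau. *)
Lemma CD_nome_ratio tau : Omega tau -> F_is_theta tau -> CD nome_ratio tau 0.
Proof.
  intros HO HP; assert (HO' := HO); destruct HO' as (Hi & Ha & Hx).
  assert (HF := F_is_theta_eq tau HO HP).
  assert (DX := CD_Xf tau Hi Ha).
  assert (DH := CD_comp Cexp (fun t => ev fh (Xf t)) tau _ _ (CD_exp _) (CD_ev_Xf fh tau good_fh HO)).
  assert (DT : CD (fun t => - (tpi * t)) tau (- tpi)).
  { apply (CD_ext (fun t => (- tpi) * t)); [intros; ring|].
    eapply CD_eq; [|apply CD_scal, CD_id]; ring. }
  assert (DE := CD_comp Cexp (fun t => - (tpi * t)) tau _ _ (CD_exp _) DT).
  eapply CD_eq; [|exact (CD_mult _ _ _ _ _ (CD_mult _ _ _ _ _ DX DH) DE)].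
  cbv beta; assert (E := ev_fD_fh _ Hx); rewrite HF in E.
  set (a := ev fa (nome tau)) in *; set (x := Xf tau) in *.
  set (e1 := Cexp (ev fh x)); set (e2 := Cexp (- (tpi * tau))).
  transitivity (tpi * x * e1 * e2 * ((ev (fD fh) x + 1) * ((1 - x) * (a * a)) - 1)).
  - ring.
  - rewrite E; ring.
Qed.

Lemma at_cusp_ext_pos f g l : (forall z, (0 < Im z)%R -> f z = g z) -> at_cusp f l -> at_cusp g l.
Proof.
  intros H Hf eps He; destruct (Hf eps He) as [M HM]; exists (Rmax 0 M); intros z Hz.
  assert (0 <= Rmax 0 M)%R by apply Rmax_l; assert (M <= Rmax 0 M)%R by apply Rmax_r.
  rewrite <- H by lra; apply HM; lra.
Qed.

(** The factor q of [fC] cancels the factor 1 / q, and what is left tends to the leading coefficient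
    27. *)
Lemma at_cusp_nome_ratio : at_cusp nome_ratio 27.
Proof.
  assert (Ta := at_cusp_ev fa nome good_fa at_cusp_nome); rewrite fa_O in Ta.
  assert (Tt := at_cusp_ev (ftail fC) nome (good_tail _ good_fC) at_cusp_nome).
  change (ftail fC O) with (fC 1%nat) in Tt; rewrite fC_1 in Tt.
  assert (Th := at_cusp_ev fh Xf good_fh at_cusp_Xf).
  replace (fh O) with 0%R in Th by (symmetry; apply fint_O, fh_arg_O).
  assert (Te := at_cusp_CD Cexp _ 0 _ (CD_exp 0) Th); rewrite Cexp_0 in Te.
  assert (T3 := at_cusp_mult _ _ _ _ (at_cusp_mult _ _ _ _ Ta Ta) Ta).
  assert (N : RtoC 1 * 1 * 1 <> 0) by (repeat apply Cmult_neq_0; exact C1_nz).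
  apply (at_cusp_ext_pos (fun t => ev (ftail fC) (nome t)
    * / (ev fa (nome t) * ev fa (nome t) * ev fa (nome t)) * Cexp (ev fh (Xf t)))).
  - intros z Hz; unfold nome_ratio; unfold Xf at 2.
    rewrite (ev_tail fC) by (try apply good_fC; now apply nome_lt_1).
    rewrite fC_O, nome_eq, Cexp_opp; unfold Cdiv.
    assert (Ne := Cexp_neq_0 (tpi * z)).
    set (i3 := / (ev fa (Cexp (tpi * z)) * ev fa (Cexp (tpi * z)) * ev fa (Cexp (tpi * z)))).
    field; exact Ne.
  - eapply at_cusp_eq; [|exact (at_cusp_mult _ _ _ _ (at_cusp_mult _ _ _ _ Tt (at_cusp_inv _ _ N T3)) Te)].
    field.
Qed.

Lemma nome_ratio_eq tau : C_infty tau -> nome_ratio tau = 27.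
Proof.
  intros H; apply (C_infty_limit F_is_theta nome_ratio 27 tau H loc_const_F_is_theta (C_infty_F_is_theta tau H)
    CD_nome_ratio at_cusp_nome_ratio).
Qed.

(** * Zeros of E4 and E6 *)

Section RamanujanUniqueness.
Local Open Scope R_scope.

(** Ramanujan's equations along e^(-s), where d/ds = - q d/dq, hence the signs; v is s up to a
    translation. *)
Definition ramanujan_solution (V : R) (p q r : R -> R) : Prop :=
  forall v, 0 <= v <= V ->
    is_derive p v (- (p v * p v - q v) / 12) /\
    is_derive q v (- (p v * q v - r v) / 3) /\
    is_derive r v (- (p v * r v - q v * q v) / 2).

Lemma is_derive_continuity_pt (f : R -> R) (x l : R) :
  is_derive f x l -> continuity_pt f x.
Proof.
  intros H; apply derivable_continuous_pt; exists l; now apply is_derive_Reals.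
Qed.

(** E exp(-K v) is nonincreasing, nonnegative and starts at 0. *)
Lemma gronwall_zero (E E' : R -> R) V K :
  (forall v, 0 <= v <= V -> is_derive E v (E' v)) ->
  (forall v, 0 <= v <= V -> E' v <= K * E v) ->
  (forall v, 0 <= E v) -> E 0 = 0 -> forall v, 0 <= v <= V -> E v = 0.
Proof.
  intros HD HK Hp H0 v Hv.
  destruct (Req_dec v 0) as [->|Nv]; [exact H0|].
  set (G := fun t => E t * exp (- K * t)).
  set (G' := fun t => E' t * exp (- K * t) + E t * (- K * exp (- K * t))).
  assert (HG : forall t, 0 <= t <= V -> is_derive G t (G' t)).
  { intros t Ht; assert (D := HD t Ht); unfold G, G'.
    apply (is_derive_mult (K := R_AbsRing) E (fun t => exp (- K * t)) t); [exact D| |exact Rmult_comm].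
    auto_derive; [exact I|ring]. }
  destruct (MVT_gen G 0 v G') as (c & Hc & Ec).
  - intros t Ht; rewrite Rmin_left, Rmax_right in Ht by lra; apply HG; lra.
  - intros t Ht; rewrite Rmin_left, Rmax_right in Ht by lra.
    apply (is_derive_continuity_pt G t (G' t)), HG; lra.
  - rewrite Rmin_left, Rmax_right in Hc by lra.
    assert (HK' := HK c ltac:(lra)); assert (P := exp_pos (- K * c)).
    assert (G' c <= 0) by (unfold G'; nra).
    assert (G v <= 0).
    { unfold G in Ec at 2; rewrite H0 in Ec; nra. }
    unfold G in H1; assert (P2 := exp_pos (- K * v)); assert (Q := Hp v); nra.
Qed.

Lemma ramanujan_unique V p q r p' q' r' :
  ramanujan_solution V p q r -> ramanujan_solution V p' q' r' ->
  p 0 = p' 0 -> q 0 = q' 0 -> r 0 = r' 0 ->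
  forall v, 0 <= v <= V -> q v = q' v.
Proof.
  intros H H' Ep Eq Er v Hv.
  (* The extra 1 lets x^2 + 1 <= M imply |x| <= M and gives M >= 1, so one constant bounds both
     linear and quadratic coefficients. *)
  set (S := fun t => p t * p t + q t * q t + r t * r t
    + (p' t * p' t + q' t * q' t + r' t * r' t) + 1).
  assert (HM : exists M, forall t, 0 <= t <= V -> S t <= M).
  { destruct (continuity_ab_maj S 0 V) as (m & Hm & _).
    - lra.
    - intros t Ht; destruct (H t Ht) as (A & B & C); destruct (H' t Ht) as (A' & B' & C').
      apply is_derive_continuity_pt in A, B, C, A', B', C'.
      unfold S; repeat apply continuity_pt_plus; try (apply continuity_pt_mult; assumption).
      apply continuity_pt_const; intros ? ?; reflexivity.
    - exists (S m); exact Hm. }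
  destruct HM as [M HM].
  set (E := fun t => (p t - p' t) * (p t - p' t) + (q t - q' t) * (q t - q' t)
     + (r t - r' t) * (r t - r' t)).
  set (E' := fun t =>
    2 * (p t - p' t) * (- (p t * p t - q t) / 12 - - (p' t * p' t - q' t) / 12)
    + 2 * (q t - q' t) * (- (p t * q t - r t) / 3 - - (p' t * q' t - r' t) / 3)
    + 2 * (r t - r' t) * (- (p t * r t - q t * q t) / 2 - - (p' t * r' t - q' t * q' t) / 2)).
  assert (HE : E v = 0).
  { apply (gronwall_zero E E' V (20 * M)); try exact Hv.
    - intros t Ht; destruct (H t Ht) as (A & B & C); destruct (H' t Ht) as (A' & B' & C').
      assert (D2 : forall f f' l l', is_derive f t l -> is_derive f' t l' ->
        is_derive (fun t => (f t - f' t) * (f t - f' t)) t (2 * (f t - f' t) * (l - l'))).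
      { intros f f' l l' Hf Hf'.
        assert (Hd := is_derive_minus (V := R_NormedModule) f f' t l l' Hf Hf').
        evar_last; [exact (is_derive_mult (K := R_AbsRing) _ _ t _ _ Hd Hd Rmult_comm)|].
        unfold minus, plus, opp, mult; simpl; ring. }
      exact (is_derive_plus (V := R_NormedModule) _ _ t _ _
        (is_derive_plus (V := R_NormedModule) _ _ t _ _ (D2 p p' _ _ A A') (D2 q q' _ _ B B'))
        (D2 r r' _ _ C C')).
    - intros t Ht; assert (B := HM t Ht); unfold S in B; unfold E', E.
      generalize dependent (p t); generalize dependent (q t); generalize dependent (r t).
      generalize dependent (p' t); generalize dependent (q' t); generalize dependent (r' t).
      clear; intros c' b' a' c b a B.
      assert (Bd : forall x, x * x + 1 <= M -> - M <= x <= M) by (intros; nra).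
      assert (Ba : - M <= a <= M) by (apply Bd; nra).
      assert (Bb : - M <= b <= M) by (apply Bd; nra).
      assert (Ba' : - M <= a' <= M) by (apply Bd; nra).
      assert (Bb' : - M <= b' <= M) by (apply Bd; nra).
      assert (Bc' : - M <= c' <= M) by (apply Bd; nra).
      assert (M1 : 1 <= M) by nra.
      set (x := a - a'); set (y := b - b'); set (z := c - c').
      replace (- (a * a - b) / 12 - - (a' * a' - b') / 12) with ((y - (a + a') * x) / 12)
        by (unfold x, y; field).
      replace (- (a * b - c) / 3 - - (a' * b' - c') / 3) with ((z - a * y - b' * x) / 3)
        by (unfold x, y, z; field).
      replace (- (a * c - b * b) / 2 - - (a' * c' - b' * b') / 2)
        with (((b + b') * y - a * z - c' * x) / 2) by (unfold x, y, z; field).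
      set (T := x * x + y * y + z * z).
      assert (X1 : x * x <= T) by (unfold T; nra).
      assert (Y1 : y * y <= T) by (unfold T; nra).
      assert (Z1 : z * z <= T) by (unfold T; nra).
      (* By 2 |s t| <= s^2 + t^2, every product costs at most 2 M T. *)
      assert (P : forall k s t, - (2 * M) <= k <= 2 * M -> s * s <= T -> t * t <= T ->
        k * (s * t) <= 2 * M * T).
      { intros k s t Hk Hs Ht.
        assert (Q1 := Rle_0_sqr (s - t)); assert (Q2 := Rle_0_sqr (s + t)).
        unfold Rsqr in Q1, Q2.
        eapply Rle_trans; [apply Rle_abs|]; rewrite Rabs_mult.
        apply Rmult_le_compat; try apply Rabs_pos; apply Rabs_le; lra. }
      assert (T1 := P 1 x y ltac:(lra) X1 Y1).
      assert (T2 := P (- (a + a')) x x ltac:(lra) X1 X1).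
      assert (T3 := P 1 y z ltac:(lra) Y1 Z1).
      assert (T4 := P (- a) y y ltac:(lra) Y1 Y1).
      assert (T5 := P (- b') x y ltac:(lra) X1 Y1).
      assert (T6 := P (b + b') y z ltac:(lra) Y1 Z1).
      assert (T7 := P (- a) z z ltac:(lra) Z1 Z1).
      assert (T8 := P (- c') x z ltac:(lra) X1 Z1).
      assert (0 <= M * T) by (apply Rmult_le_pos; unfold T; nra).
      replace (20 * M * T) with (20 * (M * T)) by ring.
      replace (2 * x * ((y - (a + a') * x) / 12) + 2 * y * ((z - a * y - b' * x) / 3)
        + 2 * z * (((b + b') * y - a * z - c' * x) / 2))
      with ((1 * (x * y) + (- (a + a')) * (x * x)) / 6
        + 2 * (1 * (y * z) + (- a) * (y * y) + (- b') * (x * y)) / 3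
        + ((b + b') * (y * z) + (- a) * (z * z) + (- c') * (x * z))) by field.
      lra.
    - intros t; unfold E; assert (Q1 := Rle_0_sqr (p t - p' t)).
      assert (Q2 := Rle_0_sqr (q t - q' t)); assert (Q3 := Rle_0_sqr (r t - r' t)).
      unfold Rsqr in Q1, Q2, Q3; lra.
    - unfold E; rewrite Ep, Eq, Er; ring. }
  unfold E in HE.
  assert (Q1 := Rle_0_sqr (p v - p' v)); assert (Q2 := Rle_0_sqr (q v - q' v)).
  assert (Q3 := Rle_0_sqr (r v - r' v)); unfold Rsqr in Q1, Q2, Q3.
  apply Rminus_diag_uniq, Rsqr_0_uniq; unfold Rsqr; lra.
Qed.

(* A solution on (0, oo) with R s0 = 0 coincides with its image under the
   involution s = s0 + v |-> s0 - v / (1 + k v), where k = p s0 / 6.  As Q >= 1 and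
   Q s >= 1 / s, the involution must map oo to 0, that is k = 1 / s0. *)
Lemma ramanujan_reflection (p q r : R -> R) s0 :
  (forall s, 0 < s -> is_derive p s (- (p s * p s - q s) / 12) /\
    is_derive q s (- (p s * q s - r s) / 3) /\
    is_derive r s (- (p s * r s - q s * q s) / 2)) ->
  (forall s, 0 < s -> 1 <= q s) -> (forall s, 0 < s -> 1 <= s * q s) ->
  0 < s0 -> r s0 = 0 -> p s0 * s0 = 6.
Proof.
  intros H Hq1 Hq2 Hs0 Hr.
  set (k := p s0 / 6).
  set (g := fun v => 1 + k * v).
  set (sg := fun v => s0 - v / g v).
  (* The image triple has weights 2, 4, 6 in g, signs because [sg] is decreasing, and the correction
     12 k / g for the quasimodular p. At v = 0 both solutions agree: r s0 = 0 absorbs the sign of r,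
     and k = p s0 / 6 gives - p s0 + 12 k = p s0. *)
  assert (Key : forall V, 0 <= V -> (forall v, 0 <= v <= V -> 0 < g v /\ 0 < sg v) ->
    q (s0 + V) * g V ^ 4 = q (sg V)).
  { intros V HV Hg.
    assert (E : q (s0 + V) = q (sg V) / g V ^ 4).
    { apply (ramanujan_unique V (fun v => p (s0 + v)) (fun v => q (s0 + v)) (fun v => r (s0 + v))
        (fun v => - p (sg v) / g v ^ 2 + 12 * k / g v) (fun v => q (sg v) / g v ^ 4)
        (fun v => - r (sg v) / g v ^ 6)).
      - intros v Hv; destruct (H (s0 + v) ltac:(lra)) as (A & B & C).
        assert (Dv : is_derive (fun v => s0 + v) v 1) by (auto_derive; [exact I|ring]).
        assert (Sh : forall (f : R -> R) (l : R), is_derive f (s0 + v) l ->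
          is_derive (fun v => f (s0 + v)) v l).
        { intros f l Hf; evar_last; [exact (is_derive_comp f (fun v => s0 + v) v _ _ Hf Dv)|].
          apply Rmult_1_l. }
        split; [|split]; apply Sh; assumption.
      - intros v Hv; destruct (Hg v Hv) as [Gp Sp].
        destruct (H (sg v) Sp) as (A & B & C).
        assert (Dg : is_derive g v k) by (unfold g; auto_derive; [exact I|ring]).
        assert (Dsg : is_derive sg v (- / (g v * g v))).
        { unfold sg, g; auto_derive; [unfold g in Gp; lra|]. unfold g in *; field; lra. }
        assert (A' := is_derive_comp p sg v _ _ A Dsg).
        assert (B' := is_derive_comp q sg v _ _ B Dsg).
        assert (C' := is_derive_comp r sg v _ _ C Dsg).
        assert (Quot : forall f l n, is_derive f v l ->
          is_derive (fun v => f v / g v ^ n) v (l / g v ^ n - INR n * k * f v / g v ^ (S n))).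
        { intros f l n Df.
          assert (Dn : is_derive (fun v => / g v ^ n) v (- (INR n * k * g v ^ pred n) / (g v ^ n) ^ 2)).
          { apply is_derive_inv; [|apply pow_nonzero; lra].
            apply (is_derive_pow g n v k Dg). }
          evar_last; [exact (is_derive_mult (K := R_AbsRing) f _ v _ _ Df Dn Rmult_comm)|].
          unfold plus, mult; simpl.
          destruct n as [|n]; [simpl; field; lra|].
          rewrite Nat.pred_succ; simpl pow; field.
          assert (0 < g v ^ n) by (apply pow_lt; lra); split; lra. }
        unfold scal in A', B', C'; simpl in A', B', C'; unfold mult in A', B', C'; simpl in A', B', C'.
        split; [|split].
        + assert (D1 := is_derive_opp (V := R_NormedModule) _ _ _ A').
          apply (Quot _ _ 2%nat) in D1.
          assert (D2 := Quot _ _ 1%nat (is_derive_const (V := R_NormedModule) (12 * k) v)).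
          assert (D := is_derive_plus (V := R_NormedModule) _ _ _ _ _ D1 D2).
          apply (is_derive_ext (V := R_NormedModule) _
            (fun v => - p (sg v) / g v ^ 2 + 12 * k / g v)) in D.
          2:{ intros t; unfold plus, opp; simpl; rewrite Rmult_1_r; reflexivity. }
          evar_last; [exact D|].
          unfold plus, opp, zero; simpl; field; lra.
        + evar_last; [exact (Quot _ _ 4%nat B')|]; simpl; field; lra.
        + assert (D1 := is_derive_opp (V := R_NormedModule) _ _ _ C').
          apply (Quot _ _ 6%nat) in D1.
          evar_last; [exact D1|].
          unfold opp; simpl; field; lra.
      - unfold sg, g; rewrite Rmult_0_r, !Rplus_0_r; unfold Rdiv.
        rewrite Rmult_0_l, Rminus_0_r, pow1, Rinv_1; unfold k; field.
      - unfold sg, g; rewrite Rmult_0_r, !Rplus_0_r; unfold Rdiv.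
        rewrite Rmult_0_l, Rminus_0_r, pow1, Rinv_1; ring.
      - unfold sg, g; rewrite Rmult_0_r, !Rplus_0_r; unfold Rdiv.
        rewrite Rmult_0_l, Rminus_0_r, pow1, Rinv_1, Hr; ring.
      - lra. }
    destruct (Hg V ltac:(lra)) as [Gp _]; rewrite E; field; lra. }
  assert (Cq : forall s, 0 < s -> continuity_pt q s).
  { intros s Hs; destruct (H s Hs) as (_ & B & _); exact (is_derive_continuity_pt _ _ _ B). }
  destruct (Rtotal_order (k * s0) 1) as [Hk|[Hk|Hk]].
  - exfalso.
    (* [sg] would reach 0 at the finite time v1: there q (sg v) must blow up at least like 1 / sg v,
       while q (s0 + v) g^3 stays bounded. *)
    set (v1 := s0 / (1 - k * s0)).
    assert (Hv1 : 0 < v1) by (apply Rdiv_lt_0_compat; lra).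
    assert (Ev1 : v1 * (1 - k * s0) = s0) by (unfold v1; field; lra).
    assert (Gp : forall v, 0 <= v <= v1 -> 0 < g v).
    { intros v Hv; unfold g.
      destruct (Rle_dec 0 k); [nra|].
      assert (0 < 1 + k * v1).
      { apply (Rmult_lt_reg_r (1 - k * s0)); [lra|].
        replace ((1 + k * v1) * (1 - k * s0)) with (1 - k * s0 + k * (v1 * (1 - k * s0))) by ring.
        rewrite Ev1; lra. }
      nra. }
    assert (Sp : forall v, 0 <= v <= v1 -> sg v * g v = (v1 - v) * (1 - k * s0)).
    { intros v Hv; specialize (Gp v Hv); unfold sg.
      transitivity (s0 * g v - v); [field; lra|].
      unfold g; rewrite <- Ev1 at 1.
      replace ((v1 - v) * (1 - k * s0)) with (v1 * (1 - k * s0) - v * (1 - k * s0)) by ring.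
      rewrite Ev1; ring. }
    destruct (continuity_ab_maj (fun v => q (s0 + v) * (g v * g v * g v)) 0 v1) as (m & Hm & Hm').
    + lra.
    + intros c Hc.
      assert (Cg : continuity_pt g c).
      { apply (is_derive_continuity_pt g c k); unfold g; auto_derive; [exact I|ring]. }
      apply continuity_pt_mult; [|repeat apply continuity_pt_mult; exact Cg].
      apply (continuity_pt_comp (fun v => s0 + v) q c).
      * apply (is_derive_continuity_pt _ c 1); auto_derive; [exact I|ring].
      * apply Cq; lra.
    + set (M := q (s0 + m) * (g m * g m * g m)) in *.
      assert (HM : 0 < M).
      { assert (G := Gp m Hm'); assert (Q := Hq1 (s0 + m) ltac:(lra)).
        unfold M; apply Rmult_lt_0_compat; [lra|repeat apply Rmult_lt_0_compat; lra]. }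
      (* So close to v1 that sg v * q (sg v) would be at most 1/2. *)
      set (w := Rmin v1 (/ (2 * M * (1 - k * s0)))).
      assert (HD : 0 < 2 * M * (1 - k * s0)) by (apply Rmult_lt_0_compat; lra).
      assert (Hw : 0 < w).
      { apply Rmin_pos; [exact Hv1|apply Rinv_0_lt_compat; exact HD]. }
      assert (Hw1 : w <= v1) by apply Rmin_l.
      assert (Hw2 : w * (2 * M * (1 - k * s0)) <= 1).
      { apply Rle_trans with (/ (2 * M * (1 - k * s0)) * (2 * M * (1 - k * s0))).
        - apply Rmult_le_compat_r; [lra|apply Rmin_r].
        - right; field; lra. }
      set (v := v1 - w).
      assert (Hv : 0 <= v <= v1) by (unfold v; lra).
      assert (Gv := Gp v Hv); assert (Sv := Sp v Hv).
      assert (Sg0 : forall t, 0 <= t <= v -> 0 < sg t).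
      { intros t Ht; assert (G := Gp t ltac:(lra)); assert (S := Sp t ltac:(lra)).
        assert (0 < (v1 - t) * (1 - k * s0)) by (apply Rmult_lt_0_compat; unfold v in Ht; lra).
        apply (Rmult_lt_reg_r (g t)); [exact G|]; rewrite S; lra. }
      assert (K := Key v (proj1 Hv) (fun t Ht => conj (Gp t (conj (proj1 Ht)
        (Rle_trans _ _ _ (proj2 Ht) (proj2 Hv)))) (Sg0 t Ht))).
      assert (B := Hq2 (sg v) (Sg0 v (conj (proj1 Hv) (Rle_refl v)))).
      rewrite <- K in B.
      replace (sg v * (q (s0 + v) * g v ^ 4)) with
        ((sg v * g v) * (q (s0 + v) * (g v * g v * g v))) in B by ring.
      rewrite Sv in B; replace (v1 - v) with w in B by (unfold v; ring).
      assert (C := Hm v Hv); cbv beta in C; fold M in C.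
      assert (0 < w * (1 - k * s0)) by (apply Rmult_lt_0_compat; lra).
      nra.
  (* The surviving case, in which the involution is s |-> s0^2 / s. *)
  - unfold k in Hk; lra.
  - exfalso.
    (* Now [sg] stays in the compact interval [s0 - 1/k, s0], where q is bounded by q m, although q
       (s0 + v) g^4 >= g^4; the time v = q m / k, where g = 1 + q m, is late enough for a
       contradiction. *)
    assert (Hkp : 0 < k) by nra.
    assert (Hb : 0 < s0 - / k).
    { apply (Rmult_lt_reg_r k); [exact Hkp|].
      replace ((s0 - / k) * k) with (k * s0 - 1) by (field; lra); lra. }
    assert (Gp : forall v, 0 <= v -> 0 < g v) by (intros v Hv; unfold g; nra).
    assert (Sp : forall v, 0 <= v -> s0 - / k <= sg v <= s0).
    { intros v Hv; assert (G := Gp v Hv); unfold sg.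
      assert (0 <= v / g v) by (apply Rdiv_le_0_compat; lra).
      assert (v / g v <= / k).
      { apply (Rmult_le_reg_r (g v)); [exact G|].
        replace (v / g v * g v) with v by (field; lra).
        unfold g; replace (/ k * (1 + k * v)) with (/ k + v) by (field; lra).
        assert (0 < / k) by (apply Rinv_0_lt_compat; lra); lra. }
      lra. }
    destruct (continuity_ab_maj q (s0 - / k) s0) as (m & Hm & Hm').
    + assert (0 < / k) by (apply Rinv_0_lt_compat; lra); lra.
    + intros c Hc; apply Cq; lra.
    + assert (HM := Hq1 m ltac:(lra)).
      set (v := q m / k).
      assert (Hv : 0 < v) by (apply Rdiv_lt_0_compat; lra).
      assert (Key' := Key v ltac:(lra) (fun t Ht => conj (Gp t (proj1 Ht))
        (Rlt_le_trans _ _ _ Hb (proj1 (Sp t (proj1 Ht)))))).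
      assert (B := Hm (sg v) (Sp v ltac:(lra))).
      assert (A := Hq1 (s0 + v) ltac:(lra)).
      assert (Gv : g v = 1 + q m) by (unfold g, v; field; lra).
      rewrite <- Key', Gv in B.
      assert (1 + q m <= (1 + q m) ^ 4).
      { replace ((1 + q m) ^ 4) with ((1 + q m) * ((1 + q m) * (1 + q m) * (1 + q m))) by ring.
        assert (1 <= (1 + q m) * (1 + q m)) by nra.
        assert (1 <= (1 + q m) * (1 + q m) * (1 + q m)) by nra; nra. }
      nra.
Qed.

End RamanujanUniqueness.

(** * Restriction to the imaginary axis and exclusion of the degenerate cases *)

Lemma Cexp_RtoC x : Cexp (RtoC x) = RtoC (exp x).
Proof.
  unfold Cexp, RtoC; cbn [Re Im fst snd]; rewrite cos_0, sin_0; f_equal; ring.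
Qed.

(* values on the imaginary axis, tau = i t / (2 pi) *)
Definition er (s : fps) (t : R) : R := Re (ev s (RtoC (exp (- t)))).

Lemma ev_RtoC s x : ev s (RtoC x) = RtoC (Series (fun n => s n * x ^ n)%R).
Proof.
  unfold ev; rewrite CSeries_eq.
  assert (E : forall n, RtoC (s n) * RtoC x ^ n = RtoC (s n * x ^ n)%R).
  { intros n; rewrite RtoC_mult, RtoC_pow; reflexivity. }
  unfold RtoC at 5; f_equal.
  - apply Series_ext; intros n; rewrite E; reflexivity.
  - apply Series_zero; intros n; rewrite E; reflexivity.
Qed.

Lemma ev_er s t : ev s (RtoC (exp (- t))) = RtoC (er s t).
Proof. unfold er; rewrite ev_RtoC; reflexivity. Qed.

Lemma Cmod_exp_lt_1 t : (0 < t)%R -> (Cmod (RtoC (exp (- t))) < 1)%R.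
Proof.
  intros Ht; rewrite Cmod_R, Rabs_pos_eq by (apply Rlt_le, exp_pos).
  rewrite <- exp_0; apply exp_increasing; lra.
Qed.

Lemma er_sub s s' t : good s -> good s' -> (0 < t)%R ->
  er (s - s')%fps t = (er s t - er s' t)%R.
Proof.
  intros Hs Hs' Ht; unfold er at 1.
  rewrite ev_sub, !ev_er by (try apply Cmod_exp_lt_1; assumption); reflexivity.
Qed.

Lemma er_mul s s' t : good s -> good s' -> (0 < t)%R ->
  er (s * s')%fps t = (er s t * er s' t)%R.
Proof.
  intros Hs Hs' Ht; unfold er at 1.
  rewrite ev_mul, !ev_er by (try apply Cmod_exp_lt_1; assumption).
  rewrite <- RtoC_mult; reflexivity.
Qed.

Lemma er_fz z t : er (fz z) t = IZR z.
Proof. unfold er, fz; rewrite ev_fc; reflexivity. Qed.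

Lemma er_derive s t : good s -> (0 < t)%R -> is_derive (er s) t (- er (fD s) t)%R.
Proof.
  intros Hs Ht.
  set (b := Ci / (2 * RtoC PI)).
  assert (NP : RtoC PI <> 0) by (intros E; apply RtoC_inj in E; revert E; apply PI_neq0).
  assert (Eb : tpi * b = - (1)).
  { unfold tpi, b.
    transitivity (Ci * Ci); [field; exact NP|].
    unfold Ci, Cmult, Copp, RtoC; cbn [fst snd]; f_equal; ring. }
  assert (En : forall x, nome (RtoC x * b) = RtoC (exp (- x))).
  { intros x; rewrite nome_eq, <- Cexp_RtoC; f_equal.
    transitivity (RtoC x * (tpi * b)); [ring|].
    rewrite Eb, RtoC_opp; ring. }
  assert (Hi : (0 < Im (0 + RtoC t * b))%R).
  { assert (L : (Cmod (nome (RtoC t * b)) < 1)%R) by (rewrite En; now apply Cmod_exp_lt_1).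
    rewrite Cmod_nome, <- exp_0 in L; apply exp_lt_inv in L.
    replace (0 + RtoC t * b) with (RtoC t * b) by ring.
    assert (P := PI_RGT_0); nra. }
  assert (D := CD_line Re _ 0 b t _ re_le_Cmod ltac:(reflexivity) Re_scal (CD_ev_nome s _ Hs Hi)).
  apply (is_derive_ext (V := R_NormedModule) _ (er s)) in D.
  - evar_last; [exact D|].
    replace (0 + RtoC t * b) with (RtoC t * b) by ring; rewrite En, ev_er.
    replace (tpi * RtoC (er (fD s) t) * b) with (RtoC (er (fD s) t) * (tpi * b)) by ring.
    rewrite Eb; simpl; ring.
  - intros x; unfold er; rewrite <- En.
    replace (0 + RtoC x * b) with (RtoC x * b) by ring; reflexivity.
Qed.

(** The divisor 1 alone suffices. Hence E4 dominates 1 / (1 - q) on the imaginary axis, the source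
    of both lower bounds in the reflection argument. *)
Lemma fQ_coef_ge_1 n : (1 <= fQ n)%R.
Proof.
  unfold fQ, fadd, fz; rewrite fmul_fc.
  destruct n as [|n]; [unfold Sk; rewrite LS_O; simpl; lra|].
  assert (H : (1 <= Sk 3 (S n))%R).
  { unfold Sk; rewrite LS_coef.
    set (f := fun k => (INR k ^ 3 * fwe 1 k (S n))%R).
    assert (Hf : forall k, (0 <= f k)%R).
    { intros k; apply Rmult_le_pos; [apply pow_le, pos_INR|apply fw_coef_bound]. }
    assert (H1 : forall m, (f 1%nat <= psum f (S m))%R).
    { induction m as [|m IH]; [simpl; lra|].
      change (psum f (S (S m))) with (psum f (S m) + f (S (S m)))%R.
      assert (P := Hf (S (S m))); lra. }
    eapply Rle_trans; [|apply H1].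
    unfold f, fwe, fw; rewrite Nat.mod_1_r; simpl; lra. }
  simpl fc; lra.
Qed.

Lemma er_fQ_ge t : (0 < t)%R -> (/ (1 - exp (- t)) <= er fQ t)%R.
Proof.
  intros Ht; unfold er; rewrite ev_RtoC; change (Re (RtoC ?x)) with x.
  assert (He : (0 < exp (- t) < 1)%R).
  { split; [apply exp_pos|]; rewrite <- exp_0; apply exp_increasing; lra. }
  set (e := exp (- t)) in *; cbn [Re RtoC fst].
  rewrite <- Series_geom by (rewrite Rabs_pos_eq; lra).
  apply Series_le.
  - intros n; assert (0 <= e ^ n)%R by (apply pow_le; lra).
    assert (H1 := fQ_coef_ge_1 n); split; [assumption|]; nra.
  - apply (ex_ext_R (fun n => Rabs (fQ n) * e ^ n)%R).
    + intros n; rewrite Rabs_pos_eq; [reflexivity|].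
      assert (H1 := fQ_coef_ge_1 n); lra.
    + apply good_fQ; lra.
Qed.

(* On the imaginary axis a zero of E6 is a zero of E2*. *)
Lemma er_fR_zero s : (0 < s)%R -> er fR s = 0%R -> (er fP s * s = 6)%R.
Proof.
  apply (ramanujan_reflection (er fP) (er fQ) (er fR)).
  - intros t Ht.
    assert (EP := f_equal (fun s => er s t) fD_fP).
    assert (EQ := f_equal (fun s => er s t) fD_fQ).
    assert (ER := f_equal (fun s => er s t) fD_fR); cbv beta in EP, EQ, ER.
    rewrite er_sub, !er_mul, er_fz in EP, EQ, ER by good_tac.
    rewrite (er_mul fQ fQ) in ER by good_tac.
    split; [|split]; (evar_last; [apply er_derive; [good_tac|exact Ht]|]; lra).
  - intros t Ht; eapply Rle_trans; [|apply er_fQ_ge, Ht].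
    assert (H : (exp (- t) < 1)%R) by (rewrite <- exp_0; apply exp_increasing; lra).
    assert (P := exp_pos (- t)).
    rewrite <- Rinv_1 at 1; apply Rinv_le_contravar; lra.
  - intros t Ht.
    assert (H : (exp (- t) < 1)%R) by (rewrite <- exp_0; apply exp_increasing; lra).
    assert (P := exp_ineq1_le (- t)).
    apply Rle_trans with (t * / (1 - exp (- t)))%R.
    + apply (Rmult_le_reg_r (1 - exp (- t))); [lra|].
      rewrite Rmult_assoc, Rinv_l by lra; lra.
    + apply Rmult_le_compat_l; [lra|apply er_fQ_ge, Ht].
Qed.

(** A real q forces sin(2 pi Re tau) = 0; the open strip leaves only Re tau = 0. *)
Lemma nome_real tau r : (Rabs (Re tau) < 1 / 2)%R -> nome tau = RtoC r ->
  Re tau = 0%R /\ (0 < r)%R.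
Proof.
  intros Hx E; rewrite nome_eq in E.
  assert (Et : tpi * tau = (- (2 * PI * Im tau), 2 * PI * Re tau)%R).
  { destruct tau as [x y]; unfold tpi, Cmult, Ci, RtoC, Re, Im; cbn [fst snd]; f_equal; ring. }
  rewrite Et in E; unfold Cexp in E; cbn [Re Im fst snd] in E.
  assert (Ei := f_equal snd E); assert (Er := f_equal fst E); cbn [fst snd RtoC] in Ei, Er.
  assert (Pe := exp_pos (- (2 * PI * Im tau))); assert (Pi := PI_RGT_0).
  apply Rmult_integral in Ei; destruct Ei as [Ei|Ei]; [lra|].
  apply Rabs_def2 in Hx.
  assert (H0 : Re tau = 0%R).
  { destruct (Rtotal_order (Re tau) 0) as [H|[H|H]]; [exfalso|exact H|exfalso].
    - assert (sin (2 * PI * Re tau) < 0)%R by (apply sin_lt_0_var; nra); lra.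
    - assert (0 < sin (2 * PI * Re tau))%R by (apply sin_gt_0; nra); lra. }
  split; [exact H0|].
  rewrite H0, Rmult_0_r, cos_0, Rmult_1_r in Er.
  change (exp (- (2 * PI * Im tau)) = r) in Er; lra.
Qed.

Lemma Xf_real tau r : C_infty tau -> Xf tau = RtoC r -> Re tau = 0%R /\ (0 < r)%R.
Proof.
  intros H Hr; assert (HF : (Rabs (Re tau) < 1 / 2)%R) by apply H.
  assert (E := nome_ratio_eq tau H); unfold nome_ratio in E.
  rewrite Hr, ev_RtoC, Cexp_RtoC, Cexp_opp, <- nome_eq in E.
  set (e := exp (Series (fun n => fh n * r ^ n)%R)) in *.
  assert (Nq : nome tau <> 0) by apply Cexp_neq_0.
  assert (E2 : RtoC r * RtoC e = 27 * nome tau).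
  { transitivity (RtoC r * RtoC e * / nome tau * nome tau); [field; exact Nq|].
    rewrite E; reflexivity. }
  assert (En : nome tau = RtoC (r * e / 27)).
  { rewrite RtoC_div, RtoC_mult, E2 by lra; field. }
  destruct (nome_real tau _ HF En) as [H0 Hp]; split; [exact H0|].
  assert (0 < e)%R by apply exp_pos; nra.
Qed.

Lemma E2star_zero tau : C_infty tau -> ev fR (nome tau) = 0 ->
  ev fP (nome tau) = 6 * RtoC (/ (2 * PI * Im tau)).
Proof.
  intros H HR; destruct (C_infty_Omega tau H) as (Hi & Ha & Hx).
  assert (Hq := nome_lt_1 tau Hi).
  assert (E := ev_fR_Xf tau (C_infty_Omega tau H)).
  rewrite E in HR.
  assert (HX : 1 - 20 * Xf tau - 8 * (Xf tau * Xf tau) = 0).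
  { set (p := 1 - 20 * Xf tau - 8 * (Xf tau * Xf tau)) in *.
    transitivity (ev fa (nome tau) ^ 6 * p / ev fa (nome tau) ^ 6).
    - field; exact Ha.
    - rewrite HR; field; exact Ha. }
  (* Both roots (-5 +- sqrt 27) / 4 of the quadratic are real, so [Xf_real] applies whichever one x
     is. *)
  assert (HS : exists r, Xf tau = RtoC r).
  { set (x := Xf tau) in *.
    assert (Hs : RtoC (sqrt 27) * RtoC (sqrt 27) = 27).
    { rewrite <- RtoC_mult, sqrt_sqrt by lra; reflexivity. }
    assert (P : (4 * x + 5 - RtoC (sqrt 27)) * (4 * x + 5 + RtoC (sqrt 27)) = 0).
    { transitivity (16 * (x * x) + 40 * x + 25 - RtoC (sqrt 27) * RtoC (sqrt 27)); [ring|].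
      rewrite Hs; transitivity (- (2) * (1 - 20 * x - 8 * (x * x))); [ring|].
      rewrite HX; ring. }
    assert (Q : forall z w, z * w = 0 -> z = 0 \/ w = 0).
    { intros z w E0; destruct (classic (z = 0)), (classic (w = 0)); try tauto.
      exfalso; revert E0; now apply Cmult_neq_0. }
    destruct (Q _ _ P) as [Z|Z].
    - exists ((sqrt 27 - 5) / 4)%R; rewrite RtoC_div, RtoC_minus by lra.
      transitivity ((4 * x + 5 - RtoC (sqrt 27) + RtoC (sqrt 27) - 5) / 4); [field|].
      rewrite Z; field.
    - exists ((- sqrt 27 - 5) / 4)%R; rewrite RtoC_div, RtoC_minus, RtoC_opp by lra.
      transitivity ((4 * x + 5 + RtoC (sqrt 27) - RtoC (sqrt 27) - 5) / 4); [field|].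
      rewrite Z; field. }
  destruct HS as [r Hr]; destruct (Xf_real tau r H Hr) as [H0 _].
  set (s := (2 * PI * Im tau)%R).
  assert (P := PI_RGT_0).
  assert (Hs : (0 < s)%R) by (unfold s; nra).
  assert (En : nome tau = RtoC (exp (- s))).
  { rewrite nome_eq, <- Cexp_RtoC; f_equal; unfold s.
    destruct tau as [x y]; cbn [Re Im fst snd] in H0 |- *; subst x.
    unfold tpi, Cmult, Ci, RtoC; cbn [fst snd]; f_equal; ring. }
  assert (HR' : er fR s = 0%R).
  { unfold er; rewrite <- En, E, HX.
    replace (ev fa (nome tau) ^ 6 * 0) with (RtoC 0) by ring; reflexivity. }
  assert (HP := er_fR_zero s Hs HR').
  rewrite En, ev_er; fold s.
  replace (er fP s) with (6 * / s)%R; [rewrite RtoC_mult; reflexivity|].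
  rewrite <- HP; field; lra.
Qed.

Lemma one_add_8_Xf tau : C_infty tau -> 1 + 8 * Xf tau <> 0.
Proof.
  intros H E.
  assert (HX : Xf tau = RtoC (- / 8)).
  { rewrite RtoC_opp, RtoC_inv by lra.
    transitivity ((1 + 8 * Xf tau - 1) / 8); [field|rewrite E; field]. }
  destruct (Xf_real tau _ H HX) as [_ P]; lra.
Qed.

(** * The derivative of F^2 and the final identity *)

Lemma CD_F_sq y : 1 - y <> 0 -> (Cmod (1 / (1 - y)) < 1)%R ->
  let x := 1 / (1 - y) in
  CD (fun y => F y ^ 2) y (2 * (ev fH x * (x * ev (fD fH) x))).
Proof.
  intros N Hx x.
  assert (D1 : CD (fun y => 1 - y) y (0 - 1)) by (apply CD_minus; [apply CD_const|apply CD_id]).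
  (* dx/dy = x^2; one factor x is absorbed below into the Euler derivative of F. *)
  assert (D2 : CD (fun y => 1 * / (1 - y)) y (x * x)).
  { eapply CD_eq; [|apply CD_scal; exact (CD_comp Cinv (fun y => 1 - y) y _ _ (CD_inv _ N) D1)].
    unfold x; field; exact N. }
  assert (D3 := CD_comp (ev fH) (fun y => 1 * / (1 - y)) y _ _ (CD_ev fH x good_fH Hx) D2).
  apply (CD_ext (fun y => ev fH (1 * / (1 - y)) * ev fH (1 * / (1 - y)))).
  - intros t; unfold F; rewrite hyp2F1_eq; unfold Cdiv; simpl; ring.
  - eapply CD_eq; [|exact (CD_mult _ _ _ _ _ D3 D3)].
    rewrite <- (ev_dif_mul fH x good_fH Hx).
    change (1 * / (1 - y)) with x; ring.
Qed.

Theorem mainTheorem14 :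
  forall (a b c d : Z) (tau : C),
    Z.gcd a (Z.gcd b c) = 1%Z ->
    (0 < a)%Z ->
    (- d = b ^ 2 - 4 * a * c)%Z ->
    tau = (RtoC (- IZR b) + Ci * RtoC (sqrt (IZR d))) / RtoC (2 * IZR a) ->
    RtoC (IZR a) * tau ^ 2 + RtoC (IZR b) * tau + RtoC (IZR c) = 0 ->
    C_infty tau ->
    exists dF2 : C,
      is_derive (fun x : C => F x ^ 2) (u tau) dF2 /\
      F (u tau) ^ 2 / 6 *
          ((u tau + 3)
           - (u tau ^ 2 + 18 * u tau - 27) / (u tau - 9) * s2 tau)
        - u tau * (u tau - 1) * dF2
      = RtoC (IZR a / (PI * sqrt (IZR d))) * (u tau - 1).
Proof.
  intros a b c d tau _ Ha _ Htau _ HC.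
  destruct (region_Omega tau (proj1 HC)) as [HO HX].
  assert (HO' := HO); destruct HO' as (Hi & Nth & Hx).
  assert (Hq := nome_lt_1 tau Hi).
  assert (HaR : (0 < IZR a)%R) by now apply IZR_lt.
  assert (Him : (Im tau = sqrt (IZR d) / (2 * IZR a))%R).
  { rewrite Htau; unfold Cdiv; rewrite <- RtoC_inv by lra.
    unfold Ci, RtoC, Cmult, Cplus, Im; cbn [fst snd]; field; lra. }
  (* This common value is [rho] below, and E2* = E2 - 6 rho. *)
  assert (Hrho : (IZR a / (PI * sqrt (IZR d)) = / (2 * PI * Im tau))%R).
  { assert (Hs : (sqrt (IZR d) = Im tau * (2 * IZR a))%R) by (rewrite Him; field; lra).
    rewrite Hs; field; assert (P := PI_RGT_0); repeat split; lra. }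
  assert (NC := ev_fC_neq_0 tau Hi).
  assert (Nx : Xf tau <> 0).
  { intros E; apply NC.
    transitivity (Xf tau * (ev fa (nome tau) * ev fa (nome tau) * ev fa (nome tau))).
    - unfold Xf; field; exact Nth.
    - rewrite E; ring. }
  assert (N1u : 1 - u tau <> 0).
  { rewrite one_sub_u by exact Hi; intros E.
    set (a3 := ev fa (nome tau) * ev fa (nome tau) * ev fa (nome tau)) in *.
    assert (Z : a3 = 0).
    { transitivity (a3 / ev fC (nome tau) * ev fC (nome tau)); [field; exact NC|].
      rewrite E; ring. }
    revert Z; unfold a3; repeat apply Cmult_neq_0; assumption. }
  assert (Eu : u tau = 1 - 1 / Xf tau).
  { rewrite <- HX; field; exact N1u. }
  assert (Hx' : (Cmod (1 / (1 - u tau)) < 1)%R) by (rewrite HX; exact Hx).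
  exists (2 * (ev fH (Xf tau) * (Xf tau * ev (fD fH) (Xf tau)))); split.
  { apply CD_is_derive; rewrite <- HX; exact (CD_F_sq (u tau) N1u Hx'). }
  assert (EF : F (u tau) = ev fH (Xf tau)) by (unfold F; rewrite HX; apply hyp2F1_eq).
  rewrite EF, Hrho.
  assert (HFt := C_infty_F_is_theta tau HC).
  assert (EG := F_is_theta_eq tau HO HFt).
  assert (HW := proj2 (proj1 HFt)); unfold wronskian in HW; rewrite EG in HW.
  rewrite ev_fD_fH in HW by exact Hx; rewrite EG.
  assert (N8 := one_add_8_Xf tau HC).
  set (rho := RtoC (/ (2 * PI * Im tau))).
  assert (Es : E2star tau = ev fP (nome tau) - 6 * rho).
  { unfold E2star; rewrite E2_eq by exact Hi; unfold rho; f_equal; f_equal.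
    rewrite <- RtoC_mult; f_equal; field; assert (P := PI_RGT_0); split; lra. }
  assert (EQ := ev_fQ_Xf tau HO); assert (ER := ev_fR_Xf tau HO).
  assert (Hz := E2star_zero tau HC); fold rho in Hz.
  assert (Eda := ev_fD_fa _ Hq).
  assert (EB := ev_fB_Xf tau HO).
  (* For u = 1 - 1/x one has u^2 + 18 u - 27 = (1 - 20 x - 8 x^2) / x^2 and u - 9 = - (1 + 8 x) / x,
     so E4 and E6 cancel and only - 1/x = u - 1 remains in front of E2*. *)
  assert (Key : ev fa (nome tau) ^ 2 * ((u tau ^ 2 + 18 * u tau - 27) / (u tau - 9) * s2 tau)
    = (u tau - 1) * (ev fP (nome tau) - 6 * rho)).
  { unfold s2; rewrite E4_eq, E6_eq, Es by exact Hi.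
    destruct (classic (ev fR (nome tau) = 0)) as [Z|Z].
    (* At a zero of E6 the factor E2* vanishes, so both sides are 0 whatever the value of E4 / 0. *)
    - rewrite (Hz Z); ring.
    - rewrite ER in Z.
      assert (Z' : 1 - 20 * Xf tau - 8 * (Xf tau * Xf tau) <> 0).
      { intros Z'; apply Z; rewrite Z'; ring. }
      rewrite EQ, ER, Eu; field; repeat split; try assumption.
      intros E; apply N8; replace (1 + 8 * Xf tau) with
        (- (Xf tau - 1 - 9 * Xf tau)) by ring; rewrite E; ring. }
  clear Hz ER EQ Es HX Hx' EF.
  set (th := ev fa (nome tau)) in *; set (x := Xf tau) in *.
  set (p := ev fP (nome tau)) in *; set (da := ev (fD fa) (nome tau)) in *.
  set (dg := ev (fD fH) x) in *.
  assert (Eda' : da = (th * (3 * (th * th) + p) - 4 * (th ^ 3 * (1 - x))) / 12)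
    by (rewrite <- EB, <- Eda; field).
  (* The vanishing Wronskian with F(x) = a, solved for the derivative of F. *)
  assert (Edg : (1 - x) * dg = da / (th * th)).
  { transitivity ((th * ((1 - x) * dg) - da * / (th * th) * th) / th + da / (th * th));
      [field; exact Nth|rewrite HW; field; exact Nth]. }
  set (K := (u tau ^ 2 + 18 * u tau - 27) / (u tau - 9) * s2 tau) in *.
  transitivity (th ^ 2 / 6 * (u tau + 3) - th ^ 2 * K / 6
    - u tau * (u tau - 1) * (2 * (th * (x * dg)))); [field|].
  rewrite Key.
  transitivity (th ^ 2 / 6 * (u tau + 3) - (u tau - 1) * (p - 6 * rho) / 6
    - 2 * th / x * ((1 - x) * dg)); [rewrite Eu; field; exact Nx|].
  (* Here p = E2 cancels between the s2 term and q da/dq, leaving rho (u - 1). *)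
  rewrite Edg, Eda', Eu; field; auto.
Qed.
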